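(* Let $d\ge 1$, $L>0$, $T>0$, and let $N\ge 2$ be an integer power of $2$. Let $(p_t)_{t\in[0,T]}$ be a family of probability density functions on $\mathbb{T}^d$ (so $p_t\ge 0$ and $\int_{\mathbb{T}^d}p_t(x)\,dx=1$) and $(V_t)_{t\in[0,T]}$ a family of real-valued functions on $\mathbb{T}^d$ such that $p_t$ satisfies the continuity equation $\frac{\partial}{\partial t}p_t(x)=-\nabla\cdot\big[p_t(x)\nabla V_t(x)\big]$ on $\mathbb{T}^d\times[0,T]$. Suppose that $\sqrt{p_t},\,V_t\in\mathsf{C}^{2(s+1)}$ for all $t\in[0,T]$, for some integer $s\ge (d+7)/4$, and that for every $x\in\mathbb{T}^d$ the functions $t\mapsto V_t(x)$, $t\mapsto \nabla^2\sqrt{p_t}(x)$ and $t\mapsto \nabla^2[V_t\sqrt{p_t}](x)$ are continuous on $[0,T]$. For $t\in[0,T]$ let $\ket{\psi_t}\in\mathbb{C}^{N^d}$ be the unit vector proportional to $\sum_{x\in\mathbb{X}_N^d}\sqrt{p_t(x)}\ket{x}$. Let $\ket{\phi_0}\in\mathbb{C}^{N^d}$ be a unit vector and let $\ket{\phi_t}$ be the solution of $i\frac{d}{dt}\ket{\phi_t}=H_t^c\ket{\phi_t}$ on $[0,T]$ with this initial condition, where $H_t^c=i[K,D_{V_t}]$. Define $$c_s=3\max_{t\in[0,T]}\Big[\big(\|V_t\|_{\mathsf{L}^\infty}+1\big)\big\|\nabla^{2(s+1)}\sqrt{p_t}\big\|_{\mathsf{L}^2}+\big\|\nabla^{2(s+1)}(V_t\sqrt{p_t})\big\|_{\mathsf{L}^2}\Big]+1$$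 and $$\delta=\big\|\ket{\psi_0}-\ket{\phi_0}\big\|+T\,c_s\Big(\frac{Ld}{N}\Big)^{2s},$$ where $\|\cdot\|$ is the Euclidean norm. If $\delta\le T$, then $\big\|\ket{\psi_T}-\ket{\phi_T}\big\|\le\delta$.
   Context: $\mathbb{T}^d$ denotes the cube $[0,L]^d$ with opposite faces identified. $\mathbb{X}_N=\frac{L}{N}\{0,1,\dots,N-1\}$ and $\mathbb{X}_N^d\subset\mathbb{T}^d$ is the uniform grid of $N^d$ points. For $x=(x_1,\dots,x_d)\in\mathbb{X}_N^d$, $\ket{x}=\ket{x_1N/L}\otimes\cdots\otimes\ket{x_dN/L}\in\mathbb{C}^{N^d}$, where $\ket{j}$, $j\in\{0,\dots,N-1\}$, is the standard basis of $\mathbb{C}^N$. Define $N\times N$ matrices $F=\frac{1}{\sqrt N}\sum_{j,\ell=0}^{N-1}e^{2\pi i j\ell/N}\ket{j}\!\bra{\ell}$, $S=\sum_{j=0}^{N-1}(-1)^j\ket{j}\!\bra{j}$, $D_K=(2\pi/L)^2\sum_{j=0}^{N-1}(j-N/2)^2\ket{j}\!\bra{j}$, and the $N^d\times N^d$ matrix $K=\frac12\big(SFD_KF^\dagger S^\dagger\big)^{\oplus d}$, where $M^{\oplus d}=\sum_{j=1}^d I^{\otimes(j-1)}\otimes M\otimes I^{\otimes(d-j)}$ is the $d$-fold Kronecker sum. For a function $V$ on $\mathbb{T}^d$, $D_V=\sum_{x\in\mathbb{X}_N^d}V(x)\ket{x}\!\bra{x}$. $\|f\|_{\mathsf{L}^2}=(\int_{\mathbb{T}^d}|f|^2dx)^{1/2}$,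 $\|f\|_{\mathsf{L}^\infty}=\max_{x\in\mathbb{T}^d}|f(x)|$; $\nabla^{2m}f$ denotes the Laplacian applied $m$ times to $f$. $\mathsf{C}^k$ is the space of functions $f:\mathbb{T}^d\to\mathbb{C}$ all of whose partial derivatives $\partial^{\kappa}f$ with $\|\kappa\|_1\le k$ are continuous on $\mathbb{T}^d$ (including across the periodic boundaries). $\sqrt{p_t}$ and $V_t\sqrt{p_t}$ denote pointwise operations. *)

(* Defs.v *)
From HB Require Import structures.
From mathcomp Require Import all_boot all_order all_algebra.
From mathcomp Require Import all_classical all_reals all_analysis.
From mathcomp Require Import complex.
Unset Printing Implicit Defensive.
Import Order.TTheory GRing.Theory Num.Theory.
Import numFieldNormedType.Exports.
Local Open Scope classical_set_scope.
Local Open Scope ring_scope.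

Section Defs.
Context {R : realType}.

Definition evec (d : nat) (i : 'I_d) : 'rV[R]_d := delta_mx 0 i.

(* L-periodicity in each coordinate: f is a function on T^d = [0,L]^d / ~ *)
Definition torus_periodic (d : nat) (L : R) (f : 'rV[R]_d -> R) : Prop :=
  forall (i : 'I_d) (x : 'rV[R]_d), f (x + L *: evec d i) = f x.

Definition partial (d : nat) (i : 'I_d) (f : 'rV[R]_d -> R) : 'rV[R]_d -> R :=
  fun x => 'D_(evec d i) f x.

Fixpoint Ck (d : nat) (k : nat) (f : 'rV[R]_d -> R) : Prop :=
  match k with
  | 0 => continuous f
  | k'.+1 => continuous f /\
      forall i : 'I_d, (forall x, derivable f x (evec d i)) /\ Ck d k' (partial d i f)
  end.

(* Laplacian and its iterates: nabla^{2m} f = lap^m f *)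
Definition lap (d : nat) (f : 'rV[R]_d -> R) : 'rV[R]_d -> R :=
  fun x => \sum_(i < d) partial d i (partial d i f) x.

Definition lapn (d m : nat) (f : 'rV[R]_d -> R) : 'rV[R]_d -> R :=
  iter m (lap d) f.

Definition div_p_gradV (d : nat) (p V : 'rV[R]_d -> R) : 'rV[R]_d -> R :=
  fun x => \sum_(i < d) partial d i (fun y => p y * partial d i V y) x.

(* Integral over the cube [0,L]^d, as an iterated Lebesgue integral
   (coordinates listed in s are integrated out, over [0,L] each). *)
Definition upd (d : nat) (x : 'rV[R]_d) (i : 'I_d) (y : R) : 'rV[R]_d :=
  x + (y - x 0 i) *: evec d i.

Fixpoint iint (d : nat) (L : R) (s : seq 'I_d) (f : 'rV[R]_d -> R)
    (x : 'rV[R]_d) : R :=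
  match s with
  | [::] => f x
  | i :: s' => Rintegral lebesgue_measure `[0, L]%classic
                 (fun y => iint d L s' f (upd d x i y))
  end.

Definition torus_int (d : nat) (L : R) (f : 'rV[R]_d -> R) : R :=
  iint d L (enum 'I_d) f 0.

Definition L2norm (d : nat) (L : R) (f : 'rV[R]_d -> R) : R :=
  Num.sqrt (torus_int d L (fun x => f x ^+ 2)).

Definition cube (d : nat) (L : R) : set 'rV[R]_d :=
  [set x | forall i : 'I_d, 0 <= x 0 i <= L].

Definition Linfnorm (d : nat) (L : R) (f : 'rV[R]_d -> R) : R :=
  sup [set `|f x| | x in @cube d L].

(* derivative on [0,T] (one-sided at the endpoints) *)
Definition has_deriv_on (T : R) (f : R -> R) (t l : R) : Prop :=
  (fun h => h^-1 * (f (t + h) - f t)) @ within [set h | h != 0 /\ 0 <= t + h <= T] (nbhs 0)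
    --> l.

Local Open Scope complex_scope.
Local Notation C := R[i].

(* grid index k = (k_1,...,k_d) in {0..N-1}^d ; |x> = |k_1> (x) ... (x) |k_d> *)
Definition gidx (d N : nat) := {ffun 'I_d -> 'I_N}.

Definition gridpt (d N : nat) (L : R) (k : gidx d N) : 'rV[R]_d :=
  \row_i (L / N%:R * (k i)%:R).

Definition cvec (d N : nat) := gidx d N -> C.
Definition cop (d N : nat) := gidx d N -> gidx d N -> C.

Definition vnorm (d N : nat) (v : cvec d N) : R :=
  Num.sqrt (\sum_k (complex.Re (v k) ^+ 2 + complex.Im (v k) ^+ 2)).

Definition opmul (d N : nat) (A B : cop d N) : cop d N :=
  fun k k' => \sum_m A k m * B m k'.

Definition opapp (d N : nat) (A : cop d N) (v : cvec d N) : cvec d N :=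
  fun k => \sum_m A k m * v m.

Definition expi (x : R) : C := cos x +i* sin x.

Definition adjmx (N : nat) (M : 'M[C]_N) : 'M[C]_N := \matrix_(i, j) (M j i)^*.

Definition Fmx (N : nat) : 'M[C]_N :=
  \matrix_(j, l) (((Num.sqrt N%:R)^-1)%:C * expi (2 * pi * (j%:R * l%:R) / N%:R)).

Definition Smx (N : nat) : 'M[C]_N :=
  \matrix_(j, l) ((j == l)%:R * ((-1) ^+ j)%:C).

Definition DKmx (N : nat) (L : R) : 'M[C]_N :=
  \matrix_(j, l) ((j == l)%:R *
     (((2 * pi / L) ^+ 2) * ((j%:R - N%:R / 2) ^+ 2))%:C).

(* M^{(+)d} in the tensor-product basis |k_1>...|k_d> *)
Definition kron_sum (d N : nat) (M : 'M[C]_N) : cop d N :=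
  fun k k' => \sum_(j < d)
     (M (k j) (k' j) * ([forall i, (i != j) ==> (k i == k' i)])%:R).

Definition Kop (d N : nat) (L : R) : cop d N :=
  fun k k' => (2^-1)%:C *
    kron_sum d N (Smx N *m Fmx N *m DKmx N L *m adjmx N (Fmx N) *m adjmx N (Smx N)) k k'.

Definition DVop (d N : nat) (L : R) (V : 'rV[R]_d -> R) : cop d N :=
  fun k k' => (k == k')%:R * (V (gridpt d N L k))%:C.

Definition Hc (d N : nat) (L : R) (V : 'rV[R]_d -> R) : cop d N :=
  fun k k' => 'i * (opmul d N (Kop d N L) (DVop d N L V) k k'
                    - opmul d N (DVop d N L V) (Kop d N L) k k').

Definition gridvec (d N : nat) (L : R) (p : 'rV[R]_d -> R) : cvec d N :=
  fun k => (Num.sqrt (p (gridpt d N L k)))%:C.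

Definition psivec (d N : nat) (L : R) (p : 'rV[R]_d -> R) : cvec d N :=
  fun k => ((vnorm d N (gridvec d N L p))^-1)%:C * gridvec d N L p k.

Definition has_cderiv_on (T : R) (f : R -> C) (t : R) (z : C) : Prop :=
  has_deriv_on T (fun u => complex.Re (f u)) t (complex.Re z) /\
  has_deriv_on T (fun u => complex.Im (f u)) t (complex.Im z).

End Defs.

(* Main.v *)
(** Fourier series are replaced by exact discrete Fourier analysis on refinements
    of the grid.  A finer grid with [N (2 r + 1)] points per direction has frequencies
    [l + N (m - r)], all of which alias to the coarse frequency [l]; the finite-difference
    Laplacian is diagonal there, with symbol at least [16 |nu|^2 / L^2] by Jordan's
    inequality.  A weighted Cauchy-Schwarz inequality over the aliases [m] bounds the
    difference between [K] and [- lap / 2] on the coarse grid by the fine-grid energy of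
    the [(s+1)]-st discrete Laplacian times a lattice sum converging since [4 s >= d + 7].
    As [r] tends to infinity the energy tends to [L2norm (lapn (s+1) f) ^ 2].  The same
    argument bounds the norm of [sqrt p] on the grid from below; this is where
    [delta <= T] enters.  The continuity equation says that [sqrt (p t)] solves
    [u' = (V lap u - lap (V u)) / 2], so the sampled amplitude satisfies the discrete
    Schroedinger equation up to a residual.  Normalising only removes the component of
    the residual along [u], and the unitary flow preserves distances, so the error grows
    at rate at most [cs (L d / N)^(2 s)]. *)

Require Import Defs.
From HB Require Import structures.
From mathcomp Require Import all_boot all_order all_algebra.
From mathcomp Require Import all_classical all_reals all_analysis.
From mathcomp Require Import complex ring lra zify.
Import Order.TTheory GRing.Theory Num.Theory.
Import numFieldNormedType.Exports.
Local Open Scope classical_set_scope.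
Local Open Scope ring_scope.

(** * Calculus on the line *)

Section RealCalculus.
Set Implicit Arguments.
Unset Strict Implicit.
Context {R : realType}.
Implicit Types (f g u v w : R -> R) (a b x y t T : R).

(** On each grid every sum is finite, so the only limits are those of difference quotients and of
    Riemann sums, which uniform continuity on the torus controls. Within an alias class the central
    alias [m = r] is special: it brings no power of [1 / N], only the discrepancy between the
    difference Laplacian and the symbol of [K] at one fixed frequency, and letting [r] tend to
    infinity removes it. The other aliases carry the true error. There the symbol difference costs
    two powers of the weight, so [s + 1] Laplacians yield order [2 s]. Constants: the lattice sum is
    at most [(L d / N)^(4 s) / 64]; the symbol difference multiplies it by 4, the two functions
    [sqrt p] and [V sqrt p] by 2, and the resulting [1/8] stays below the lower bound [1/4] for the
    sampled mass. In [cs], the inner [+ 1] makes the bracket dominate the norm of the iterated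
    Laplacian of [sqrt p]; the outer one turns [delta <= T] into [(L d / N)^(2 s) <= 1]. The density
    may vanish, and [sqrt] is not differentiable at 0. At such points the right-hand side of the
    amplitude equation vanishes as well, and its continuity in time rescues the derivative. *)

Lemma is_derive_continuous f x l : is_derive x 1 f l -> {for x, continuous f}.
Proof. by move=> h; apply: differentiable_continuous; apply/derivable1_diffP; apply: (@ex_derive _ _ _ _ _ _ _ h). Qed.

Lemma MVT_everywhere f g a b : a < b -> (forall x, is_derive x 1 f (g x)) ->
  exists2 c, c \in `]a, b[%R & f b - f a = g c * (b - a).
Proof.
move=> ab df; apply: MVT => //; apply: continuous_subspaceT => x.
exact: (is_derive_continuous (df x)).
Qed.

Lemma is_derive_shift f g h : (forall x, is_derive x 1 f (g x)) ->
  forall x, is_derive x 1 (fun y => f (y + h)) (g (x + h)).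
Proof.
move=> df x.
have H : is_derive x 1 (fun y : R => y + h) (1 + 0) by apply: is_deriveD.
have := @is_derive1_comp _ f (fun y => y + h) x _ _ (df (x + h)) H.
by rewrite addr0 mulr1.
Qed.

(** The mean value theorem is applied first to [u (y + h) - u y] on [[-h, 0]], then to [v] on an
    interval of length [h]. *)
Lemma second_difference_MVT u v w h : 0 < h ->
  (forall x, is_derive x 1 u (v x)) -> (forall x, is_derive x 1 v (w x)) ->
  exists2 c, `|c| <= h & u h + u (- h) - 2 * u 0 = h ^+ 2 * w c.
Proof.
move=> h0 du dv.
have dphi x : is_derive x 1 (fun y => u (y + h) - u y) (v (x + h) - v x).
  by apply: is_deriveB; apply: is_derive_shift.
have [|c1 /[!in_itv] /= /andP[c1l c1r] E1] := @MVT_everywhere _ _ (- h) 0 _ dphi; first by lra.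
have [|c2 /[!in_itv] /= /andP[c2l c2r] E2] := @MVT_everywhere v w c1 (c1 + h) _ dv; first by lra.
exists c2; first by rewrite ler_norml; apply/andP; split; lra.
move: E1; rewrite add0r addNr opprK E2 add0r => E1.
have -> : u h + u (- h) - 2 * u 0 = u h - u 0 - (u 0 - u (- h)) by ring.
by rewrite E1; ring.
Qed.

Lemma sin_MVT a b : a < b -> exists2 c, a < c < b & sin b - sin a = cos c * (b - a) :> R.
Proof.
move=> ab; have [c] := @MVT_everywhere sin cos a b ab (fun x => is_derive_sin x).
by rewrite in_itv /= => cab E; exists c.
Qed.

(** Concavity through the mean value theorem: [cos] decreases, so the chord of [sin] over [[0, x]]
    is steeper than the one over [[x, pi / 2]]. *)
Lemma jordan_sin x : 0 <= x -> x <= pi / 2 -> 2 * x <= pi * sin x.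
Proof.
have pi0 : 0 < pi :> R := pi_gt0 R.
rewrite le_eqVlt => /orP[/eqP <- _|x0]; first by rewrite sin0 !mulr0.
rewrite le_eqVlt => /orP[/eqP -> |xp]; first by rewrite sin_pihalf; lra.
have [c /andP[c0 cx]] := sin_MVT x0; rewrite sin0 !subr0 => E1.
have [c' /andP[c'0 c'x]] := sin_MVT xp; rewrite sin_pihalf => E2.
have cc : cos c' < cos c.
  rewrite ltr_cos ?in_itv//=; first exact: (lt_trans cx).
  - by apply/andP; split; lra.
  - by apply/andP; split; lra.
have : 0 <= (cos c - cos c') * (x * (pi / 2 - x)).
  by rewrite mulr_ge0 ?mulr_ge0//; lra.
have -> : (cos c - cos c') * (x * (pi / 2 - x)) =
  (cos c * x) * (pi / 2 - x) - (cos c' * (pi / 2 - x)) * x by ring.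
by rewrite -E1 -E2; lra.
Qed.

Lemma sqr_sin_jordan x : `|x| <= pi / 2 -> (2 * x / pi) ^+ 2 <= sin x ^+ 2.
Proof.
move=> xp; have pi0 : 0 < pi :> R := pi_gt0 R.
have J := jordan_sin (normr_ge0 x) xp.
have -> : sin x ^+ 2 = sin `|x| ^+ 2.
  by case: (ger0P x) => // _; rewrite sinN sqrrN.
rewrite -(real_normK (num_real (2 * x / pi))) normrM normrM (gtr0_norm (_ : 0 < 2))//.
rewrite normrV ?unitf_gt0// (gtr0_norm pi0).
rewrite ler_sqr ?nnegrE ?divr_ge0 ?mulr_ge0 ?(ltW pi0)//.
- by rewrite ler_pdivrMr// mulrC (mulrC (sin _)) mulrC.
- by rewrite -(pmulr_rge0 _ pi0); apply: le_trans J; rewrite mulr_ge0.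
Qed.

(** Gives the limit of the difference symbol at a fixed frequency as the mesh shrinks, see
    [central_symbol_cvg]. *)
Lemma sin_lin_cvg (c : R) : (fun h => h^-1 * sin (c * h)) @ 0^' --> c.
Proof.
have H : is_derive (0:R) 1 (fun h : R => sin (c * h)) c.
  have H1 : is_derive (0 : R) 1 (fun h : R => c * h) (c *: 1).
    by apply: is_deriveZ.
  have := @is_derive1_comp _ sin (fun y => c * y) 0 _ _ (is_derive_sin _) H1.
  by rewrite mulr0 cos0 mul1r /GRing.scale /= mulr1.
have D : derivable (fun h : R => sin (c * h)) (0:R) (1:R) by apply: (@ex_derive _ _ _ _ _ _ _ H).
have E : 'D_(1:R) (fun h : R => sin (c * h)) 0 = c by apply: derive_val.
move: D; rewrite /derivable => D.
rewrite -[X in _ --> X]E; move: D.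
rewrite /derive /= => D.
set F := (X in X @ 0^' --> _).
set G := (X in cvg (X @ 0^')) in D.
have -> : F = G.
  by apply/funext => h; rewrite /F /G /= mulr0 sin0 subr0 addr0 /GRing.scale /= mulr1.
exact: D.
Qed.
End RealCalculus.

Section TimeDerivative.
Set Implicit Arguments.
Unset Strict Implicit.
Context {R : realType}.

Lemma norm_near0 (e : R) : 0 < e -> \forall h \near (0 : R), `|h| < e.
Proof. exact: pseudometric_normed_Zmodule.nbhs0_lt. Qed.

Implicit Types (f g u p : R -> R) (t T l : R).

Lemma has_deriv_on_interior T f t l : 0 < t < T -> has_deriv_on T f t l -> is_derive t 1 f l.
Proof.
move=> /andP[t0 tT] H.
have H' : (fun h => h^-1 *: ((f \o shift t) (h *: (1:R)) - f t)) @ 0^' --> l.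
  have E : (fun h => h^-1 *: ((f \o shift t) (h *: (1:R)) - f t)) = (fun h => h^-1 * (f (t + h) - f t)).
    by apply/funext => h /=; rewrite /GRing.scale /= mulr1 (addrC h).
  rewrite E; apply: cvg_trans H; apply: cvg_app.
  move=> A HA.
  have {}HA : \forall h \near (0 : R), h != 0 /\ 0 <= t + h <= T -> A h by exact: HA.
  suff : \forall h \near (0 : R), h != 0 -> A h by [].
  have N0 : \forall h \near (0:R), `|h| < Num.min t (T - t).
    by apply: norm_near0; rewrite lt_min t0 subr_gt0 tT.
  near=> h => hn0.
  have : `|h| < Num.min t (T - t) by near: h.
  rewrite lt_min !ltr_norml => /andP[/andP[a b] /andP[c d]].
  have : h != 0 /\ 0 <= t + h <= T -> A h by near: h.
  by apply; split => //; apply/andP; split; lra.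
split; first by apply/cvg_ex; exists l.
by apply/cvg_lim.
Unshelve. all: by end_near.
Qed.

(** Serves at the endpoints, where [has_deriv_on] is one-sided: the estimates below ask for a
    derivative inside and continuity up to the boundary. *)
Lemma has_deriv_on_continuous T f : 
  (forall t, 0 <= t <= T -> exists l, has_deriv_on T f t l) -> {within `[0, T], continuous f}.
Proof.
move=> H; apply/subspace_continuousP => t /= /[!in_itv] /= tT.
have [l Hl] := H t tT.
rewrite /has_deriv_on in Hl.
apply/cvgrPdist_le => /= e e0.
move/cvgrPdist_le : Hl => /(_ 1 ltr01) Hl.
have {Hl} : \forall h \near (0 : R), h != 0 /\ 0 <= t + h <= T -> `|l - h^-1 * (f (t + h) - f t)| <= 1.
  exact: Hl.
move=> Hl.
have el : 0 < e / (`|l| + 1) by rewrite divr_gt0// ltr_wpDl.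
have Hs : \forall h \near (0:R), `|h| < e / (`|l| + 1) by apply: norm_near0.
have {Hl Hs} : \forall h \near (0:R), 0 <= t + h <= T -> `|f t - f (t + h)| <= e.
  near=> h => thT.
  have [->|hn0] := eqVneq h 0; first by rewrite addr0 subrr normr0 ltW.
  have A : `|l - h^-1 * (f (t + h) - f t)| <= 1.
    have : h != 0 /\ 0 <= t + h <= T -> `|l - h^-1 * (f (t + h) - f t)| <= 1 by near: h.
    exact.
  have B : `|h| < e / (`|l| + 1) by near: h.
  have C : `|h^-1 * (f (t + h) - f t)| <= `|l| + 1.
    have -> : h^-1 * (f (t + h) - f t) = l - (l - h^-1 * (f (t + h) - f t)) by ring.
    by rewrite (le_trans (ler_normB _ _))// lerD2l.
  rewrite distrC; have -> : f (t + h) - f t = h * (h^-1 * (f (t + h) - f t)) by rewrite mulVKf.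
  rewrite normrM; apply: (@le_trans _ _ (e / (`|l| + 1) * (`|l| + 1))).
    by apply: ler_pM => //; exact: ltW.
  by rewrite divfK// gt_eqF// ltr_wpDl.
move=> Hn.
rewrite /prop_near1 /nbhs /= /within /=.
have := near_shift t 0 (fun h => 0 <= t + h <= T -> `|f t - f (t + h)| <= e).
rewrite /= => E.
move: Hn; rewrite E; apply: filterS => s /=.
rewrite sub0r; have -> : t + (s + - t) = s by ring.
by rewrite in_itv.
Unshelve. all: by end_near.
Qed.
End TimeDerivative.

Section TimeEstimates.
Set Implicit Arguments.
Unset Strict Implicit.
Context {R : realType}.
Implicit Types (f g u p E : R -> R) (a b t T l : R).

Lemma MVT_upper_bound f g a b k : a <= b -> {within `[a, b], continuous f} ->
  (forall t, a < t < b -> is_derive t 1 f (g t)) ->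
  (forall t, a < t < b -> g t <= k) -> f b - f a <= k * (b - a).
Proof.
rewrite le_eqVlt => /orP[/eqP <- _ _ _|ab cf df gk]; first by rewrite !subrr mulr0.
have df' t : t \in `]a, b[%R -> is_derive t 1 f (g t) by rewrite in_itv; exact: df.
have [c] := MVT ab df' cf.
by rewrite in_itv /= => cab ->; rewrite ler_wpM2r ?subr_ge0 ?(ltW ab) ?gk.
Qed.

Lemma MVT_norm_bound f g a b k : a <= b ->
  (forall t, a <= t <= b -> is_derive t 1 f (g t)) ->
  (forall t, a <= t <= b -> `|g t| <= k) -> `|f b - f a| <= k * (b - a).
Proof.
move=> ab df gk.
have cf : {within `[a, b], continuous f}.
  apply: derivable_within_continuous => t; rewrite in_itv /= => /df H.
  exact: (@ex_derive _ _ _ _ _ _ _ H).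
have W t : a < t < b -> a <= t <= b by move=> /andP[/ltW -> /ltW ->].
have cN : {within `[a, b], continuous (fun t => - f t)}.
  by move=> x; apply: cvgN; exact: cf.
rewrite ler_norml; apply/andP; split; last first.
  apply: (MVT_upper_bound ab cf (fun t h => df t (W t h))) => t /W /gk.
  by rewrite ler_norml => /andP[].
rewrite lerNl; have -> : - (f b - f a) = - f b - - f a by ring.
apply: (@MVT_upper_bound (fun t => - f t) (fun t => - g t)) => //.
  by move=> t /W /df h; apply: is_deriveN.
by move=> t /W /gk; rewrite ler_norml lerNl => /andP[].
Qed.

Lemma is_derive_sqrt_comp f t l : 0 < f t -> is_derive t 1 f l ->
  is_derive t 1 (fun s => Num.sqrt (f s)) ((2 * Num.sqrt (f t))^-1 * l).
Proof. by move=> f0 df; exact: (@is_derive1_comp _ Num.sqrt f t _ _ (is_derive1_sqrt f0) df). Qed.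

Lemma sqrt_regularization_le (x e : R) : 0 <= x -> 0 < e -> Num.sqrt (x + e ^+ 2) <= Num.sqrt x + e.
Proof.
move=> x0 e0.
rewrite -(ler_pXn2r (_ : (0 < 2)%N)) ?nnegrE ?addr_ge0 ?sqrtr_ge0 ?(ltW e0)//.
rewrite sqr_sqrtr ?addr_ge0 ?sqr_ge0// sqrrD sqr_sqrtr//.
by rewrite lerD2r lerDl mulrn_wge0// mulr_ge0 ?sqrtr_ge0// ltW.
Qed.

(** Formally [(sqrt E)' = E' / (2 sqrt E) <= k]. Since [E] may vanish, the argument is run for
    [sqrt (E + e^2)], whose derivative obeys the same bound, and [e] is then sent to 0. *)
Lemma sqrt_gronwall E E' (k T : R) : 0 <= T -> 0 <= k ->
  {within `[0, T], continuous E} ->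
  (forall t, 0 <= t <= T -> 0 <= E t) ->
  (forall t, 0 < t < T -> is_derive t 1 E (E' t)) ->
  (forall t, 0 < t < T -> E' t <= 2 * k * Num.sqrt (E t)) ->
  Num.sqrt (E T) <= Num.sqrt (E 0) + k * T.
Proof.
move=> T0 k0 cE E0 dE E'k.
have W t : 0 < t < T -> 0 <= t <= T by move=> /andP[/ltW -> /ltW ->].
apply/ler_addgt0Pr => e e0.
have e20 : 0 < e ^+ 2 by rewrite exprn_gt0.
pose f t := Num.sqrt (E t + e ^+ 2).
have : f T - f 0 <= k * (T - 0).
  apply: (@MVT_upper_bound f (fun t => (2 * f t)^-1 * E' t)) => //.
  - move=> x; apply: (@continuous_comp (subspace `[0, T]) R R (fun t => E t + e ^+ 2) Num.sqrt).
      by apply: cvgD; [exact: cE|exact: cvg_cst].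
    exact: sqrt_continuous.
  - move=> t tT; apply: (@is_derive_sqrt_comp (fun t => E t + e ^+ 2)).
      by rewrite ltr_wpDl// E0// W.
    rewrite -[E' t]addr0; apply: is_deriveD; exact: dE.
  - move=> t tT.
    have f0 : 0 < f t by rewrite sqrtr_gt0 ltr_wpDl// E0// W.
    rewrite mulrC ler_pdivrMr ?mulr_gt0//.
    rewrite (le_trans (E'k t tT))// mulrA (mulrC k 2) ler_wpM2l ?mulr_ge0// ler_wsqrtr//.
    by rewrite lerDl ltW.
rewrite subr0 lerBlDl => H.
have A : Num.sqrt (E T) <= f T by rewrite ler_wsqrtr// lerDl ltW.
have B : f 0 <= Num.sqrt (E 0) + e by apply: sqrt_regularization_le => //; apply: E0; rewrite lexx.
lra.
Qed.

(* Where [p] vanishes the square root is handled by differentiating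
   [sqrt (p + e^2)], whose derivative is bounded by [g] uniformly in [e]. *)
Lemma is_derive_sqrt_nonneg p g T :
  (forall t, 0 <= t <= T -> 0 <= p t) ->
  (forall t, 0 < t < T -> is_derive t 1 p (2 * Num.sqrt (p t) * g t)) ->
  (forall t, 0 < t < T -> {for t, continuous g}) ->
  (forall t, 0 < t < T -> p t = 0 -> g t = 0) ->
  forall t, 0 < t < T -> is_derive t 1 (fun s => Num.sqrt (p s)) (g t).
Proof.
move=> p0 dp cg gz t tT.
have W s : 0 < s < T -> 0 <= s <= T by move=> /andP[/ltW -> /ltW ->].
have := p0 t (W t tT); rewrite le_eqVlt => /orP[/eqP pt|pt]; last first.
  have := is_derive_sqrt_comp pt (dp t tT).
  rewrite mulrA mulVf ?mul1r// mulf_neq0// gt_eqF// sqrtr_gt0//.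
have g0 : g t = 0 by apply: gz.
pose u s := Num.sqrt (p s).
have ut : u t = 0 by rewrite /u -pt sqrtr0.
have H' : (fun h => h^-1 *: ((u \o shift t) (h *: (1:R)) - u t)) @ 0^' --> (0 : R).
  apply/cvgrPdist_le => /= e e0.
  have /cvgrPdist_le /(_ e e0) := cg t tT.
  rewrite g0 => cge.
  have {cge} : \forall s \near t, `|g s| <= e.
    by apply: filterS cge => s; rewrite sub0r normrN.
  rewrite -near_simpl => /nbhs_ballP [r /= r0 cge].
  have {}cge s : `|s - t| < r -> `|g s| <= e by move=> h; apply: cge; rewrite /ball /= distrC.
  move: tT => /andP[t0 tT].
  have N0 : \forall h \near (0:R), `|h| < Num.min r (Num.min t (T - t)).
    by apply: norm_near0; rewrite !lt_min r0 t0 subr_gt0 tT.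
  have : \forall h \near (0:R), h != 0 -> `|0 - h^-1 *: (u (h *: 1 + t) - u t)| <= e.
    apply: filterS N0 => h; rewrite !lt_min => /and3P[hr ht hT] hn0.
    rewrite sub0r normrN ut subr0 /GRing.scale /= mulr1 normrM normfV.
    rewrite mulrC ler_pdivrMr ?normr_gt0// ger0_norm ?sqrtr_ge0//.
    move: (ht) (hT); rewrite !ltr_norml => /andP[h1 h2] /andP[h3 h4].
    apply/ler_addgt0Pr => n n0.
    have n20 : 0 < n ^+ 2 by rewrite exprn_gt0.
    pose f s := Num.sqrt (p s + n ^+ 2).
    have df s : 0 < s < T -> is_derive s 1 f ((2 * f s)^-1 * (2 * u s * g s)).
      move=> sT; apply: (@is_derive_sqrt_comp (fun t => p t + n ^+ 2)).
        by rewrite ltr_wpDl// p0// W.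
      by rewrite -[2 * _ * _]addr0; apply: is_deriveD; exact: dp.
    have bf s : 0 < s < T -> `|s - t| < r -> `|(2 * f s)^-1 * (2 * u s * g s)| <= e.
      move=> sT sr; have f0 : 0 < f s by rewrite sqrtr_gt0 ltr_wpDl// p0// W.
      rewrite normrM gtr0_norm ?invr_gt0 ?mulr_gt0// mulrC ler_pdivrMr ?mulr_gt0//.
      rewrite normrM ger0_norm ?mulr_ge0 ?sqrtr_ge0// mulrC ler_pM ?mulr_ge0 ?sqrtr_ge0 ?cge//.
      by rewrite ler_wpM2l// ler_wsqrtr// lerDl ltW.
    (* As [p t = 0], [f t = n]. Hence [u (h + t) <= f (h + t) <= n + e |h|], and [n] is
       arbitrary. *)
    have uf : u (h + t) <= f (h + t) by rewrite ler_wsqrtr// lerDl ltW.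
    have ft : f t = n by rewrite /f -pt add0r sqrtr_sqr gtr0_norm.
    suff : `|f (h + t) - f t| <= e * `|h| by rewrite ft ler_norml => /andP[_]; lra.
    case: (ger0P h) => h0.
      rewrite (_ : e * h = e * (h + t - t)); last by ring.
      apply: MVT_norm_bound; first lra.
        by move=> s /andP[s1 s2]; apply: df; lra.
      move=> s /andP[s1 s2]; apply: bf; first lra.
      by apply: le_lt_trans hr; rewrite !ger0_norm; lra.
    have -> : `|f (h + t) - f t| = `|f t - f (h + t)| by rewrite distrC.
    rewrite (_ : e * - h = e * (t - (h + t))); last by ring.
    apply: MVT_norm_bound; first lra.
      by move=> s /andP[s1 s2]; apply: df; lra.
    move=> s /andP[s1 s2]; apply: bf; first lra.
    by apply: le_lt_trans hr; rewrite distrC ger0_norm ?ltr0_norm; lra.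
  by [].
rewrite g0; split; first by apply/cvg_ex; exists 0.
by apply/cvg_lim.
Qed.
End TimeEstimates.

(** * Finite Fourier analysis *)

Section FiniteFourier.
Set Implicit Arguments.
Unset Strict Implicit.
Context {R : realType}.
Local Notation C := R[i].
Local Notation Re := (@complex.Re R).
Local Notation Im := (@complex.Im R).
Local Notation cj := (@conjc R).
Local Open Scope complex_scope.

Lemma cReD (x y : C) : Re (x + y) = Re x + Re y. Proof. by case: x; case: y. Qed.
Lemma cImD (x y : C) : Im (x + y) = Im x + Im y. Proof. by case: x; case: y. Qed.
Lemma cReM (x y : C) : Re (x * y) = Re x * Re y - Im x * Im y. Proof. by case: x; case: y. Qed.
Lemma cImM (x y : C) : Im (x * y) = Re x * Im y + Im x * Re y. Proof. by case: x; case: y. Qed.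
Lemma cReN (x : C) : Re (- x) = - Re x. Proof. by case: x. Qed.
Lemma cImN (x : C) : Im (- x) = - Im x. Proof. by case: x. Qed.

Lemma cRe_sum (I : Type) (r : seq I) (P : pred I) (F : I -> C) :
  Re (\sum_(i <- r | P i) F i) = \sum_(i <- r | P i) Re (F i).
Proof. exact: (big_morph _ cReD). Qed.

Lemma cIm_sum (I : Type) (r : seq I) (P : pred I) (F : I -> C) :
  Im (\sum_(i <- r | P i) F i) = \sum_(i <- r | P i) Im (F i).
Proof. exact: (big_morph _ cImD). Qed.

Lemma cReMr (x : C) (a : R) : Re (x * a%:C) = Re x * a.
Proof. by rewrite cReM /= mulr0 subr0. Qed.

Lemma cImMr (x : C) (a : R) : Im (x * a%:C) = Im x * a.
Proof. by rewrite cImM /= mulr0 add0r. Qed.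

Definition nsq (z : C) : R := Re z ^+ 2 + Im z ^+ 2.

Lemma nsq_ge0 z : 0 <= nsq z. Proof. by rewrite addr_ge0 ?sqr_ge0. Qed.

Lemma nsqE z : (nsq z)%:C = z * cj z.
Proof.
case: z => a b; apply/eqP; rewrite eq_complex /nsq /=; apply/andP.
by split; apply/eqP; ring.
Qed.

Lemma nsqM x y : nsq (x * y) = nsq x * nsq y.
Proof. by case: x => a b; case: y => c e; rewrite /nsq /=; ring. Qed.

Lemma nsq_real (a : R) : nsq a%:C = a ^+ 2.
Proof. by rewrite /nsq /= expr0n addr0. Qed.

Lemma nsqD_le x y : nsq (x + y) <= 2 * nsq x + 2 * nsq y.
Proof.
rewrite /nsq cReD cImD -subr_ge0.
have -> : 2 * (Re x ^+ 2 + Im x ^+ 2) + 2 * (Re y ^+ 2 + Im y ^+ 2) -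
    ((Re x + Re y) ^+ 2 + (Im x + Im y) ^+ 2) = (Re x - Re y) ^+ 2 + (Im x - Im y) ^+ 2 by ring.
by rewrite addr_ge0 ?sqr_ge0.
Qed.

Lemma cauchy_schwarz_sum (I : finType) (a b : I -> R) :
  (\sum_i a i * b i) ^+ 2 <= (\sum_i a i ^+ 2) * (\sum_i b i ^+ 2).
Proof.
set P := \sum_i a i * b i; set A := \sum_i a i ^+ 2; set B := \sum_i b i ^+ 2.
have A0 : 0 <= A by apply: sumr_ge0 => i _; rewrite sqr_ge0.
have B0 : 0 <= B by apply: sumr_ge0 => i _; rewrite sqr_ge0.
have [B00|Bn0] := eqVneq B 0.
  have b0 i : b i = 0.
    apply/eqP; rewrite -sqrf_eq0; apply/eqP.
    by move/eqP: B00; rewrite psumr_eq0 => [/allP/(_ i)|j _]; rewrite ?mem_index_enum ?sqr_ge0// => /(_ isT)/eqP.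
  by rewrite /P big1 ?expr0n ?mulr_ge0// => i _; rewrite b0 mulr0.
have Bp : 0 < B by rewrite lt_neqAle eq_sym Bn0.
have : 0 <= \sum_i (a i * B - b i * P) ^+ 2 by apply: sumr_ge0 => i _; rewrite sqr_ge0.
have -> : \sum_i (a i * B - b i * P) ^+ 2 = B * (A * B - P ^+ 2).
  transitivity (\sum_i (B ^+ 2 * a i ^+ 2 - 2 * B * P * (a i * b i) + P ^+ 2 * b i ^+ 2)).
    by apply: eq_bigr => i _; ring.
  rewrite !big_split /= sumrN -!mulr_sumr -/A -/B -/P; ring.
by rewrite pmulr_rge0// subr_ge0.
Qed.

(* The weight may vanish where [b] does: Rocq's [0 / 0 = 0] is then harmless. *)
Lemma cauchy_schwarz_weighted (I : finType) (c : I -> C) (b w : I -> R) :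
  (forall i, 0 <= w i) -> (forall i, w i = 0 -> b i = 0) ->
  nsq (\sum_i c i * (b i)%:C) <= (\sum_i nsq (c i) * w i) * (\sum_i b i ^+ 2 / w i).
Proof.
move=> w0 wb.
have H (g : I -> R) : (\sum_i g i * b i) ^+ 2 <= (\sum_i g i ^+ 2 * w i) * (\sum_i b i ^+ 2 / w i).
  have -> : \sum_i g i * b i = \sum_i (g i * Num.sqrt (w i)) * (b i / Num.sqrt (w i)).
    apply: eq_bigr => i _; have [wi|wi] := eqVneq (w i) 0; first by rewrite wb// !mulr0 mul0r mulr0.
    have sn : Num.sqrt (w i) != 0 by rewrite gt_eqF// sqrtr_gt0 lt_neqAle eq_sym wi w0.
    by field.
  apply: (le_trans (cauchy_schwarz_sum _ _)); rewrite le_eqVlt; apply/orP; left; apply/eqP.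
  by congr (_ * _); apply: eq_bigr => i _; rewrite exprMn ?exprVn sqr_sqrtr.
rewrite /nsq cRe_sum cIm_sum.
under eq_bigr do rewrite cReMr.
under [X in _ + X ^+ 2]eq_bigr do rewrite cImMr.
under [X in _ <= X * _]eq_bigr do rewrite mulrDl.
by rewrite big_split /= mulrDl lerD.
Qed.

Lemma expiD (x y : R) : expi (x + y) = expi x * expi y.
Proof. by apply/eqP; rewrite eq_complex /expi /= cosD sinD eqxx addrC (mulrC (sin x)) eqxx. Qed.

Lemma expi0 : expi (0 : R) = 1.
Proof. by rewrite /expi cos0 sin0. Qed.

Lemma expi_conj (x : R) : cj (expi x) = expi (- x).
Proof. by rewrite /expi /= cosN sinN. Qed.

Lemma expi_mulrn (x : R) n : expi (x *+ n) = expi x ^+ n.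
Proof. by elim: n => [|n IH]; rewrite ?mulr0n ?expi0// mulrS expiD IH exprS. Qed.

Lemma expi_2pi : expi (2 * pi : R) = 1.
Proof. by rewrite /expi mulr_natl cos2pi sin2pi. Qed.

Lemma expi_2pi_int (z : int) : expi (2 * pi * z%:~R : R) = 1.
Proof.
case: z => n; first by rewrite -pmulrn mulr_natr expi_mulrn expi_2pi expr1n.
have -> : (Negz n)%:~R = - (n.+1%:R) :> R by rewrite NegzE rmorphN.
rewrite mulrN -expi_conj mulr_natr expi_mulrn expi_2pi expr1n.
exact: conjc1.
Qed.

Lemma expi_neq1 (x : R) : 0 < `|x| < 2 * pi -> expi x != 1.
Proof.
move=> /andP[x0 x2]; apply/negP => /eqP H.
have cx : cos `|x| = 1 by rewrite cos_norm; case: H.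
have s0 : 0 < sin (`|x| / 2) by apply: sin_gt0_pi; apply/andP; split; lra.
have : cos (`|x| / 2 *+ 2) = 1 by rewrite -[_ *+ 2]mulr_natr divfK.
rewrite cos_mulr2n cos2sin2 => E.
have : sin (`|x| / 2) ^+ 2 = 0 by lra.
by move/eqP; rewrite sqrf_eq0 gt_eqF.
Qed.

Lemma expi_geometric_sum N (a b : 'I_N) :
  \sum_(x < N) expi (2 * pi * (a%:R - b%:R) * x%:R / N%:R : R) = (N%:R : C) * (a == b)%:R.
Proof.
have N0 : (0 < N)%N by apply: leq_ltn_trans (ltn_ord a).
have NR : (N%:R : R) != 0 by rewrite pnatr_eq0 -lt0n.
have [->|ab] := eqVneq a b.
  under eq_bigr do rewrite subrr mulr0 !mul0r expi0.
  by rewrite sumr_const card_ord mulr1.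
rewrite mulr0; pose z : C := expi (2 * pi * (a%:R - b%:R) / N%:R).
under eq_bigr => x _.
  have -> : 2 * pi * (a%:R - b%:R) * x%:R / N%:R = (2 * pi * (a%:R - b%:R) / N%:R) *+ x :> R.
    by rewrite -[RHS]mulr_natr; ring.
  rewrite expi_mulrn -/z; over.
have zN : z ^+ N = 1.
  rewrite -expi_mulrn -[X in expi X]mulr_natr divfK//.
  by rewrite -[RHS](expi_2pi_int (a%:Z - b%:Z)) rmorphB.
have z1 : z != 1.
  apply: expi_neq1; rewrite !normrM normfV (normr_nat _ N) (gtr0_norm (_ : 0 < 2))// (gtr0_norm (pi_gt0 R)).
  have NRp : 0 < (N%:R : R) by rewrite ltr0n.
  have p0 := pi_gt0 R.
  have dab : 0 < `|a%:R - b%:R : R| by rewrite normr_gt0 subr_eq0 eqr_nat.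
  have dN : `|a%:R - b%:R : R| < N%:R.
    have aN : (a%:R : R) < N%:R by rewrite ltr_nat.
    have bN : (b%:R : R) < N%:R by rewrite ltr_nat.
    have a0 : 0 <= (a%:R : R) by rewrite ler0n.
    have b0 : 0 <= (b%:R : R) by rewrite ler0n.
    by rewrite ltr_norml; apply/andP; split; lra.
  rewrite divr_gt0 ?mulr_gt0//= ltr_pdivrMr// ltr_pM2l ?mulr_gt0//.
apply/eqP; have := subrX1 z N; rewrite zN subrr => /esym/eqP.
by rewrite mulf_eq0 subr_eq0 (negbTE z1).
Qed.

Lemma parseval_kernel (I J : finType) (U : I -> J -> C) (A : R) (v : J -> C) :
  (forall j j', \sum_i U i j * cj (U i j') = A%:C * (j == j')%:R) ->
  \sum_i nsq (\sum_j v j * U i j) = A * \sum_j nsq (v j).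
Proof.
move=> orth; apply: complexI; rewrite rmorphM !rmorph_sum /=.
have E i : (nsq (\sum_j v j * U i j))%:C = \sum_j \sum_j' (v j * U i j) * cj (v j' * U i j').
  by rewrite nsqE rmorph_sum mulr_suml; apply: eq_bigr => j _; rewrite mulr_sumr.
under eq_bigr do rewrite E.
rewrite exchange_big /= mulr_sumr; apply: eq_bigr => j _.
rewrite exchange_big /= (bigD1 j)//= [X in _ + X]big1 ?addr0.
  transitivity (v j * cj (v j) * (\sum_i U i j * cj (U i j))).
    by rewrite mulr_sumr; apply: eq_bigr => i _; rewrite rmorphM /=; ring.
  by rewrite orth eqxx mulr1 nsqE mulrC.
move=> j' jj'.
transitivity (v j * cj (v j') * (\sum_i U i j * cj (U i j'))).
  by rewrite mulr_sumr; apply: eq_bigr => i _; rewrite rmorphM /=; ring.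
by rewrite orth eq_sym (negbTE jj') !mulr0.
Qed.

(* Frequencies are shifted by [N/2], as in the basis diagonalising [K]. *)
Definition freq (N l : nat) : R := l%:R - N%:R / 2.

Definition char1 (N l x : nat) : C := expi (2 * pi * freq N l * x%:R / N%:R).

Definition char (d N : nat) (l x : gidx d N) : C := \prod_j char1 N (l j) (x j).

Lemma char1_orth_space N (l l' : 'I_N) :
  \sum_(x < N) char1 N l x * cj (char1 N l' x) = (N%:R : C) * (l == l')%:R.
Proof.
rewrite -expi_geometric_sum; apply: eq_bigr => x _.
by rewrite /char1 expi_conj -expiD /freq; congr expi; ring.
Qed.

Lemma char1_orth_freq N (x x' : 'I_N) :
  \sum_(l < N) char1 N l x * cj (char1 N l x') = (N%:R : C) * (x == x')%:R.
Proof.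
(* The prefactor comes from the shift of the frequencies by [N / 2]; it is 1 when [x = x'] and
   multiplies 0 otherwise. *)
transitivity (expi (- pi * (x%:R - x'%:R) : R) * ((N%:R : C) * (x == x')%:R)); last first.
  have [->|] := eqVneq x x'; last by rewrite !mulr0.
  by rewrite subrr mulr0 expi0 mul1r.
have N0 : (N%:R : R) != 0 by rewrite pnatr_eq0 -lt0n; apply: leq_ltn_trans (ltn_ord x).
rewrite -expi_geometric_sum mulr_sumr; apply: eq_bigr => l _.
by rewrite /char1 expi_conj -!expiD /freq; congr expi; field.
Qed.

Lemma prod_delta d (N : nat) (k k' : {ffun 'I_d -> 'I_N}) :
  \prod_j ((N%:R : C) * (k j == k' j)%:R) = ((N%:R : R) ^+ d)%:C * (k == k')%:R.
Proof.
rewrite big_split /= prodr_const card_ord rmorphXn rmorph_nat; congr (_ * _).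
have [->|kk'] := eqVneq k k'; first by rewrite big1// => j _; rewrite eqxx.
have [j kj] : exists j, k j != k' j.
  by apply/existsP; rewrite -negb_forall; apply: contra kk' => /forallP h; apply/eqP/ffunP => j; apply/eqP.
by rewrite (bigD1 j)//= (negbTE kj) mul0r.
Qed.

Lemma char_orth_space d N (l l' : gidx d N) :
  \sum_x char l x * cj (char l' x) = ((N%:R : R) ^+ d)%:C * (l == l')%:R.
Proof.
rewrite -prod_delta.
under [RHS]eq_bigr do rewrite -char1_orth_space.
rewrite bigA_distr_bigA /=; apply: eq_bigr => x _.
by rewrite rmorph_prod -big_split.
Qed.

Lemma char_orth_freq d N (x x' : gidx d N) :
  \sum_l char l x * cj (char l x') = ((N%:R : R) ^+ d)%:C * (x == x')%:R.
Proof.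
rewrite -prod_delta.
under [RHS]eq_bigr do rewrite -char1_orth_freq.
rewrite bigA_distr_bigA /=; apply: eq_bigr => l _.
by rewrite rmorph_prod -big_split.
Qed.

Lemma parseval_char d N (v : gidx d N -> C) :
  \sum_x nsq (\sum_l v l * char l x) = N%:R ^+ d * \sum_l nsq (v l).
Proof. by apply: parseval_kernel => l l'; exact: char_orth_space. Qed.

(** The factor [N^-d] sits in the forward transform, so coefficients from grids of different size
    are comparable and aliasing simply adds them. *)
Definition dft d N (F : gidx d N -> C) (l : gidx d N) : C :=
  ((N%:R ^+ d)^-1 : R)%:C * \sum_x F x * cj (char l x).

Lemma dft_inv d N (F : gidx d N -> C) x : (0 < N)%N -> F x = \sum_l dft F l * char l x.
Proof.
move=> N0; have NR : (N%:R ^+ d : R) != 0 by rewrite expf_neq0// pnatr_eq0 -lt0n.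
rewrite /dft.
transitivity (((N%:R ^+ d)^-1 : R)%:C * \sum_y F y * \sum_l char l x * cj (char l y)).
  under eq_bigr do rewrite char_orth_freq.
  rewrite (bigD1 x)//= eqxx big1 => [|y xy]; last by rewrite eq_sym (negbTE xy) !mulr0.
  by rewrite addr0 mulr1 mulrCA -rmorphM mulVf// mulr1.
rewrite mulr_sumr; under eq_bigr do rewrite !mulr_sumr.
rewrite exchange_big /=; apply: eq_bigr => l _.
by rewrite mulr_sumr mulr_suml; apply: eq_bigr => y _; ring.
Qed.
End FiniteFourier.

Section DiscreteLaplacian.
Set Implicit Arguments.
Unset Strict Implicit.
Context {R : realType}.
Local Notation C := R[i].
Local Notation cj := (@conjc R).
Local Notation "x %:C" := (@real_complex_def _ (Phant _) x) : ring_scope.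

Definition ord_upd d N (i : 'I_d) (f : 'I_N -> 'I_N) (x : gidx d N) : gidx d N :=
  [ffun j => if j == i then f (x j) else x j].

(** Evenness of [N] makes [freq N l] an integer. Therefore [char1] is [N]-periodic in [x], and the
    wrap-around from [N - 1] to [0] obeys the same rule as the other steps. *)
Lemma char1_ordS N (l x : 'I_N) : ~~ odd N ->
  char1 N l (ordS x) = char1 N l x * expi (2 * pi * freq N l / N%:R) :> C.
Proof.
move=> eN; have N0 : (0 < N)%N by apply: leq_ltn_trans (ltn_ord x).
have NR : (N%:R : R) != 0 by rewrite pnatr_eq0 -lt0n.
have E : char1 N l x * expi (2 * pi * freq N l / N%:R) = expi (2 * pi * freq N l * (x.+1)%:R / N%:R) :> C.
  by rewrite /char1 -expiD; congr expi; rewrite -natr1; field.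
rewrite E /char1 /=; have := ltn_ord x; rewrite -ltnS ltnS leq_eqVlt => /orP[/eqP xN|xN].
  rewrite xN modnn mulr0 mul0r expi0 mulfK//.
  rewrite -(expi_2pi_int (l%:Z - (N./2)%:Z)) rmorphB /=; congr (expi (_ * (_ - _))).
  have -> : (N%:R : R) = 2 * (N./2)%:R.
    by rewrite -natrM mul2n -[in LHS](odd_double_half N) (negbTE eN).
  by rewrite mulrAC divff ?mul1r// pnatr_eq0.
by rewrite modn_small.
Qed.

Lemma char_upd d N (i : 'I_d) (f : 'I_N -> 'I_N) (l x : gidx d N) (z : C) :
  char1 N (l i) (f (x i)) = char1 N (l i) (x i) * z ->
  char l (ord_upd i f x) = char l x * z.
Proof.
move=> H; rewrite /char (bigD1 i)//= [in RHS](bigD1 i)//= ffunE eqxx H.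
rewrite mulrAC; congr (_ * _ * _); apply: eq_bigr => j ji.
by rewrite ffunE (negbTE ji).
Qed.

Lemma char1_ord_pred N (l x : 'I_N) : ~~ odd N ->
  char1 N l (ord_pred x) = char1 N l x * expi (- (2 * pi * freq N l / N%:R)) :> C.
Proof.
move=> eN; rewrite -{2}(ord_predK x) char1_ordS//.
by rewrite -mulrA -expiD subrr expi0 mulr1.
Qed.

Definition dlap d N (h : R) (F : gidx d N -> C) (x : gidx d N) : C :=
  \sum_(i < d) ((h ^- 2)%:C * (F (ord_upd i (@ordS N) x) + F (ord_upd i (@ord_pred N) x) - 2 * F x)).

(** The eigenvalue of minus [dlap], written by means of [2 - 2 cos (2 y) = 4 sin(y)^2] so that its
    sign is visible. *)
Definition dlap_symbol d N (h : R) (l : gidx d N) : R :=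
  \sum_(i < d) 4 / h ^+ 2 * sin (pi * freq N (l i) / N%:R) ^+ 2.

Lemma dlap_symbol_ge0 d N h (l : gidx d N) : 0 <= dlap_symbol h l.
Proof. by apply: sumr_ge0 => i _; rewrite mulr_ge0 ?divr_ge0 ?sqr_ge0. Qed.

Lemma expi_second_difference (y : R) :
  expi (2 * y) + expi (- (2 * y)) - 2 = (- 4 * sin y ^+ 2)%:C :> C.
Proof.
have -> : 2 = (2%:R : R)%:C :> C by rewrite rmorph_nat.
apply/eqP; rewrite eq_complex /= sinN cosN mulr_natl cos_mulr2n cos2sin2.
by apply/andP; split; apply/eqP; ring.
Qed.

Lemma dlap_char d N h (l : gidx d N) x : ~~ odd N ->
  dlap h (char l) x = (- dlap_symbol h l)%:C * char l x.
Proof.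
move=> eN; rewrite /dlap /dlap_symbol -sumrN rmorph_sum mulr_suml; apply: eq_bigr => i _.
rewrite (char_upd (char1_ordS (l i) (x i) eN)) (char_upd (char1_ord_pred (l i) (x i) eN)).
transitivity ((h ^- 2)%:C * char l x * (expi (2 * pi * freq N (l i) / N%:R) + expi (- (2 * pi * freq N (l i) / N%:R)) - 2)); first by ring.
have -> : 2 * pi * freq N (l i) / N%:R = 2 * (pi * freq N (l i) / N%:R) :> R by rewrite !mulrA.
rewrite expi_second_difference mulrAC -rmorphM; congr (real_complex_def _ _ * _).
by rewrite mulrA mulrN mulNr [_ * 4]mulrC.
Qed.

Lemma dlap_sum d N h (I : finType) (c : I -> C) (F : I -> gidx d N -> C) x :
  dlap h (fun x => \sum_j c j * F j x) x = \sum_j c j * dlap h (F j) x.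
Proof.
rewrite /dlap; under [RHS]eq_bigr do rewrite mulr_sumr.
rewrite exchange_big /=; apply: eq_bigr => i _.
rewrite mulr_sumr -big_split -sumrB mulr_sumr; apply: eq_bigr => j _ /=; ring.
Qed.

Lemma iter_dlap_dft d N h n (F : gidx d N -> C) x : (0 < N)%N -> ~~ odd N ->
  iter n (dlap h) F x = \sum_l (dft F l * ((- dlap_symbol h l) ^+ n)%:C) * char l x.
Proof.
move=> N0 eN; elim: n x => [|n IH] x.
  by rewrite /= [LHS](dft_inv _ _ N0); apply: eq_bigr => l _; rewrite expr0 mulr1.
rewrite iterS (_ : iter n _ F = (fun x => \sum_l (dft F l * ((- dlap_symbol h l) ^+ n)%:C) * char l x)).
  by rewrite dlap_sum; apply: eq_bigr => l _; rewrite dlap_char// exprSr rmorphM; ring.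
by apply/funext.
Qed.

Lemma parseval_dlap d N h n (F : gidx d N -> C) : (0 < N)%N -> ~~ odd N ->
  \sum_x nsq (iter n (dlap h) F x) = N%:R ^+ d * \sum_l nsq (dft F l) * dlap_symbol h l ^+ (2 * n).
Proof.
move=> N0 eN; under eq_bigr do rewrite iter_dlap_dft//.
rewrite parseval_char; congr (_ * _); apply: eq_bigr => l _.
by rewrite nsqM nsq_real -exprM mulnC !exprM sqrrN.
Qed.
End DiscreteLaplacian.

Section Aliasing.
Set Implicit Arguments.
Unset Strict Implicit.
Context {R : realType}.
Local Notation C := R[i].
Local Notation "x %:C" := (@real_complex_def _ (Phant _) x) : ring_scope.

Lemma merge_ord_subproof N q (l : 'I_N) (m : 'I_q) : (l + N * m < N * q)%N.
Proof. by have := ltn_ord l; have := ltn_ord m; nia. Qed.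
Definition merge_ord N q (l : 'I_N) (m : 'I_q) : 'I_(N * q) := Ordinal (merge_ord_subproof l m).

Lemma refine_ord_subproof N q (x : 'I_N) : (0 < q)%N -> (x * q < N * q)%N.
Proof. by move=> q0; rewrite ltn_pmul2r. Qed.
Definition refine_ord N q (q0 : (0 < q)%N) (x : 'I_N) : 'I_(N * q) := Ordinal (refine_ord_subproof x q0).

(* The fine index [l + N m] has frequency [freq N l + N (m - r)] when [q = 2 r + 1],
   see [freq_merge]. *)
Definition merge d N q (l : gidx d N) (m : gidx d q) : gidx d (N * q) :=
  [ffun j => merge_ord (l j) (m j)].
Definition refine d N q (q0 : (0 < q)%N) (x : gidx d N) : gidx d (N * q) :=
  [ffun j => refine_ord q0 (x j)].

(** Euclidean division of every fine index by [N] groups the fine frequencies into alias classes. *)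
Lemma sum_merge d N q (V : nmodType) (G : gidx d (N * q) -> V) :
  \sum_k G k = \sum_l \sum_m G (merge l m).
Proof.
rewrite pair_big /= (reindex (fun lm : gidx d N * gidx d q => merge lm.1 lm.2)) //=.
have N0 (k : 'I_(N * q)) : (0 < N)%N.
  by have := leq_ltn_trans (leq0n k) (ltn_ord k); rewrite muln_gt0 => /andP[].
have lo (k : 'I_(N * q)) : (k %% N < N)%N by rewrite ltn_mod (N0 k).
have hi (k : 'I_(N * q)) : (k %/ N < q)%N.
  by rewrite ltn_divLR ?(N0 k)// (mulnC q).
exists (fun k : gidx d (N * q) => ([ffun j => Ordinal (lo (k j))], [ffun j => Ordinal (hi (k j))])).
  move=> [l m] _; congr pair; apply/ffunP => j; apply/val_inj; rewrite !ffunE /=.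
    by rewrite addnC mulnC modnMDl modn_small.
  by rewrite addnC mulnC divnMDl ?divn_small ?addn0//; apply: leq_ltn_trans (ltn_ord (l j)).
by move=> k _; apply/ffunP => j; apply/val_inj; rewrite !ffunE /= addnC mulnC -divn_eq.
Qed.

Lemma gridpt_refine d N q (q0 : (0 < q)%N) (L : R) (x : gidx d N) :
  gridpt d (N * q) L (refine q0 x) = gridpt d N L x.
Proof.
apply/rowP => j; rewrite !mxE ffunE /=.
have N0 : (0 < N)%N := leq_ltn_trans (leq0n _) (ltn_ord (x j)).
have NR : (N%:R : R) != 0 by rewrite pnatr_eq0 -lt0n.
have qR : (q%:R : R) != 0 by rewrite pnatr_eq0 -lt0n.
by rewrite !natrM; field; rewrite NR qR.
Qed.

(** This is the reason for an odd refinement factor: the shifts [N (2 r + 1) / 2] and [N / 2] differ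
    by [N r], a multiple of [N]. So fine frequencies alias to coarse ones, and each class is
    symmetric about [m = r]. *)
Lemma freq_merge N r (l : 'I_N) (m : 'I_(r.*2.+1)) :
  freq (N * r.*2.+1) (merge_ord l m) = freq N l + N%:R * (m%:R - r%:R) :> R.
Proof.
have E : (r.*2.+1)%:R = 2 * r%:R + 1 :> R by rewrite -natr1 -mul2n natrM.
by rewrite /freq /= natrD !natrM E; field.
Qed.

Lemma char1_alias N r (l x : 'I_N) (m : 'I_(r.*2.+1)) :
  char1 (N * r.*2.+1) (merge_ord l m) (refine_ord (ltn0Sn r.*2) x) = char1 N l x :> C.
Proof.
have N0 : (N%:R : R) != 0 by rewrite pnatr_eq0 -lt0n; apply: leq_ltn_trans (ltn_ord x).
have q0 : ((r.*2.+1)%:R : R) != 0 by rewrite pnatr_eq0.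
rewrite /char1 freq_merge /=.
rewrite -[RHS]mulr1 -(expi_2pi_int ((m%:Z - r%:Z) * x%:Z)) -expiD; congr expi.
have -> : ((m%:Z - r%:Z) * x%:Z)%:~R = (m%:R - r%:R) * x%:R :> R by rewrite rmorphM rmorphB.
rewrite !natrM; move: q0; set q : R := (r.*2.+1)%:R; move: q => q q0.
by field; rewrite N0 q0.
Qed.

Lemma char_alias d N r (l x : gidx d N) (m : gidx d r.*2.+1) :
  char (merge l m) (refine (ltn0Sn r.*2) x) = char l x :> C.
Proof. by apply: eq_bigr => j _; rewrite !ffunE char1_alias. Qed.
End Aliasing.

(** * Spectral decomposition of the kinetic operator *)

Section KineticOperator.
Set Implicit Arguments.
Unset Strict Implicit.
Context {R : realType}.
Local Notation C := R[i].
Local Notation cj := (@conjc R).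
Local Notation "x %:C" := (@real_complex_def _ (Phant _) x) : ring_scope.

Definition kin_symbol d N (L : R) (l : gidx d N) : R :=
  \sum_(j < d) (2 * pi / L) ^+ 2 * freq N (l j) ^+ 2.

Definition Kmx1 N (L : R) : 'M[C]_N :=
  Smx N *m Fmx N *m DKmx N L *m adjmx N (Fmx N) *m adjmx N (Smx N).

Lemma expi_Npi_nat (x : nat) : expi (- (pi * x%:R) : R) = ((-1) ^+ x)%:C.
Proof.
have -> : - (pi * x%:R) = (- pi : R) *+ x by rewrite -[RHS]mulr_natr mulNr.
rewrite expi_mulrn rmorphXn; congr (_ ^+ _).
by rewrite /expi cosN sinN cospi sinpi oppr0.
Qed.

(** The sign [(-1)^x] equals [expi (- pi x)], which is precisely the effect of lowering the
    frequency by [N / 2]. *)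
Lemma Smx_Fmx N (x l : 'I_N) :
  (Smx N *m Fmx N) x l = ((Num.sqrt N%:R)^-1)%:C * char1 N l x :> C.
Proof.
have N0 : (N%:R : R) != 0 by rewrite pnatr_eq0 -lt0n; apply: leq_ltn_trans (ltn_ord x).
rewrite !mxE (bigD1 x)//= !mxE eqxx mul1r big1 ?addr0 => [|y yx]; last first.
  by rewrite mxE eq_sym (negbTE yx) !mul0r.
rewrite mulrCA; congr (_ * _).
by rewrite -expi_Npi_nat -expiD /char1 /freq; congr expi; field.
Qed.

Lemma conjcMr (a : R) (z : C) : cj (a%:C * z) = a%:C * cj z.
Proof. by case: z => x y; apply/eqP; rewrite eq_complex /=; apply/andP; split; apply/eqP; ring. Qed.

Lemma conjc_mulr_conj (x y : C) : cj (x * cj y) = y * cj x.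
Proof.
case: x y => a b [c e]; apply/eqP; rewrite eq_complex /=.
by apply/andP; split; apply/eqP; ring.
Qed.

Lemma Kmx1E N L (x y : 'I_N) :
  Kmx1 N L x y = \sum_(l < N) (N%:R^-1 * ((2 * pi / L) ^+ 2 * freq N l ^+ 2))%:C
     * (char1 N l x * cj (char1 N l y)).
Proof.
have N0 : 0 < (N%:R : R) by rewrite ltr0n; apply: leq_ltn_trans (ltn_ord x).
have -> : Kmx1 N L = (Smx N *m Fmx N) *m DKmx N L *m adjmx N (Smx N *m Fmx N).
  rewrite /Kmx1 -!mulmxA; do 3! congr (_ *m _).
  apply/matrixP => i j; rewrite !mxE rmorph_sum.
  by apply: eq_bigr => k _; rewrite [X in X * _ = _]mxE [X in _ * X = _]mxE mulrC [RHS]rmorphM.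
rewrite mxE; apply: eq_bigr => l _.
rewrite [in X in _ * X]mxE Smx_Fmx mxE (bigD1 l)// big1 ?addr0 => [|k kl]; last first.
  by rewrite [X in _ * X]mxE (negbTE kl) mul0r mulr0.
rewrite Smx_Fmx mxE eqxx mul1r conjcMr.
have E : (N%:R^-1 * ((2 * pi / L) ^+ 2 * freq N l ^+ 2))%:C
   = ((Num.sqrt N%:R)^-1)%:C * ((Num.sqrt N%:R)^-1)%:C * ((2 * pi / L) ^+ 2 * freq N l ^+ 2)%:C :> C.
  rewrite -!rmorphM; congr (real_complex_def _ _).
  by rewrite -invfM -expr2 sqr_sqrtr// ltW.
rewrite Monoid.mulm1 E -/(freq N l).
move: (((Num.sqrt N%:R)^-1)%:C) ((_ * _)%:C) (char1 N l x) (cj _) => a b c e; ring.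
Qed.

Lemma Kmx1_char N L (l x : 'I_N) :
  \sum_y Kmx1 N L x y * char1 N l y = ((2 * pi / L) ^+ 2 * freq N l ^+ 2)%:C * char1 N l x.
Proof.
have N0 : (N%:R : R) != 0 by rewrite pnatr_eq0 -lt0n; apply: leq_ltn_trans (ltn_ord x).
under eq_bigr do rewrite Kmx1E mulr_suml.
transitivity (\sum_(k < N) (N%:R^-1 * ((2 * pi / L) ^+ 2 * freq N k ^+ 2))%:C * char1 N k x *
     (N%:R * (l == k)%:R)).
  rewrite exchange_big; apply: eq_bigr => k _; rewrite -char1_orth_space mulr_sumr.
  by apply: eq_bigr => y _; ring.
rewrite (bigD1 l)//= eqxx big1 ?addr0 => [|k kl]; last by rewrite eq_sym (negbTE kl) !mulr0.
have -> : (N%:R : C) = (N%:R)%:C by rewrite rmorph_nat.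
by rewrite mulr1 mulrAC -rmorphM; congr (real_complex_def _ _ * _); rewrite mulrAC mulVf ?mul1r.
Qed.

Lemma Kop_hermitian d N L (k k' : gidx d N) : cj (Kop d N L k k') = Kop d N L k' k.
Proof.
rewrite /Kop conjcMr; congr (_ * _).
rewrite /kron_sum rmorph_sum; apply: eq_bigr => j _.
rewrite rmorphM rmorph_nat -/(Kmx1 N L) !Kmx1E rmorph_sum; congr (_ * _); last first.
  by congr (_%:R); congr nat_of_bool; apply: eq_forallb => i; rewrite (eq_sym (k i)).
by apply: eq_bigr => l _; rewrite [LHS]conjcMr; congr (_ * _); exact: conjc_mulr_conj.
Qed.

Lemma Kop_char d N L (l k : gidx d N) :
  \sum_k' Kop d N L k k' * char l k' = (2^-1 * kin_symbol L l)%:C * char l k.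
Proof.
rewrite rmorphM -mulrA; under eq_bigr do rewrite /Kop -mulrA.
rewrite -mulr_sumr; congr (_ * _).
rewrite /kron_sum; under eq_bigr do rewrite mulr_suml.
rewrite exchange_big /= /kin_symbol rmorph_sum mulr_suml; apply: eq_bigr => j _.
rewrite -/(Kmx1 N L).
(* The indicator keeps only the [k'] that agree with [k] off coordinate [j]; these are parametrised
   by the value [y] of that coordinate. *)
rewrite (bigID (fun k' : gidx d N => [forall i, (i != j) ==> (k i == k' i)])) /=.
rewrite [X in _ + X]big1 ?addr0 => [|k' /negbTE ->]; last by rewrite mulr0 mul0r.
rewrite (reindex_onto (fun y => ord_upd j (fun=> y) k) (fun k' : gidx d N => k' j)) /=; last first.
  move=> k' /forallP H; apply/ffunP => i; rewrite ffunE.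
  by have := H i; case: eqVneq => [->//|_ /= /eqP].
rewrite (eq_bigl xpredT) => [|y]; last first.
  rewrite ffunE !eqxx andbT; apply/forallP => i; apply/implyP => ij.
  by rewrite ffunE (negbTE ij).
have E y : char l (ord_upd j (fun=> y) k) = char1 N (l j) y * \prod_(i | i != j) char1 N (l i) (k i) :> C.
  rewrite /char (bigD1 j)//= ffunE eqxx; congr (_ * _); apply: eq_bigr => i ij.
  by rewrite ffunE (negbTE ij).
transitivity (\sum_y (Kmx1 N L (k j) y * char1 N (l j) y) * \prod_(i | i != j) char1 N (l i) (k i)).
  apply: eq_bigr => y _; rewrite E mulrA; congr (_ * _).
  have -> : [forall i, (i != j) ==> (k i == ord_upd j (fun=> y) k i)].
    by apply/forallP => i; apply/implyP => ij; rewrite ffunE (negbTE ij).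
  by rewrite mulr1 ffunE eqxx.
by rewrite -mulr_suml Kmx1_char /char [in RHS](bigD1 j)//= [RHS]mulrA.
Qed.
End KineticOperator.

(** * Aliasing estimates on nested grids *)

Section LatticeSum.
Set Implicit Arguments.
Unset Strict Implicit.
Context {R : realType}.

(** The distance [|x - r|]: one of the two truncated differences is always 0. *)
Definition cdist (r x : nat) : nat := (x - r) + (r - x).

Lemma sum_inv_sqr_le (r : nat) : \sum_(i < r) ((i.+1)%:R ^- 2 : R) <= 2.
Proof.
case: r => [|r]; first by rewrite big_ord0.
(* The bound is sharpened for the induction, where [(a + 1)^-2 <= a^-1 - (a + 1)^-1] telescopes. *)
suff : \sum_(i < r.+1) ((i.+1)%:R ^- 2 : R) <= 2 - (r.+1)%:R^-1.
  by move=> H; apply: (le_trans H); rewrite gerBl invr_ge0.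
elim: r => [|r IH]; first by rewrite big_ord_recr big_ord0 /= expr1n !invr1; lra.
rewrite big_ord_recr /=; apply: le_trans (lerD IH (lexx _)) _.
rewrite -(natr1 r.+1); set a : R := r.+1%:R.
have a1 : 1 <= a by rewrite ler1n.
have a0 : 0 < a by lra.
have b0 : 0 < a + 1 by lra.
have : (a + 1) ^- 2 <= a^-1 - (a + 1)^-1.
  have -> : a^-1 - (a + 1)^-1 = (a * (a + 1))^-1 by field; rewrite !gt_eqF.
  by rewrite lef_pV2 ?posrE ?mulr_gt0// expr2 ler_pM2r// lerDl.
move: (a^-1) ((a + 1)^-1) ((a + 1) ^- 2) => u v w; lra.
Qed.

(** Each side of the centre contributes at most 2; the left side is summed in reverse. *)
Lemma sum_cdist_inv_sqr_le (r : nat) :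
  \sum_(x < r.*2.+1 | cdist r x != 0%N) ((cdist r x)%:R ^- 2 : R) <= 4.
Proof.
rewrite -(big_mkord (fun x => cdist r x != 0%N) (fun x => (cdist r x)%:R ^- 2 : R)).
have r2 : (r <= r.*2.+1)%N by rewrite -addnn -addnS leq_addr.
rewrite (big_cat_nat _ r2)//= (_ : 4 = 2 + 2 :> R); last by ring.
apply: lerD.
  rewrite big_mkcond big_nat_rev /= add0n big_mkord.
  apply: le_trans (sum_inv_sqr_le r); apply: ler_sum => i _.
  have -> : cdist r (r - i.+1) = i.+1 by have := ltn_ord i; rewrite /cdist; lia.
  by [].
rewrite big_ltn_cond; last by rewrite -addnn ltnS leq_addr.
rewrite {1}/cdist subnn eqxx /= big_mkcond -[r.+1]add0n big_addn.
have -> : (r.*2.+1 - r.+1 = r)%N by lia.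
rewrite big_mkord.
rewrite (_ : \sum_(i < r) _ = \sum_(i < r) ((i.+1)%:R ^- 2 : R)); first exact: sum_inv_sqr_le.
apply: eq_bigr => i _; have -> : cdist r (i + r.+1) = i.+1 by rewrite /cdist; lia.
by [].
Qed.

Lemma card_cdist_le (r k : nat) : (#|[pred x : 'I_r.*2.+1 | cdist r x <= k]| <= k.*2.+1)%N.
Proof.
(* On the points counted, [x + k - r] is injective with values at most [2 k]; [minn] merely makes
   the map total. *)
have f_lt (x : 'I_r.*2.+1) : (minn (x + k - r) k.*2 < k.*2.+1)%N by rewrite ltnS geq_minr.
pose f (x : 'I_r.*2.+1) : 'I_k.*2.+1 := Ordinal (f_lt x).
rewrite -[X in (_ <= X)%N]card_ord; apply: (@leq_card_in _ _ f).
move=> x y; rewrite !inE /cdist => hx hy [] E; apply/val_inj => /=.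
by move: E hx hy; lia.
Qed.

Lemma sum_nat_of_bool_card (T : finType) (P : pred T) : (\sum_x (P x : nat) = #|P|)%N.
Proof. by rewrite -sum1_card [RHS]big_mkcond; apply: eq_bigr => x _; rewrite unfold_in; case: (P x). Qed.

(** Selects a coordinate realising the radius of the shell of [m]. Any choice will do, since
    [shell_sum_le] sums over all of them. *)
Lemma maximal_coordinate d (r : nat) (m : gidx d r.*2.+1) :
  [exists i, cdist r (m i) != 0%N] ->
  exists j, (cdist r (m j) != 0%N) && [forall i, cdist r (m i) <= cdist r (m j)]%N.
Proof.
case/existsP => i0 hi0.
case: (@arg_maxnP _ i0 xpredT (fun i => cdist r (m i)) isT) => j _ H; exists j.
have := H i0 isT => Hi; apply/andP; split.
  by rewrite -lt0n; apply: leq_trans Hi; rewrite lt0n.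
by apply/forallP => i; apply: H.
Qed.

(* Sum over the cubic shells [max_i |m_i - r| = const]; the exponent leaves
   [8] powers after the shells are counted. *)
Lemma shell_sum_le d (r : nat) : (0 < d)%N ->
  \sum_(m : gidx d r.*2.+1) \sum_j
    (if (cdist r (m j) != 0%N) && [forall i, cdist r (m i) <= cdist r (m j)]%N
     then (cdist r (m j))%:R ^- (d + 7) else 0 : R) <= 4 * d%:R * 3 ^+ d.-1.
Proof.
move=> d0; rewrite exchange_big /=.
have -> : 4 * d%:R * 3 ^+ d.-1 = \sum_(j < d) (4 * 3 ^+ d.-1 : R).
  by rewrite sumr_const card_ord -mulr_natr; ring.
apply: ler_sum => j _.
pose c (k : nat) : R := if k != 0%N then k%:R ^- (d + 7) else 0.
(* [W] writes the condition on [m] as a product over coordinates: coordinate [j] is [x] and no other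
   lies farther from [r]. The sum over [m] then factorises. *)
pose W (x : 'I_r.*2.+1) (i : 'I_d) (y : 'I_r.*2.+1) : R :=
  if i == j then (y == x)%:R else (cdist r y <= cdist r x)%N%:R.
have -> : \sum_(m : gidx d r.*2.+1)
    (if (cdist r (m j) != 0%N) && [forall i, cdist r (m i) <= cdist r (m j)]%N
     then (cdist r (m j))%:R ^- (d + 7) else 0 : R) =
   \sum_(x < r.*2.+1) c (cdist r x) * \sum_(m : gidx d r.*2.+1) \prod_i W x i (m i).
  under [RHS]eq_bigr do rewrite mulr_sumr.
  rewrite exchange_big /=; apply: eq_bigr => m _.
  rewrite (bigD1 (m j))//= [X in _ = _ + X]big1 ?addr0 => [|x xm]; last first.
    by rewrite (bigD1 j)//= /W eqxx eq_sym (negbTE xm) mul0r mulr0.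
  have -> : \prod_i W (m j) i (m i) = [forall i, cdist r (m i) <= cdist r (m j)]%N%:R.
    case: (boolP [forall i, _]) => [/forallP H|].
      by apply: big1 => i _; rewrite /W H; case: eqP => // ->; rewrite eqxx.
    rewrite negb_forall => /existsP [i Hi].
    have ij : (i == j) = false by apply/negP => /eqP E; move: Hi; rewrite E leqnn.
    by rewrite (bigD1 i)//= /W ij (negbTE Hi) mul0r.
  by rewrite /c; case: (_ != 0%N); case: [forall i, _]; rewrite /= ?mulr1 ?mulr0 ?mul0r.
have W0 x i y : 0 <= W x i y by rewrite /W; case: ifP.
have cle (x : 'I_r.*2.+1) : c (cdist r x) * \sum_(m : gidx d r.*2.+1) \prod_i W x i (m i) <=
    if cdist r x != 0%N then 3 ^+ d.-1 * (cdist r x)%:R ^- 2 else 0.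
  rewrite /c; case: ifPn => k0; last by rewrite mul0r.
  set k := cdist r x in k0 *.
  have k1 : 1 <= k%:R :> R by rewrite ler1n lt0n.
  have kp : 0 < k%:R :> R by apply: lt_le_trans k1.
  have Pb : \sum_(m : gidx d r.*2.+1) \prod_i W x i (m i) <= (3 * k%:R) ^+ d.-1.
    rewrite -(bigA_distr_bigA (W x)) (bigD1 j)//=.
    have -> : \sum_y W x j y = 1.
      by rewrite (bigD1 x)//= /W !eqxx big1 ?addr0// => y /negbTE ->.
    rewrite mul1r; apply: (@le_trans _ _ (\prod_(i < d | i != j) (3 * k%:R))); last first.
      by rewrite prodr_const (_ : #|_| = d.-1)// cardC1 card_ord.
    apply: ler_prod => i ij; rewrite sumr_ge0//=.
    rewrite (eq_bigr (fun y : 'I_r.*2.+1 => ((cdist r y <= k)%N : nat)%:R : R)); last first.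
      by move=> y _; rewrite /W (negbTE ij).
    rewrite -natr_sum sum_nat_of_bool_card.
    apply: (@le_trans _ _ (k.*2.+1)%:R); first by rewrite ler_nat; exact: card_cdist_le.
    by rewrite -natrM ler_nat; lia.
  apply: (@le_trans _ _ (k%:R ^- (d + 7) * (3 * k%:R) ^+ d.-1)).
    by rewrite ler_wpM2l// invr_ge0 exprn_ge0// ltW.
  rewrite exprMn mulrCA ler_wpM2l ?exprn_ge0//.
  have -> : (d + 7 = d.-1 + 8)%N by lia.
  rewrite exprD invfM mulrAC mulVf ?mul1r ?expf_neq0 ?gt_eqF//.
  rewrite lef_pV2 ?posrE ?exprn_gt0//.
  by apply: ler_weXn2l.
apply: le_trans (ler_sum _ (fun x _ => cle x)) _.
rewrite -big_mkcond /= -mulr_sumr mulrC ler_wpM2r ?exprn_ge0//.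
exact: sum_cdist_inv_sqr_le.
Qed.
End LatticeSum.

Section SpectralBounds.
Set Implicit Arguments.
Unset Strict Implicit.
Context {R : realType}.
Local Notation C := R[i].
Local Notation "x %:C" := (@real_complex_def _ (Phant _) x) : ring_scope.

Lemma pi_le4 : pi <= 4 :> R. Proof. by have := @pihalf_lt2 R; lra. Qed.

Lemma freq_norm_le N (l : 'I_N) : `|freq N l| <= N%:R / 2 :> R.
Proof.
have lN : l%:R <= N%:R :> R by rewrite ler_nat ltnW.
by have l0 : 0 <= l%:R :> R; rewrite // /freq ler_norml; apply/andP; split; lra.
Qed.

Lemma dlap_symbol_lower d N (L : R) (k : gidx d N) : (0 < N)%N -> 0 < L ->
  16 / L ^+ 2 * \sum_j freq N (k j) ^+ 2 <= dlap_symbol (L / N%:R) k.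
Proof.
move=> N0 L0; rewrite mulr_sumr; apply: ler_sum => j _.
have NR : 0 < (N%:R : R) by rewrite ltr0n.
have p0 := pi_gt0 R.
(* The centred frequencies satisfy [|freq| <= N / 2], which is the range covered by Jordan's
   inequality. *)
have xp : `|pi * freq N (k j) / N%:R| <= pi / 2 :> R.
  rewrite !normrM normfV (gtr0_norm p0) (gtr0_norm NR) -mulrA ler_wpM2l ?(ltW p0)//.
  by rewrite ler_pdivrMr// [2^-1 * _]mulrC freq_norm_le.
apply: le_trans (ler_wpM2l _ (sqr_sin_jordan xp)).
  have E (q y : R) : 0 < q -> 16 / L ^+ 2 * y ^+ 2 =
      4 / (L / N%:R) ^+ 2 * (2 * (q * y / N%:R) / q) ^+ 2.
    by move=> q0; field; rewrite !gt_eqF.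
  by rewrite (E pi).
by rewrite divr_ge0 ?sqr_ge0.
Qed.

(** Since [|freq N l| <= N / 2], adding a multiple of [N] cannot bring the frequency closer to 0. *)
Lemma freq_merge_sqr_ge N r (l : 'I_N) (m : 'I_r.*2.+1) :
  freq N l ^+ 2 <= freq (N * r.*2.+1) (merge_ord l m) ^+ 2 :> R.
Proof.
rewrite freq_merge; have := freq_norm_le l; set a := freq N l.
rewrite ler_norml => /andP[a1 a2].
have n0 : 0 <= N%:R :> R by [].
have [mr|rm|->] := ltngtP m r; last by rewrite subrr mulr0 addr0.
- have z1 : m%:R - r%:R <= -1 :> R.
    by rewrite lerBlDr -lerBlDl opprK natr1 ler_nat.
  have w1 : N%:R * (m%:R - r%:R) <= - N%:R :> R by nra.
  by move: w1; set w := _ * (_ - _) => w1; nra.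
- have z1 : 1 <= m%:R - r%:R :> R by rewrite lerBrDr addrC natr1 ler_nat.
  have w1 : N%:R <= N%:R * (m%:R - r%:R) :> R by nra.
  by move: w1; set w := _ * (_ - _) => w1; nra.
Qed.

(** For an integer [z] other than 0, [|freq N l + N z| >= N |z| - N / 2 >= N |z| / 2]. *)
Lemma freq_merge_cdist N r (l : 'I_N) (m : 'I_r.*2.+1) :
  (N%:R / 2) ^+ 2 * (cdist r m)%:R ^+ 2 <= freq (N * r.*2.+1) (merge_ord l m) ^+ 2 :> R.
Proof.
rewrite freq_merge; have := freq_norm_le l; set a := freq N l.
rewrite ler_norml => /andP[a1 a2].
have n0 : 0 <= N%:R :> R by [].
have [mr|rm|->] := ltngtP m r; last by rewrite /cdist subnn expr0n mulr0 sqr_ge0.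
- have z1 : m%:R - r%:R <= -1 :> R by rewrite lerBlDr -lerBlDl opprK natr1 ler_nat.
  have -> : (cdist r m)%:R = r%:R - m%:R :> R.
    by rewrite /cdist (_ : (m - r)%N = 0%N) ?add0n ?natrB//; [exact: ltnW|lia].
  have H : N%:R / 2 * (r%:R - m%:R) <= - (a + N%:R * (m%:R - r%:R)) by nra.
  rewrite -exprMn -[X in _ <= X]sqrrN ler_sqr ?nnegrE//; last apply: le_trans H.
    by apply: mulr_ge0; [rewrite divr_ge0|lra].
  by apply: mulr_ge0; [rewrite divr_ge0|lra].
- have z1 : 1 <= m%:R - r%:R :> R by rewrite lerBrDr addrC natr1 ler_nat.
  have -> : (cdist r m)%:R = m%:R - r%:R :> R.
    by rewrite /cdist (_ : (r - m)%N = 0%N) ?addn0 ?natrB//; [exact: ltnW|lia].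
  have H : N%:R / 2 * (m%:R - r%:R) <= a + N%:R * (m%:R - r%:R) by nra.
  rewrite -exprMn ler_sqr ?nnegrE//; last apply: le_trans H.
    by apply: mulr_ge0; [rewrite divr_ge0|lra].
  by apply: mulr_ge0; [rewrite divr_ge0|lra].
Qed.

Lemma kin_symbol_ge0 d N (L : R) (l : gidx d N) : 0 <= kin_symbol L l.
Proof. by apply: sumr_ge0 => j _; rewrite mulr_ge0 ?sqr_ge0. Qed.

Section FineGrid.
Variables (d N r : nat) (L : R).
Hypotheses (d0 : (0 < d)%N) (N0 : (0 < N)%N) (L0 : 0 < L).
Let M := (N * r.*2.+1)%N.
Let h : R := L / M%:R.
Let Lam (l : gidx d N) (m : gidx d r.*2.+1) : R := dlap_symbol h (merge l m).
Let centre : gidx d r.*2.+1 := [ffun=> inord r].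

Let M0 : (0 < M)%N. Proof. by rewrite muln_gt0 N0. Qed.

(** The factor 4 comes from [pi <= 4]: [(2 pi)^2 <= 64 = 4 * 16]. *)
Lemma kin_symbol_le l m : kin_symbol L l <= 4 * Lam l m.
Proof.
have H := dlap_symbol_lower (merge l m) M0 L0.
apply: (@le_trans _ _ (4 * (16 / L ^+ 2 * \sum_j freq M (merge l m j) ^+ 2))); last first.
  by rewrite ler_wpM2l.
rewrite mulrA mulr_sumr; apply: ler_sum => j _.
rewrite ffunE; apply: ler_pM; rewrite ?sqr_ge0//; last exact: freq_merge_sqr_ge.
rewrite exprMn exprVn mulrA ler_wpM2r ?invr_ge0 ?sqr_ge0// exprMn.
by have := pi_le4; have := pi_gt0 R; nra.
Qed.

Lemma symbol_cdist_le l (m : gidx d r.*2.+1) j : (2 * N%:R / L) ^+ 2 * (cdist r (m j))%:R ^+ 2 <= Lam l m.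
Proof.
apply: le_trans (dlap_symbol_lower (merge l m) M0 L0).
apply: (@le_trans _ _ (16 / L ^+ 2 * freq M (merge l m j) ^+ 2)); last first.
  rewrite ler_wpM2l ?divr_ge0 ?sqr_ge0// (bigD1 j)//= lerDl.
  by apply: sumr_ge0 => i _; rewrite sqr_ge0.
rewrite ffunE.
have -> : (2 * N%:R / L) ^+ 2 * (cdist r (m j))%:R ^+ 2 =
   16 / L ^+ 2 * ((N%:R / 2) ^+ 2 * (cdist r (m j))%:R ^+ 2) by field; rewrite gt_eqF.
by rewrite ler_wpM2l ?divr_ge0 ?sqr_ge0// freq_merge_cdist.
Qed.

(** Split [(2 d)^(d + 7)] as [(2 d)^8 (2 d)^(d - 1)]. The factor [2^8] pays for [4 * 64], and
    [3 <= 2 d] as soon as [d >= 2], while for [d = 1] the exponent [d - 1] is 0. *)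
Lemma shell_constant_le n : (d + 7 <= n)%N -> 4 * d%:R * 3 ^+ d.-1 <= (2 * d%:R) ^+ n / 64 :> R.
Proof.
move=> dn; rewrite ler_pdivlMr//.
have -> : 4 * d%:R * 3 ^+ d.-1 * 64 = (256 * d * 3 ^ d.-1)%:R :> R by rewrite !natrM natrX; ring.
rewrite -natrM -natrX ler_nat; apply: (@leq_trans ((2 * d) ^ (d + 7))); last first.
  by rewrite leq_pexp2l// muln_gt0.
have -> : (d + 7 = d.-1 + 8)%N by lia.
rewrite expnD mulnC leq_mul//.
  case: (d) d0 => // -[//|d'] _; rewrite leq_exp2r//; lia.
rewrite expnMn leq_mul//; by rewrite -{1}(expn1 d) leq_pexp2l.
Qed.

(** An alias at distance [k] from the centre has [Lam >= (A k)^2] with [A = 2 N / L], so the sum is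
    at most [A^-(4 n)] times a lattice sum. The identity [2 d / A = L d / N] is the origin of the
    factor [d] in the error bound. *)
Lemma inv_symbol_sum_le n l : (d + 7 <= 4 * n)%N ->
  \sum_m (if m == centre then 0 else (Lam l m ^+ (2 * n))^-1) <= (L * d%:R / N%:R) ^+ (4 * n) / 64.
Proof.
move=> dn.
have NR : 0 < (N%:R : R) by rewrite ltr0n.
have [A AE] : {A : R | A = 2 * N%:R / L} by exists (2 * N%:R / L).
have A0 : 0 < A by rewrite AE divr_gt0 ?mulr_gt0.
apply: (@le_trans _ _ (\sum_(m : gidx d r.*2.+1) A ^- (4 * n) * \sum_j
    (if (cdist r (m j) != 0%N) && [forall i, cdist r (m i) <= cdist r (m j)]%N
     then (cdist r (m j))%:R ^- (d + 7) else 0))).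
  apply: ler_sum => m _.
  have S0 j : 0 <= (if (cdist r (m j) != 0%N) && [forall i, cdist r (m i) <= cdist r (m j)]%N
     then (cdist r (m j))%:R ^- (d + 7) else 0 : R) by case: ifP.
  case: ifPn => [_|mc].
    by rewrite mulr_ge0 ?invr_ge0 ?exprn_ge0 ?(ltW A0)// sumr_ge0.
  have [|j jm] := @maximal_coordinate d r m.
    apply: contraR mc; rewrite negb_exists => /forallP H; apply/eqP/ffunP => i.
    rewrite ffunE; apply/val_inj; have := H i; rewrite negbK => /eqP E /=.
    rewrite inordK; last by lia.
    by move: E; rewrite /cdist; lia.
  apply: (@le_trans _ _ (A ^- (4 * n) * (cdist r (m j))%:R ^- (d + 7))); last first.
    rewrite ler_wpM2l ?invr_ge0 ?exprn_ge0 ?(ltW A0)// (bigD1 j)//= jm lerDl.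
    by apply: sumr_ge0.
  move/andP: jm => [k0 _]; set k := cdist r (m j) in k0 *.
  have k1 : 1 <= k%:R :> R by rewrite ler1n lt0n.
  have kp : 0 < k%:R :> R by apply: lt_le_trans k1.
  have B : A ^+ (4 * n) * k%:R ^+ (d + 7) <= Lam l m ^+ (2 * n).
    apply: (@le_trans _ _ ((A ^+ 2 * k%:R ^+ 2) ^+ (2 * n))).
      rewrite exprMn -!exprM mulnA ler_wpM2l ?exprn_ge0 ?(ltW A0)//.
      exact: ler_weXn2l.
    have SC := symbol_cdist_le l m j; rewrite -AE -/k in SC.
    apply: lerXn2r SC; rewrite nnegrE; first by rewrite mulr_ge0 ?sqr_ge0.
    exact: dlap_symbol_ge0.
  have P0 : 0 < A ^+ (4 * n) * k%:R ^+ (d + 7) by rewrite mulr_gt0 ?exprn_gt0.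
  by rewrite -invfM lef_pV2 ?posrE//; apply: lt_le_trans B.
rewrite -mulr_sumr.
apply: le_trans (ler_wpM2l _ (@shell_sum_le R d r d0)) _.
  by rewrite invr_ge0 exprn_ge0// ltW.
apply: le_trans (ler_wpM2l _ (shell_constant_le dn)) _.
  by rewrite invr_ge0 exprn_ge0// ltW.
rewrite mulrA ler_wpM2r// -exprVn -exprMn le_eqVlt; apply/orP; left; apply/eqP; congr (_ ^+ _).
by rewrite AE; field; rewrite !gt_eqF.
Qed.
End FineGrid.
End SpectralBounds.

Section AliasingError.
Set Implicit Arguments.
Unset Strict Implicit.
Context {R : realType}.
Local Notation C := R[i].
Local Notation "x %:C" := (@real_complex_def _ (Phant _) x) : ring_scope.
Variables (d N r : nat) (L : R).
Hypotheses (d0 : (0 < d)%N) (N0 : (0 < N)%N) (eN : ~~ odd N) (L0 : 0 < L).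
Let M := (N * r.*2.+1)%N.
Let h : R := L / M%:R.
Let Lam (l : gidx d N) (m : gidx d r.*2.+1) : R := dlap_symbol h (merge l m).
Let centre : gidx d r.*2.+1 := [ffun=> inord r].
Let coarse (x : gidx d N) : gidx d M := refine (ltn0Sn r.*2) x.

Let M0 : (0 < M)%N. Proof. by rewrite muln_gt0 N0. Qed.
Let eM : ~~ odd M. Proof. by rewrite oddM negb_and eN. Qed.
Let Lam0 l m : 0 <= Lam l m. Proof. exact: dlap_symbol_ge0. Qed.

(** For samples of a function, [L^d] times this is the grid quadrature of the square of its [n]-th
    discrete Laplacian, see [grid_energy]. *)
Definition weighted_energy n (F : gidx d M -> C) : R :=
  \sum_k nsq (dft F k) * dlap_symbol h k ^+ (2 * n).

(** The share of the central aliases, summed over [l] to be uniform in [l]. At zero frequency both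
    symbols vanish and the term is [0 / 0 = 0]. *)
Definition central_error n : R :=
  \sum_l (2^-1 * (kin_symbol L l - Lam l centre)) ^+ 2 / Lam l centre ^+ (2 * n).

Lemma coarse_expansion (a : gidx d M -> C) x :
  \sum_k a k * char k (coarse x) = \sum_l (\sum_m a (merge l m)) * char l x.
Proof.
rewrite sum_merge; apply: eq_bigr => l _; rewrite mulr_suml; apply: eq_bigr => m _.
by rewrite char_alias.
Qed.

(** On coarse points [K] sees only the coarse frequency [l], whereas [dlap] acts on each alias
    through its own symbol. As [dlap] has eigenvalue [- Lam], the sum on the left is really a
    difference. *)
Lemma kinetic_error_expansion (F : gidx d M -> C) x :
  (2^-1)%:C * dlap h F (coarse x) + \sum_x' Kop d N L x x' * F (coarse x') =
  \sum_l (\sum_m dft F (merge l m) * (2^-1 * (kin_symbol L l - Lam l m))%:C) * char l x.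
Proof.
have E1 := @iter_dlap_dft R d M h 1 F (coarse x) M0 eM.
rewrite /= in E1; rewrite E1 (coarse_expansion (fun k => _ * _)).
have E2 x' : F (coarse x') = \sum_l (\sum_m dft F (merge l m)) * char l x'.
  by rewrite (dft_inv F _ M0) coarse_expansion.
under [X in _ + X]eq_bigr do rewrite E2 mulr_sumr.
rewrite exchange_big /= mulr_sumr -big_split; apply: eq_bigr => l _ /=.
have -> : \sum_x' Kop d N L x x' * ((\sum_m dft F (merge l m)) * char l x') =
    (\sum_m dft F (merge l m)) * ((2^-1 * kin_symbol L l)%:C * char l x).
  by rewrite -Kop_char mulr_sumr; apply: eq_bigr => x' _; ring.
rewrite !mulrA -mulrDl; congr (_ * _).
rewrite mulr_sumr mulr_suml -big_split; apply: eq_bigr => m _ /=.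
have -> : (2^-1 * (kin_symbol L l - Lam l m))%:C =
    (2^-1)%:C * (- Lam l m ^+ 1)%:C + (2^-1 * kin_symbol L l)%:C :> C.
  by rewrite -rmorphM -rmorphD; congr (real_complex_def _ _); ring.
rewrite expr1 /Lam; ring.
Qed.

Lemma sum_mul_le (I : finType) (a b : I -> R) (B : R) :
  (forall i, 0 <= a i) -> (forall i, b i <= B) -> \sum_i a i * b i <= (\sum_i a i) * B.
Proof. by move=> a0 bB; rewrite mulr_suml; apply: ler_sum => i _; rewrite ler_wpM2l. Qed.

(** From [0 <= kin_symbol <= 4 Lam] one gets [b^2 <= 4 Lam^2]. This uses up two of the [2 (s + 1)]
    powers of the weight, leaving [Lam^-(2 s)] to be summed; [1/16] is [4/64]. *)
Lemma kinetic_error_le s (F : gidx d M -> C) : (d + 7 <= 4 * s)%N ->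
  \sum_x nsq ((2^-1)%:C * dlap h F (coarse x) + \sum_x' Kop d N L x x' * F (coarse x')) <=
  N%:R ^+ d * weighted_energy s.+1 F *
   (central_error s.+1 + (L * d%:R / N%:R) ^+ (4 * s) / 16).
Proof.
move=> ds; under eq_bigr do rewrite kinetic_error_expansion.
rewrite parseval_char -mulrA ler_wpM2l ?exprn_ge0//.
rewrite /weighted_energy sum_merge.
pose b l m : R := 2^-1 * (kin_symbol L l - Lam l m).
have b_sqr l m : b l m ^+ 2 <= 4 * Lam l m ^+ 2.
  have k0 := kin_symbol_ge0 L l; have k4 := kin_symbol_le N0 L0 l m.
  rewrite -/M -/h -/(Lam l m) in k4; have := Lam0 l m; rewrite /b; nra.
have b0 l m : Lam l m ^+ (2 * s.+1) = 0 -> b l m = 0.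
  move/eqP; rewrite expf_eq0 => /andP[_ /eqP E].
  by have := b_sqr l m; rewrite E expr0n mulr0 exprn_even_le0//= => /eqP.
have Lam_pow l m : 0 <= Lam l m ^+ (2 * s.+1) by rewrite exprn_ge0.
have termle l m : b l m ^+ 2 / Lam l m ^+ (2 * s.+1) <= 4 * (Lam l m ^+ (2 * s))^-1.
  have [E|E] := eqVneq (Lam l m) 0.
    by rewrite (b0 l m) ?E ?expr0n// mul0r mulr_ge0 ?invr_ge0 ?exprn_ge0.
  have Lp : 0 < Lam l m by rewrite lt_neqAle eq_sym E Lam0.
  rewrite ler_pdivrMr ?exprn_gt0// mulnS exprD [_ ^+ 2 * _]mulrC mulrA mulfVK ?expf_neq0//.
have rest l : \sum_m b l m ^+ 2 / Lam l m ^+ (2 * s.+1) <=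
    central_error s.+1 + (L * d%:R / N%:R) ^+ (4 * s) / 16.
  (* The central alias is set apart because [inv_symbol_sum_le] omits it. *)
  apply: (@le_trans _ _ (b l centre ^+ 2 / Lam l centre ^+ (2 * s.+1) +
     4 * \sum_m (if m == centre then 0 else (Lam l m ^+ (2 * s))^-1))).
    rewrite (bigD1 centre)//= lerD2l mulr_sumr [leRHS](bigD1 centre)//= eqxx mulr0 add0r.
    by apply: ler_sum => m /negbTE ->; exact: termle.
  apply: lerD.
    rewrite /central_error (bigD1 l)//= lerDl; apply: sumr_ge0 => i _.
    by rewrite mulr_ge0 ?sqr_ge0 ?invr_ge0.
  have := @inv_symbol_sum_le _ _ _ r _ d0 N0 L0 s l ds; rewrite -/M -/h -/centre; lra.
apply: le_trans (sum_mul_le _ rest) => [|l]; last first.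
  by apply: sumr_ge0 => m _; rewrite mulr_ge0 ?nsq_ge0 ?exprn_ge0 ?dlap_symbol_ge0.
apply: ler_sum => l _.
exact: (cauchy_schwarz_weighted (fun m => dft F (merge l m)) (Lam_pow l) (b0 l)).
Qed.

(** In each class the central coefficient is the coarse one minus [rho], the sum of the other
    aliases. Its square gives the factor 2 and a term [2 |rho|^2]; the mass of the other aliases
    raises the second constant to 3. *)
Lemma sampling_lower_bound n (F : gidx d M -> C) : (d + 7 <= 4 * n)%N ->
  weighted_energy 0 F <= 2 * (N%:R ^- d * \sum_x nsq (F (coarse x)))
    + 3 * (weighted_energy n F * ((L * d%:R / N%:R) ^+ (4 * n) / 64)).
Proof.
move=> dn; have NR : 0 < N%:R ^+ d :> R by rewrite exprn_gt0// ltr0n.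
pose c l m := dft F (merge l m).
pose D : R := (L * d%:R / N%:R) ^+ (4 * n) / 64.
pose S l : R := \sum_m (if m == centre then 0 else (Lam l m ^+ (2 * n))^-1).
have SD l : S l <= D by exact: inv_symbol_sum_le.
have E : \sum_x nsq (F (coarse x)) = N%:R ^+ d * \sum_l nsq (\sum_m c l m).
  rewrite -parseval_char; apply: eq_bigr => x _.
  by rewrite (dft_inv F _ M0) coarse_expansion.
rewrite E mulKf ?gt_eqF// -/D.
pose P l : R := \sum_m nsq (c l m) * Lam l m ^+ (2 * n).
have WE : weighted_energy n F = \sum_l P l by rewrite /weighted_energy sum_merge.
have W0 : weighted_energy 0 F = \sum_l \sum_m nsq (c l m).
  by rewrite /weighted_energy sum_merge; do 2! apply: eq_bigr => ? _; rewrite expr0 mulr1.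
rewrite W0 WE mulr_suml !mulr_sumr -big_split; apply: ler_sum => l _ /=.
have P0 : 0 <= P l by apply: sumr_ge0 => m _; rewrite mulr_ge0 ?nsq_ge0 ?exprn_ge0.
have Lamp m : m != centre -> 0 < Lam l m.
  move=> mc; rewrite lt_neqAle Lam0 andbT; apply/negP => /eqP E0.
  have [|j /andP[jm _]] := @maximal_coordinate d r m.
    apply: contraR mc; rewrite negb_exists => /forallP H; apply/eqP/ffunP => i.
    rewrite ffunE; apply/val_inj; have := H i; rewrite negbK => /eqP Ec /=.
    rewrite inordK; last by lia.
    by move: Ec; rewrite /cdist; lia.
  have := symbol_cdist_le N0 L0 l m j; rewrite -/M -/h -/(Lam l m) -E0.
  rewrite leNgt mulr_gt0 ?exprn_gt0 ?divr_gt0 ?mulr_gt0 ?ltr0n// lt0n //.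
pose rho : C := \sum_(m | m != centre) c l m.
have rho_le : nsq rho <= P l * D.
  (* The indicator removes the central alias, the only one whose weight can vanish. *)
  pose w m : R := if m == centre then 0 else 1.
  have -> : rho = \sum_m c l m * (w m)%:C.
    rewrite /rho big_mkcond; apply: eq_bigr => m _; rewrite /w.
    by case: eqVneq => _; rewrite ?mulr0 ?mulr1.
  have wz m : Lam l m ^+ (2 * n) = 0 -> w m = 0.
    rewrite /w; case: (eqVneq m centre) => // mc /eqP.
    by rewrite gt_eqF ?exprn_gt0 ?Lamp.
  have wp m : 0 <= Lam l m ^+ (2 * n) by rewrite exprn_ge0.
  apply: le_trans (cauchy_schwarz_weighted (c l) wp wz) _.
  rewrite ler_wpM2l//; apply: le_trans (SD l); rewrite le_eqVlt; apply/orP; left; apply/eqP.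
  by apply: eq_bigr => m _; rewrite /w; case: eqP => _; rewrite ?expr1n ?expr0n ?mul0r ?mul1r.
have tail_le : \sum_(m | m != centre) nsq (c l m) <= P l * D.
  apply: (@le_trans _ _ (P l * S l)); last by rewrite ler_wpM2l.
  rewrite /S [in leRHS](bigD1 centre)//= eqxx add0r mulr_sumr; apply: ler_sum => m mc.
  rewrite (negbTE mc) -[leLHS](mulfK (_ : Lam l m ^+ (2 * n) != 0)) ?expf_neq0 ?gt_eqF ?Lamp//.
  rewrite ler_wpM2r ?invr_ge0 ?exprn_ge0// /P (bigD1 m)//= lerDl.
  by apply: sumr_ge0 => i _; rewrite mulr_ge0 ?nsq_ge0 ?exprn_ge0.
rewrite (bigD1 centre)//=.
have : nsq (c l centre) <= 2 * nsq (\sum_m c l m) + 2 * nsq rho.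
  have -> : c l centre = \sum_m c l m + - rho by rewrite (bigD1 centre)//= addrK.
  apply: le_trans (nsqD_le _ _) _; rewrite lerD2l.
  by rewrite /nsq cReN cImN !sqrrN.
by move: rho_le tail_le; rewrite -/D; lra.
Qed.
End AliasingError.

(** * Grid sums and torus integrals *)

Section RiemannSums.
Set Implicit Arguments.
Unset Strict Implicit.
Context {R : realType}.
Local Notation mu := (@lebesgue_measure R).

Lemma integrable_continuous (f : R -> R) a b : continuous f ->
  mu.-integrable `[a, b] (EFin \o f).
Proof.
move=> cf; apply: continuous_compact_integrable; first exact: segment_compact.
by apply: continuous_subspaceT.
Qed.

Lemma Rintegral_itv_cst (c a b : R) : a <= b ->
  Rintegral mu `[a, b] (fun=> c) = c * (b - a).
Proof.
move=> ab; rewrite Rintegral_cst; last exact: measurable_itv.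
rewrite /= lebesgue_measure_itv /= lte_fin; have [//|ba] := ltP a b.
by have -> : a = b; [apply/eqP; rewrite eq_le ab ba|rewrite subrr].
Qed.

Lemma Rintegral_itv_dist (f g : R -> R) a b e : a <= b -> continuous f -> continuous g ->
  (forall x, a <= x <= b -> `|f x - g x| <= e) ->
  `|Rintegral mu `[a, b] f - Rintegral mu `[a, b] g| <= e * (b - a).
Proof.
move=> ab cf cg fg; have mI : measurable (`[a, b]%classic : set R) by exact: measurable_itv.
rewrite -RintegralB//; try exact: integrable_continuous.
have cfg : continuous (fun x => f x - g x) by move=> x; apply: cvgB; [exact: cf|exact: cg].
apply: le_trans (le_normr_Rintegral _ _) _ => //; first exact: integrable_continuous.
rewrite -(Rintegral_itv_cst e ab); apply: le_Rintegral => //.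
- apply: integrable_continuous => x; apply: cvg_norm; exact: cfg.
- by apply: integrable_continuous => x; exact: cvg_cst.
Qed.

Lemma Rintegral_itv_split (f : R -> R) a b c : a <= b -> b <= c -> continuous f ->
  Rintegral mu `[a, c] f = Rintegral mu `[a, b] f + Rintegral mu `[b, c] f.
Proof.
move=> ab bc cf; have ic y z := @integrable_continuous f y z cf.
have := @Rintegral_itvB R f (BLeft a) (BRight c) b (ic a c).
rewrite !bnd_simp => /(_ ab bc) H.
rewrite -(@Rintegral_itv_obnd_cbnd R b (BRight c)); last first.
  apply: integrableS (ic b c) => //; try exact: measurable_itv.
  by apply: subset_itvr; rewrite bnd_simp.
by rewrite -H addrC subrK.
Qed.

Lemma riemann_sum_dist (f : R -> R) (h e : R) (n : nat) : 0 <= h -> continuous f ->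
  (forall x y, `|x - y| <= h -> `|f x - f y| <= e) ->
  `|Rintegral mu `[0, n%:R * h] f - h * \sum_(j < n) f (j%:R * h)| <= e * (n%:R * h).
Proof.
move=> h0 cf fe; elim: n => [|n IH].
  by rewrite big_ord0 !mul0r !mulr0 subr0 set_itv1 Rintegral_set1 normr0.
have nh : n%:R * h <= n.+1%:R * h by rewrite ler_wpM2r// ler_nat.
rewrite (@Rintegral_itv_split _ 0 (n%:R * h) (n.+1%:R * h))//; last by rewrite mulr_ge0.
have D : n.+1%:R * h - n%:R * h = h by rewrite -natr1; ring.
rewrite big_ord_recr /=.
have : `|Rintegral mu `[n%:R * h, n.+1%:R * h] f - h * f (n%:R * h)| <= e * h.
  rewrite -[in leRHS]D -[h in h * f _]D [_ * f _]mulrC -(Rintegral_itv_cst _ nh).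
  apply: Rintegral_itv_dist => //; first by move=> x; exact: cvg_cst.
  move=> x /andP[x1 x2]; apply: fe; rewrite ger0_norm ?subr_ge0//.
  by move: x2; rewrite -natr1 mulrDl mul1r; lra.
move=> H; rewrite mulrDr.
set A := Rintegral _ _ _ in IH *; set B := Rintegral _ _ _ in H *.
set S := h * \sum_(i < n) _ in IH *.
have -> : A + B - (S + h * f (n%:R * h)) = (A - S) + (B - h * f (n%:R * h)) by ring.
apply: le_trans (ler_normD _ _) _.
have -> : e * (n.+1%:R * h) = e * (n%:R * h) + e * h by rewrite -natr1; ring.
exact: lerD.
Qed.

(** Measured coordinate by coordinate, so that it is inherited by sections obtained with [upd]. *)
Definition modulus d (e delta : R) (f : 'rV[R]_d -> R) : Prop :=
  forall x y : 'rV[R]_d, (forall i, `|x 0 i - y 0 i| < delta) -> `|f x - f y| <= e.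

Definition unif_cont d (f : 'rV[R]_d -> R) : Prop :=
  forall e, 0 < e -> exists2 delta, 0 < delta & modulus e delta f.

Lemma updE d (x : 'rV[R]_d) i y j : upd d x i y 0 j = if j == i then y else x 0 j.
Proof.
rewrite !mxE eqxx /=; case: (eqVneq j i) => [->|ji]; last by rewrite /= mulr0 addr0.
by rewrite /= mulr1 addrC subrK.
Qed.

Lemma modulus_upd d e delta (f : 'rV[R]_d -> R) x i (y z : R) : 0 < delta ->
  modulus e delta f -> `|y - z| < delta -> `|f (upd d x i y) - f (upd d x i z)| <= e.
Proof.
move=> d0 mf yz; apply: mf => j; rewrite !updE; case: eqP => // _.
by rewrite subrr normr0.
Qed.

Lemma continuous_upd d (f : 'rV[R]_d -> R) x i : unif_cont f -> continuous (fun y => f (upd d x i y)).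
Proof.
move=> uf y; apply/cvgrPdist_le => /= e e0; have [delta d0 mf] := uf e e0.
near=> z; apply: modulus_upd mf _ => //.
Unshelve. all: by end_near.
Qed.

(** Each integration multiplies [e] by [L] and keeps [delta]. The induction also carries
    [unif_cont], because every inner integral must be continuous in the next variable. *)
Lemma modulus_iint d (L : R) e delta (f : 'rV[R]_d -> R) (s : seq 'I_d) : 0 < L -> 0 < delta ->
  unif_cont f -> modulus e delta f ->
  unif_cont (iint d L s f) /\ modulus (L ^+ size s * e) delta (iint d L s f).
Proof.
move=> L0 d0 uf.
have step e' delta' g i : 0 < delta' -> unif_cont g -> modulus e' delta' g ->
    modulus (L * e') delta' (fun x => Rintegral mu `[0, L] (fun y => g (upd d x i y))).
  move=> d0' ug mg x y xy; have -> : L * e' = e' * (L - 0) by ring.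
  apply: (@Rintegral_itv_dist (fun z => g (upd d x i z)) (fun z => g (upd d y i z))).
  - exact: ltW.
  - exact: continuous_upd.
  - exact: continuous_upd.
  move=> z _; apply: mg => j; rewrite !updE; case: eqP => // _.
  by rewrite subrr normr0.
elim: s e delta d0 => [|i s IH] e delta d0 mf; first by rewrite expr0 mul1r.
have [ug mg] := IH e delta d0 mf.
split; last by rewrite /= exprS -mulrA; apply: step.
move=> eta eta0; have [|delta' d0' mg'] := ug (eta / L); first by rewrite divr_gt0.
by exists delta' => //; rewrite -(divfK (lt0r_neq0 L0) eta) mulrC; apply: step.
Qed.

(** Follows the recursion of [iint], to allow a comparison one coordinate at a time;
    [riemann_sum_grid] identifies it with a sum over the grid. *)
Fixpoint riemann_sum d (L : R) (M : nat) (s : seq 'I_d) (f : 'rV[R]_d -> R) (x : 'rV[R]_d) : R :=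
  match s with
  | [::] => f x
  | i :: s' => L / M%:R * \sum_(j < M) riemann_sum L M s' f (upd d x i (j%:R * (L / M%:R)))
  end.

Lemma iint_riemann_sum_dist d (L : R) e delta (f : 'rV[R]_d -> R) M (s : seq 'I_d) x :
  0 < L -> 0 < delta -> (0 < M)%N -> L / M%:R < delta -> unif_cont f -> modulus e delta f ->
  `|iint d L s f x - riemann_sum L M s f x| <= (size s)%:R * (L ^+ size s * e).
Proof.
move=> L0 d0 M0 Md uf mf; have MR : (M%:R : R) != 0 by rewrite pnatr_eq0 -lt0n.
have h0 : 0 <= L / M%:R by rewrite divr_ge0// ltW.
elim: s x => [|i s IH] x /=; first by rewrite subrr normr0 mul0r.
have [ug mg] := modulus_iint s L0 d0 uf mf.
pose g y := iint d L s f (upd d x i y).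
have cg : continuous g by exact: continuous_upd.
have E : L = M%:R * (L / M%:R) by rewrite mulrC divfK.
have H1 : `|Rintegral mu `[0, L] g - L / M%:R * \sum_(j < M) g (j%:R * (L / M%:R))|
    <= (L ^+ size s * e) * L.
  have := @riemann_sum_dist g (L / M%:R) (L ^+ size s * e) M h0 cg; rewrite -E; apply.
  move=> y z yz; apply: (@modulus_upd d _ _ _ x i _ _ d0 mg); exact: le_lt_trans Md.
have H2 : `|L / M%:R * (\sum_(j < M) g (j%:R * (L / M%:R))) -
    L / M%:R * \sum_(j < M) riemann_sum L M s f (upd d x i (j%:R * (L / M%:R)))|
    <= L * ((size s)%:R * (L ^+ size s * e)).
  set X := (size s)%:R * _; have -> : L * X = L / M%:R * (M%:R * X) by rewrite mulrA divfK.
  rewrite -mulrBr normrM (ger0_norm h0) -sumrB ler_wpM2l//.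
  apply: le_trans (ler_norm_sum _ _ _) _.
  apply: (@le_trans _ _ (\sum_(j < M) X)); first by apply: ler_sum => j _; exact: IH.
  by rewrite sumr_const card_ord mulr_natl.
have -> : (size s).+1%:R * (L ^+ (size s).+1 * e) =
  (L ^+ size s * e) * L + L * ((size s)%:R * (L ^+ size s * e)) by rewrite -natr1 exprS; ring.
apply: le_trans (lerD H1 H2).
by apply: le_trans (ler_normD _ _); rewrite addrA subrK.
Qed.
End RiemannSums.

Section GridSums.
Set Implicit Arguments.
Unset Strict Implicit.
Context {R : realType}.

(** Exchanging coordinate [i] of [k] with [y] is an involution on pairs [(k, y)]. *)
Lemma sum_ord_upd d N (i : 'I_d) (F : gidx d N -> R) :
  \sum_k \sum_(y < N) F (ord_upd i (fun=> y) k) = N%:R * \sum_k F k.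
Proof.
rewrite pair_big /=.
pose sw (q : gidx d N * 'I_N) := (ord_upd i (fun=> q.2) q.1, q.1 i).
have swK : involutive sw.
  move=> [k y]; rewrite /sw /= ffunE eqxx; congr pair; apply/ffunP => j.
  by rewrite !ffunE; case: eqP => // ->.
rewrite (reindex_inj (can_inj swK)) /= (eq_bigr (fun q : gidx d N * 'I_N => F q.1)); last first.
  move=> [k y] _ /=; congr F; apply/ffunP => j.
  by rewrite !ffunE; case: eqP => // ->.
rewrite -(pair_big xpredT xpredT (fun k (_ : 'I_N) => F k)) /= mulr_sumr.
by apply: eq_bigr => k _; rewrite sumr_const card_ord mulr_natl.
Qed.

Fixpoint iter_sum d N (s : seq 'I_d) (F : gidx d N -> R) (k : gidx d N) : R :=
  match s with
  | [::] => F k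
  | i :: s' => \sum_(y < N) iter_sum s' F (ord_upd i (fun=> y) k)
  end.

Lemma sum_iter_sum d N (s : seq 'I_d) (F : gidx d N -> R) :
  \sum_k iter_sum s F k = N%:R ^+ size s * \sum_k F k.
Proof.
elim: s => [|i s IH] /=; first by rewrite expr0 mul1r.
by rewrite sum_ord_upd IH exprS mulrA.
Qed.

Lemma eq_iter_sum d N (s : seq 'I_d) (F : gidx d N -> R) (k k' : gidx d N) :
  (forall i, i \notin s -> k i = k' i) -> iter_sum s F k = iter_sum s F k'.
Proof.
elim: s k k' => [|i s IH] k k' kk' /=; first by congr F; apply/ffunP => i; apply: kk'.
apply: eq_bigr => y _; apply: IH => j js; rewrite !ffunE; case: eqVneq => // ji.
by apply: kk'; rewrite in_cons (negbTE ji).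
Qed.

Lemma gridpt_upd d N (L : R) (k : gidx d N) i (y : 'I_N) :
  upd d (gridpt d N L k) i (y%:R * (L / N%:R)) = gridpt d N L (ord_upd i (fun=> y) k).
Proof.
apply/rowP => j; rewrite updE !mxE ffunE mulrC.
by case: eqP.
Qed.

Lemma riemann_sum_grid d N (L : R) (f : 'rV[R]_d -> R) : (0 < N)%N ->
  riemann_sum L N (enum 'I_d) f 0 = (L / N%:R) ^+ d * \sum_k f (gridpt d N L k).
Proof.
move=> N0; pose k0 : gidx d N := [ffun=> Ordinal N0].
have -> : 0 = gridpt d N L k0 by apply/rowP => j; rewrite !mxE ffunE mulr0.
have E s k : riemann_sum L N s f (gridpt d N L k) =
    (L / N%:R) ^+ size s * iter_sum s (fun k => f (gridpt d N L k)) k.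
  elim: s k => [|i s IH] k /=; first by rewrite expr0 mul1r.
  rewrite exprS -[RHS]mulrA; congr (_ * _); rewrite mulr_sumr; apply: eq_bigr => y _.
  by rewrite gridpt_upd IH.
rewrite E size_enum_ord; congr (_ * _).
(* Once all coordinates are summed the base point is irrelevant, so summing over all [N^d] base
   points multiplies by [N^d]; this factor cancels the one in [sum_iter_sum]. *)
have := @sum_iter_sum d N (enum 'I_d) (fun k => f (gridpt d N L k)).
rewrite size_enum_ord (eq_bigr (fun=> iter_sum (enum 'I_d) (fun k => f (gridpt d N L k)) k0)); last first.
  by move=> k _; apply: eq_iter_sum => i; rewrite mem_enum.
rewrite sumr_const card_ffun !card_ord -[X in X = _ -> _]mulr_natl natrX; apply: mulfI.
by rewrite expf_neq0// pnatr_eq0 -lt0n.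
Qed.

Lemma torus_int_grid_cvg d (L : R) (f : 'rV[R]_d -> R) (e : R) : 0 < L -> 0 < e -> unif_cont f ->
  exists M0 : nat, forall M, (M0 <= M)%N -> (0 < M)%N ->
    `|torus_int d L f - (L / M%:R) ^+ d * \sum_k f (gridpt d M L k)| <= e.
Proof.
move=> L0 e0 uf; pose e' := e / (d%:R * L ^+ d + 1).
have p0 : 0 < d%:R * L ^+ d + 1 by rewrite ltr_wpDl// mulr_ge0// exprn_ge0// ltW.
have e'0 : 0 < e' by rewrite divr_gt0.
have [delta d0 mf] := uf e' e'0.
exists (Num.truncn (L / delta)).+1 => M MM M0.
have MR : 0 < M%:R :> R by rewrite ltr0n.
have Md : L / M%:R < delta.
  rewrite ltr_pdivrMr// mulrC -ltr_pdivrMr//.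
  by apply: (lt_le_trans (truncnS_gt _)); rewrite ler_nat.
rewrite -riemann_sum_grid//.
apply: le_trans (iint_riemann_sum_dist (enum 'I_d) 0 L0 d0 M0 Md uf mf) _.
rewrite size_enum_ord mulrA -[leRHS](divfK (lt0r_neq0 p0)) mulrC ler_wpM2l ?(ltW e'0)//.
by rewrite lerDl.
Qed.
End GridSums.

Section PeriodicFunctions.
Set Implicit Arguments.
Unset Strict Implicit.
Context {R : realType}.

Lemma cube_compact d (L : R) : compact (cube d L).
Proof.
have := @rV_compact R d (fun=> `[0, L]%classic) (fun=> @segment_compact R 0 L).
rewrite /cube; congr (compact _); apply/seteqP; split => x /= H i; have := H i;
  by rewrite in_itv.
Qed.

Lemma periodic_nat d (L : R) (f : 'rV[R]_d -> R) i (n : nat) x : torus_periodic d L f ->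
  f (x + (n%:R * L) *: evec d i) = f x.
Proof.
move=> pf; elim: n => [|n IH]; first by rewrite mul0r scale0r addr0.
by rewrite -natr1 mulrDl mul1r scalerDl addrA pf.
Qed.

Lemma periodic_int d (L : R) (f : 'rV[R]_d -> R) i (n : int) x : torus_periodic d L f ->
  f (x + (n%:~R * L) *: evec d i) = f x.
Proof.
move=> pf; case: n => n; first exact: periodic_nat.
rewrite NegzE rmorphN mulNr scaleNr.
by rewrite -(periodic_nat i n.+1 (x - _) pf) subrK.
Qed.

Lemma periodic_lattice d (L : R) (f : 'rV[R]_d -> R) (n : 'I_d -> int) x : torus_periodic d L f ->
  f (x + \sum_i ((n i)%:~R * L) *: evec d i) = f x.
Proof.
move=> pf; elim/big_ind : _ x => [x|u v IHu IHv x|i _ x]; first by rewrite addr0.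
- by rewrite addrA IHv IHu.
- exact: periodic_int.
Qed.

Lemma lattice_translate_coord d (L : R) (n : 'I_d -> int) (x : 'rV[R]_d) j :
  (x + \sum_i ((n i)%:~R * L) *: evec d i) 0 j = x 0 j + (n j)%:~R * L.
Proof.
rewrite mxE summxE; congr (_ + _); rewrite (bigD1 j)//= big1 ?addr0.
  by rewrite !mxE !eqxx mulr1.
by move=> i ij; rewrite !mxE eqxx /= eq_sym (negbTE ij) mulr0.
Qed.

Lemma translate_into_cube d (L : R) (x : 'rV[R]_d) : 0 < L ->
  exists n : 'I_d -> int, cube d L (x + \sum_i ((n i)%:~R * L) *: evec d i).
Proof.
move=> L0; exists (fun i => - Num.floor (x 0 i / L)) => j.
rewrite lattice_translate_coord rmorphN mulNr.
have /andP[] := Num.Theory.floor_itv (x 0 j / L).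
rewrite ler_pdivlMr// ltr_pdivrMr// rmorphD mulrDl mul1r => h1 h2.
by rewrite subr_ge0 h1 lerBlDr addrC ltW.
Qed.

Lemma continuous_modulus_at d (f : 'rV[R]_d -> R) (x : 'rV[R]_d) (e : R) : continuous f -> 0 < e ->
  exists2 delta, 0 < delta & forall y : 'rV[R]_d, (forall i, `|x 0 i - y 0 i| < delta) -> `|f x - f y| <= e.
Proof.
move=> cf e0; have /cvgrPdist_le /(_ e e0) := cf x.
rewrite -near_simpl => /nbhs_ballP [delta /= d0 H]; exists delta => // y xy.
apply: H; split => // i j; rewrite ord1; exact: xy.
Qed.

(** Heine-Cantor on the cube. In [P] the point [y] ranges over the whole space, since a neighbour of
    a point of the cube may lie outside it; one lattice translation, common to [x] and [y], reduces
    to [x] in the cube. *)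
Lemma periodic_unif_cont d (L : R) (f : 'rV[R]_d -> R) : 0 < L -> torus_periodic d L f ->
  continuous f -> unif_cont f.
Proof.
move=> L0 pf cf e e0.
have /compact_near_coveringP K := @cube_compact d L.
pose P (delta : R) (x : 'rV[R]_d) :=
  forall y : 'rV[R]_d, (forall i, `|x 0 i - y 0 i| < delta) -> `|f x - f y| <= e.
have : \forall delta \near (0 : R)^'+, cube d L `<=` P delta.
  apply: K => x _; have [delta d0 H] := continuous_modulus_at x cf (divr_gt0 e0 (ltr0Sn R 1)).
  have d2 : 0 < delta / 2 by rewrite divr_gt0.
  exists (ball x (delta / 2), [set t | 0 < t < delta / 2]) => /=.
    split; first exact: nbhsx_ballx.
    near=> t; apply/andP; split; near: t; [exact: nbhs_right_gt|exact: nbhs_right_lt].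
  move=> [x' t] /= [[_ xx'] /andP[t0 t2]] y x'y.
  have H1 : `|f x - f x'| <= e / 2.
    apply: H => i; apply: lt_trans (_ : delta / 2 < delta); first exact: xx'.
    by rewrite ltr_pdivrMr// mulr_natr mulr2n ltrDl.
  have H2 : `|f x - f y| <= e / 2.
    apply: H => i; have := xx' 0 i; rewrite /ball /= => A.
    have -> : x 0 i - y 0 i = (x 0 i - x' 0 i) + (x' 0 i - y 0 i) by ring.
    apply: le_lt_trans (ler_normD _ _) _; have := x'y i; lra.
  have -> : f x' - f y = (f x - f y) - (f x - f x') by ring.
  by apply: le_trans (ler_normB _ _) _; lra.
move=> H.
have [delta [d0 Hd]] : exists delta, 0 < delta /\ cube d L `<=` P delta.
  near (0 : R)^'+ => delta; exists delta; split; last by near: delta.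
  by near: delta; exact: nbhs_right_gt.
exists delta => // x y xy; have [n nx] := translate_into_cube x L0.
rewrite -(periodic_lattice n x pf) -(periodic_lattice n y pf).
apply: (Hd _ nx) => i; rewrite !lattice_translate_coord.
by rewrite (_ : _ - _ = x 0 i - y 0 i)//; ring.
Unshelve. all: by end_near.
Qed.

Lemma Linfnorm_ge d (L : R) (f : 'rV[R]_d -> R) x : continuous f -> cube d L x ->
  `|f x| <= Linfnorm d L f.
Proof.
move=> cf cx; apply: ub_le_sup; last by exists x.
have cN : {within cube d L, continuous (fun x => `|f x|)}.
  apply: continuous_subspaceT => y; apply: (@continuous_comp _ _ _ f (fun r : R => `|r|)); [exact: cf|exact: norm_continuous].
have /compact_bounded [M [_ HM]] := continuous_compact cN (@cube_compact d L).
exists (M + 1) => y hy; apply: le_trans (ler_norm y) _; apply: HM => //.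
by rewrite ltrDl.
Qed.
End PeriodicFunctions.

(** * Finite differences and the Laplacian *)

Section DeriveTransfer.
Set Implicit Arguments.
Unset Strict Implicit.
Context {R : realType}.

Section TwoSpaces.
Variables (U V : normedModType R) (f : U -> R) (g : V -> R) (x v : U) (y w : V).
Hypothesis fg : forall h : R, f (h *: v + x) = g (h *: w + y).

Let quotientE : (fun h : R => h^-1 *: ((f \o shift x) (h *: v) - f x)) =
    (fun h : R => h^-1 *: ((g \o shift y) (h *: w) - g y)).
Proof.
apply/funext => h /=; rewrite fg; congr (_ *: (_ - _)).
by have := fg 0; rewrite !scale0r !add0r.
Qed.

(** Functions that agree along two lines have the same difference quotients. This covers
    translations, restrictions to a line and periodicity of derivatives at once. *)
Lemma derive_transfer : 'D_v f x = 'D_w g y.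
Proof. by rewrite /derive quotientE. Qed.

Lemma is_derive_transfer (l : R) : is_derive x v f l -> is_derive y w g l.
Proof. by move=> [df dE]; split; [move: df; rewrite /derivable quotientE|rewrite -derive_transfer]. Qed.
End TwoSpaces.
End DeriveTransfer.

Section Partials.
Set Implicit Arguments.
Unset Strict Implicit.
Context {R : realType}.
Variable d : nat.
Implicit Types (f g : 'rV[R]_d -> R) (x : 'rV[R]_d) (i j : 'I_d).

Lemma is_derive_partial f i x : derivable f x (evec d i) -> is_derive x (evec d i) f (partial d i f x).
Proof. by move=> df; split. Qed.

Lemma partial_val f i x l : is_derive x (evec d i) f l -> partial d i f x = l.
Proof. by move=> H; apply: derive_val. Qed.

Lemma is_derive_translate f i x a l : is_derive (x + a) (evec d i) f l ->
  is_derive x (evec d i) (fun y => f (y + a)) l.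
Proof. by apply: is_derive_transfer => h; rewrite addrA. Qed.

Lemma is_derive_line f i x (y l : R) : is_derive (x + y *: evec d i) (evec d i) f l ->
  is_derive y 1 (fun z => f (x + z *: evec d i)) l.
Proof.
apply: is_derive_transfer => h; congr f.
by rewrite (_ : h *: 1 = h) ?scalerDl 1?addrCA// -[LHS]/(h * 1) mulr1.
Qed.

Lemma Ck_continuous k f : Ck d k f -> continuous f.
Proof. by case: k => [|k] //= []. Qed.

Lemma Ck_is_derive k f i x : Ck d k.+1 f -> is_derive x (evec d i) f (partial d i f x).
Proof. by move=> [_ H]; apply: is_derive_partial; have [] := H i. Qed.

Lemma Ck_partial k f i : Ck d k.+1 f -> Ck d k (partial d i f).
Proof. by move=> [_ H]; have [] := H i. Qed.

Lemma Ck_pred k f : Ck d k.+1 f -> Ck d k f.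
Proof.
elim: k f => [|k IH] f [cf H]; first exact: cf.
by split=> // i; have [df pf] := H i; split=> //; exact: IH.
Qed.

Lemma Ck_le k m f : (m <= k)%N -> Ck d k f -> Ck d m f.
Proof.
move=> /subnK <-; elim: (k - m)%N => [//|n IH]; rewrite addSn => /Ck_pred; exact: IH.
Qed.

Lemma partialD k f g i : Ck d k.+1 f -> Ck d k.+1 g ->
  partial d i (fun x => f x + g x) = (fun x => partial d i f x + partial d i g x).
Proof.
move=> hf hg; apply/funext => x; apply: partial_val.
by apply: is_deriveD; [exact: Ck_is_derive hf|exact: Ck_is_derive hg].
Qed.

Lemma partialM k f g i : Ck d k.+1 f -> Ck d k.+1 g ->
  partial d i (fun x => f x * g x) = (fun x => f x * partial d i g x + g x * partial d i f x).
Proof.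
move=> hf hg; apply/funext => x; apply: partial_val.
by apply: is_deriveM; [exact: Ck_is_derive hf|exact: Ck_is_derive hg].
Qed.

Lemma CkD k f g : Ck d k f -> Ck d k g -> Ck d k (fun x => f x + g x).
Proof.
elim: k f g => [|k IH] f g hf hg /=.
  by have [cf cg] : continuous f /\ continuous g := conj hf hg; move=> x; exact: (cvgD (cf x) (cg x)).
have [cf cg] := (Ck_continuous hf, Ck_continuous hg).
split; first by move=> x; exact: (cvgD (cf x) (cg x)).
move=> i; split=> [x|].
  by apply: (@ex_derive _ _ _ _ _ _ _ (is_deriveD (Ck_is_derive i x hf) (Ck_is_derive i x hg))).
by rewrite (partialD i hf hg); apply: IH; exact: Ck_partial.
Qed.

Lemma CkM k f g : Ck d k f -> Ck d k g -> Ck d k (fun x => f x * g x).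
Proof.
elim: k f g => [|k IH] f g hf hg /=.
  by have [cf cg] : continuous f /\ continuous g := conj hf hg; move=> x; exact: (cvgM (cf x) (cg x)).
have [cf cg] := (Ck_continuous hf, Ck_continuous hg).
split; first by move=> x; exact: (cvgM (cf x) (cg x)).
move=> i; split=> [x|].
  by apply: (@ex_derive _ _ _ _ _ _ _ (is_deriveM (Ck_is_derive i x hf) (Ck_is_derive i x hg))).
rewrite (partialM i hf hg); apply: CkD; apply: IH; try exact: Ck_pred; exact: Ck_partial.
Qed.

Lemma Ck_cst k (c : R) : Ck d k (fun=> c).
Proof.
elim: k c => [|k IH] c /=; first exact: cst_continuous.
split; first exact: cst_continuous.
move=> i; split=> [x|]; first exact: derivable_cst.
have -> : partial d i (fun=> c) = (fun=> 0).
  by apply/funext => x; apply: partial_val; exact: is_derive_cst.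
exact: IH.
Qed.

Lemma Ck_sum k (I : Type) (r : seq I) (F : I -> 'rV[R]_d -> R) : (forall a, Ck d k (F a)) ->
  Ck d k (fun x => \sum_(a <- r) F a x).
Proof.
move=> H; elim: r => [|a r IH].
  have -> : (fun x => \sum_(a <- [::]) F a x) = (fun=> 0) by apply/funext => x; rewrite big_nil.
  exact: Ck_cst.
have -> : (fun x => \sum_(b <- a :: r) F b x) = (fun x => F a x + \sum_(b <- r) F b x).
  by apply/funext => x; rewrite big_cons.
exact: CkD.
Qed.

Lemma partial_sum k (I : Type) (r : seq I) (F : I -> 'rV[R]_d -> R) i : (forall a, Ck d k.+1 (F a)) ->
  partial d i (fun x => \sum_(a <- r) F a x) = (fun x => \sum_(a <- r) partial d i (F a) x).
Proof.
move=> H; elim: r => [|a r IH].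
  apply/funext => x; rewrite big_nil; apply: partial_val.
  have -> : (fun x => \sum_(a <- [::]) F a x) = (fun=> 0) by apply/funext => y; rewrite big_nil.
  exact: is_derive_cst.
have -> : (fun x => \sum_(b <- a :: r) F b x) = (fun x => F a x + \sum_(b <- r) F b x).
  by apply/funext => x; rewrite big_cons.
rewrite (partialD i (H a) (Ck_sum r H)) IH; apply/funext => x.
by rewrite big_cons.
Qed.

Lemma lap_sum k (I : Type) (r : seq I) (F : I -> 'rV[R]_d -> R) : (forall a, Ck d k.+2 (F a)) ->
  lap d (fun x => \sum_(a <- r) F a x) = (fun x => \sum_(a <- r) lap d (F a) x).
Proof.
move=> H; apply/funext => x; rewrite /lap exchange_big /=; apply: eq_bigr => i _.
rewrite (partial_sum r i H) (@partial_sum k I r (fun a => partial d i (F a)))//.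
by move=> a; exact: Ck_partial.
Qed.

Lemma Ck_lap k f : Ck d k.+2 f -> Ck d k (lap d f).
Proof. by move=> H; apply: Ck_sum => i; do 2!apply: Ck_partial. Qed.

Lemma lapnS m f : lapn d m.+1 f = lapn d m (lap d f).
Proof. by rewrite /lapn iterSr. Qed.

Lemma Ck_lapn m k f : Ck d (2 * m + k) f -> Ck d k (lapn d m f).
Proof.
elim: m f => [|m IH] f; first by [].
by rewrite lapnS mulnS => H; apply: IH; exact: Ck_lap.
Qed.

Lemma lapn_sum m (I : Type) (r : seq I) (F : I -> 'rV[R]_d -> R) : (forall a, Ck d (2 * m) (F a)) ->
  lapn d m (fun x => \sum_(a <- r) F a x) = (fun x => \sum_(a <- r) lapn d m (F a) x).
Proof.
elim: m F => [//|m IH] F H.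
rewrite lapnS; rewrite mulnS in H.
rewrite (lap_sum r H) IH; last by move=> a; apply: Ck_lap; exact: H.
by apply/funext => x; apply: eq_bigr => a _; rewrite lapnS.
Qed.

Lemma lapM k f g : Ck d k.+2 f -> Ck d k.+2 g ->
  lap d (fun x => f x * g x) =
  (fun x => f x * lap d g x + 2 * (\sum_i partial d i f x * partial d i g x) + g x * lap d f x).
Proof.
move=> hf hg; apply/funext => x; rewrite /lap !mulr_sumr -!big_split; apply: eq_bigr => i _ /=.
have pf := Ck_partial i hf; have pg := Ck_partial i hg.
rewrite (partialM i hf hg) (partialD i (CkM (Ck_pred hf) pg) (CkM (Ck_pred hg) pf)).
by rewrite (partialM i (Ck_pred hf) pg) (partialM i (Ck_pred hg) pf); ring.
Qed.

Lemma periodic_partial L f i : torus_periodic d L f -> torus_periodic d L (partial d i f).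
Proof.
by move=> pf j x; apply: derive_transfer => h; rewrite addrA pf.
Qed.

Lemma periodic_lap L f : torus_periodic d L f -> torus_periodic d L (lap d f).
Proof.
move=> pf j x; rewrite /lap; apply: eq_bigr => i _.
exact: (periodic_partial i (periodic_partial i pf) j x).
Qed.

Lemma periodic_lapn L m f : torus_periodic d L f -> torus_periodic d L (lapn d m f).
Proof. by move=> pf; elim: m => [//|m IH]; exact: periodic_lap. Qed.
End Partials.

Section FiniteDifferences.
Set Implicit Arguments.
Unset Strict Implicit.
Context {R : realType}.
Variable d : nat.
Implicit Types (f g : 'rV[R]_d -> R) (x : 'rV[R]_d) (i j : 'I_d).

(** The difference Laplacian on functions of a continuous variable: it commutes with partial
    derivatives, and [dlap_grid] relates its samples to [dlap]. *)
Definition flap (h : R) f x : R :=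
  \sum_i h ^- 2 * (f (x + h *: evec d i) + f (x - h *: evec d i) - 2 * f x).

Lemma is_derive_flap h f g i : (forall x, is_derive x (evec d i) f (g x)) ->
  forall x, is_derive x (evec d i) (flap h f) (flap h g x).
Proof.
move=> df x; rewrite /flap.
have D j : is_derive x (evec d i)
   (fun x => h ^- 2 * (f (x + h *: evec d j) + f (x - h *: evec d j) - 2 * f x))
   (h ^- 2 * (g (x + h *: evec d j) + g (x - h *: evec d j) - 2 * g x)).
  apply: is_deriveZ; apply: is_deriveB.
  by apply: is_deriveD; exact: is_derive_translate.
have E : (fun x => \sum_j h ^- 2 * (f (x + h *: evec d j) + f (x - h *: evec d j) - 2 * f x)) =
   \sum_j (fun x => h ^- 2 * (f (x + h *: evec d j) + f (x - h *: evec d j) - 2 * f x)).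
  by apply/funext => y; rewrite fct_sumE.
by rewrite E; apply: is_derive_sum.
Qed.

Lemma is_derive_iter_flap n h f g i : (forall x, is_derive x (evec d i) f (g x)) ->
  forall x, is_derive x (evec d i) (iter n (flap h) f) (iter n (flap h) g x).
Proof. by move=> df; elim: n => [//|n IH] x; exact: is_derive_flap. Qed.

Lemma flap_MVT h f (f1 f2 : 'I_d -> 'rV[R]_d -> R) x : 0 < h ->
  (forall i x, is_derive x (evec d i) f (f1 i x)) ->
  (forall i x, is_derive x (evec d i) (f1 i) (f2 i x)) ->
  exists c : 'I_d -> R, (forall i, `|c i| <= h) /\
     flap h f x = \sum_i f2 i (x + c i *: evec d i).
Proof.
move=> h0 d1 d2.
have H i : exists c : R, `|c| <= h /\
    f (x + h *: evec d i) + f (x - h *: evec d i) - 2 * f x = h ^+ 2 * f2 i (x + c *: evec d i).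
  have [|y|c ch E] := @second_difference_MVT R (fun z => f (x + z *: evec d i))
    (fun z => f1 i (x + z *: evec d i)) (fun z => f2 i (x + z *: evec d i)) h h0.
  - by move=> y; apply: is_derive_line.
  - by apply: is_derive_line.
  by exists c; split => //; move: E; rewrite scaleNr scale0r addr0.
have [c Hc] := choice H.
exists c; split=> [i|]; first by have [] := Hc i.
rewrite /flap; apply: eq_bigr => i _; have [_ ->] := Hc i.
by rewrite mulKf// expf_neq0// gt_eqF.
Qed.

(** With only [2 n] derivatives available the outermost [flap] is peeled off by the mean value
    theorem: since [flap] commutes with derivatives, it yields [iter n (flap h)] of the pure second
    derivatives at shifted points. Induction treats these, and uniform continuity of their [lapn]
    absorbs the shifts. *)
Lemma flap_cvg L n f (e : R) : 0 < L -> torus_periodic d L f -> Ck d (2 * n) f -> 0 < e ->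
  \forall h \near (0 : R)^'+, forall x, `|iter n (flap h) f x - lapn d n f x| <= e.
Proof.
move=> L0; elim: n f e => [|n IH] f e pf hf e0.
  by near=> h => x; rewrite subrr normr0 ltW.
rewrite mulnS in hf.
pose f1 i := partial d i f; pose f2 i := partial d i (f1 i).
have hf2 i : Ck d (2 * n) (f2 i) by do 2!apply: Ck_partial.
have pf2 i : torus_periodic d L (f2 i) by do 2!apply: periodic_partial.
pose e' := e / (2 * d%:R + 1).
have p0 : 0 < 2 * d%:R + 1 :> R by rewrite ltr_wpDl// mulr_ge0.
have e'0 : 0 < e' by rewrite divr_gt0.
have N1 : \forall h \near (0 : R)^'+, forall i x, `|iter n (flap h) (f2 i) x - lapn d n (f2 i) x| <= e'.
  by apply: filter_forall => i; exact: IH.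
(* The factor 2 turns [|c i| <= h] into the strict inequality required by [modulus]. *)
have N2 : \forall h \near (0 : R)^'+, forall i, modulus e' (2 * h) (lapn d n (f2 i)).
  apply: filter_forall => i.
  have [|delta delta0 md] := @periodic_unif_cont R d L (lapn d n (f2 i)) L0 (periodic_lapn n (pf2 i)) _ e' e'0.
    by apply: (@Ck_continuous _ _ 0); apply: Ck_lapn; rewrite addn0.
  near=> h => x y xy; apply: md => j; apply: lt_le_trans (xy j) _.
  rewrite -ler_pdivlMl//; near: h; apply: nbhs_right_le; by rewrite mulr_gt0.
near=> h => x; have h0 : 0 < h by near: h; exact: nbhs_right_gt.
have d1 i y : is_derive y (evec d i) (iter n (flap h) f) (iter n (flap h) (f1 i) y).
  by apply: is_derive_iter_flap => z; exact: Ck_is_derive hf.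
have d2 i y : is_derive y (evec d i) (iter n (flap h) (f1 i)) (iter n (flap h) (f2 i) y).
  by apply: is_derive_iter_flap => z; exact: Ck_is_derive (Ck_partial i hf).
have [c [ch E]] := flap_MVT x h0 d1 d2.
rewrite iterS E lapnS (@lapn_sum _ _ n _ _ f2)// -sumrB.
apply: le_trans (ler_norm_sum _ _ _) _.
apply: (@le_trans _ _ (\sum_(i < d) 2 * e')); last first.
  rewrite sumr_const card_ord -[_ *+ d]mulr_natr mulrAC -[leRHS](divfK (lt0r_neq0 p0)) -/e' mulrC.
  by rewrite ler_wpM2l ?(ltW e'0)// lerDl.
apply: ler_sum => i _.
have A1 : `|iter n (flap h) (f2 i) (x + c i *: evec d i) - lapn d n (f2 i) (x + c i *: evec d i)| <= e'.
  have : forall i x, `|iter n (flap h) (f2 i) x - lapn d n (f2 i) x| <= e' by near: h.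
  exact.
have A2 : `|lapn d n (f2 i) (x + c i *: evec d i) - lapn d n (f2 i) x| <= e'.
  have : forall i, modulus e' (2 * h) (lapn d n (f2 i)) by near: h.
  apply => j; rewrite !mxE addrAC subrr add0r.
  have ch' : `|c i| < 2 * h by have := ch i; lra.
  by case: (_ && _); rewrite ?mulr1// mulr0 normr0 mulr_gt0.
set A := iter n _ _ _ in A1 *; set B := lapn d n (f2 i) (_ + _) in A1 A2.
have -> : A - lapn d n (f2 i) x = (A - B) + (B - lapn d n (f2 i) x) by ring.
by apply: le_trans (ler_normD _ _) _; lra.
Unshelve. all: by end_near.
Qed.
End FiniteDifferences.

(** * The kinetic operator on the grid *)

Section GridLaplacian.
Set Implicit Arguments.
Unset Strict Implicit.
Context {R : realType}.
Local Notation "x %:C" := (@real_complex_def _ (Phant _) x) : ring_scope.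
Variables (d : nat) (L : R).
Implicit Types (f : 'rV[R]_d -> R).

(** When the last index wraps to 0 the two points differ by a period [L]. *)
Lemma gridpt_ordS M (x : gidx d M) i f : torus_periodic d L f ->
  f (gridpt d M L x + (L / M%:R) *: evec d i) = f (gridpt d M L (ord_upd i (@ordS M) x)).
Proof.
move=> pf; have M0 : (0 < M)%N := leq_ltn_trans (leq0n _) (ltn_ord (x i)).
have MR : (M%:R : R) != 0 by rewrite pnatr_eq0 -lt0n.
have [xM|xM] := ltnP (x i).+1 M.
  congr f; apply/rowP => j; rewrite !mxE ffunE eqxx /=.
  case: eqVneq => [->|ji]; last by rewrite mulr0 addr0.
  by rewrite /= modn_small// mulr1 -[(x i).+1%:R]natr1 mulrDr mulr1.
have xE : (x i).+1 = M by apply/eqP; rewrite eqn_leq xM ltn_ord.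
rewrite -(pf i (gridpt d M L (ord_upd _ _ _))); congr f; apply/rowP => j.
rewrite !mxE ffunE eqxx /=; case: eqVneq => [->|ji]; last by rewrite !mulr0 !addr0.
rewrite /= xE modnn mulr0 add0r !mulr1.
have -> : (x i)%:R = M%:R - 1 :> R by rewrite -[in RHS]xE -natr1 addrK.
by rewrite mulrBr mulr1 divfK// subrK.
Qed.

Lemma gridpt_ord_pred M (x : gidx d M) i f : torus_periodic d L f ->
  f (gridpt d M L x - (L / M%:R) *: evec d i) = f (gridpt d M L (ord_upd i (@ord_pred M) x)).
Proof.
move=> pf; set y := ord_upd i _ x.
have -> : x = ord_upd i (@ordS M) y.
  by apply/ffunP => j; rewrite !ffunE; case: eqP => // _; rewrite ord_predK.
pose g z := f (z - (L / M%:R) *: evec d i).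
have pg : torus_periodic d L g by move=> j z; rewrite /g addrAC pf.
by rewrite -[LHS]/(g _) -(gridpt_ordS y i pg) /g addrK.
Qed.

Lemma periodic_flap h f : torus_periodic d L f -> torus_periodic d L (flap h f).
Proof.
move=> pf j x; rewrite /flap; apply: eq_bigr => i _.
have E y : f (x + L *: evec d j + y) = f (x + y) by rewrite addrAC pf.
by rewrite !E pf.
Qed.

Lemma periodic_iter_flap n h f : torus_periodic d L f -> torus_periodic d L (iter n (flap h) f).
Proof. by move=> pf; elim: n => [//|n IH]; exact: periodic_flap. Qed.

Lemma dlap_grid M f x : torus_periodic d L f ->
  dlap (L / M%:R) (fun x => (f (gridpt d M L x))%:C) x = (flap (L / M%:R) f (gridpt d M L x))%:C.
Proof.
move=> pf; rewrite /dlap /flap rmorph_sum; apply: eq_bigr => i _.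
rewrite gridpt_ordS// gridpt_ord_pred// rmorphM rmorphB rmorphD rmorphM.
by rewrite rmorph_nat.
Qed.

Lemma iter_dlap_grid n M f : torus_periodic d L f ->
  iter n (dlap (L / M%:R)) (fun x => (f (gridpt d M L x))%:C) =
  (fun x => (iter n (flap (L / M%:R)) f (gridpt d M L x))%:C).
Proof.
move=> pf; elim: n => [//|n IH]; rewrite iterS IH; apply/funext => x.
by rewrite dlap_grid//; exact: periodic_iter_flap.
Qed.

Lemma grid_energy n M f : (0 < M)%N -> ~~ odd M -> torus_periodic d L f ->
  (L / M%:R) ^+ d * \sum_x iter n (flap (L / M%:R)) f (gridpt d M L x) ^+ 2 =
  L ^+ d * \sum_k nsq (dft (fun x : gidx d M => (f (gridpt d M L x))%:C) k) * dlap_symbol (L / M%:R) k ^+ (2 * n).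
Proof.
move=> M0 eM pf; have MR : (M%:R ^+ d : R) != 0 by rewrite expf_neq0// pnatr_eq0 -lt0n.
have := @parseval_dlap R d M (L / M%:R) n (fun x => (f (gridpt d M L x))%:C) M0 eM.
rewrite iter_dlap_grid//; under eq_bigr do rewrite nsq_real.
by move=> ->; rewrite expr_div_n mulrA divfK.
Qed.
End GridLaplacian.

(** * Letting the fine grid tend to the continuum *)

Section Refinement.
Set Implicit Arguments.
Unset Strict Implicit.
Context {R : realType}.
Local Notation "x %:C" := (@real_complex_def _ (Phant _) x) : ring_scope.
Variables (d N : nat) (L : R).
Hypotheses (d0 : (0 < d)%N) (N0 : (0 < N)%N) (eN : ~~ odd N) (L0 : 0 < L).
Implicit Types (f : 'rV[R]_d -> R).
Let M r := (N * r.*2.+1)%N.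
Let h r : R := L / (M r)%:R.

Let centre r : gidx d r.*2.+1 := [ffun=> inord r].

Let M0 r : (0 < M r)%N. Proof. by rewrite muln_gt0 N0. Qed.
Let eM r : ~~ odd (M r). Proof. by rewrite oddM negb_and eN. Qed.
Let h_gt0 r : 0 < h r. Proof. by rewrite divr_gt0// ltr0n. Qed.
Let M_ge r : (r <= M r)%N.
Proof. by apply: leq_trans (leq_pmull _ N0); lia. Qed.

Lemma near_mesh (P : R -> Prop) : (\forall x \near (0 : R)^'+, P x) -> \forall r \near \oo, P (h r).
Proof.
case=> e /= e0 H; near=> r; apply: H => //=; rewrite sub0r normrN gtr0_norm//.
rewrite /h ltr_pdivrMr ?ltr0n// mulrC -ltr_pdivrMr//.
apply: (@lt_le_trans _ _ r%:R); last by rewrite ler_nat.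
apply: lt_le_trans (truncnS_gt _) _; rewrite ler_nat.
by near: r; exact: nbhs_infty_ge.
Unshelve. all: by end_near.
Qed.

Lemma mesh_cvg0 : h @ \oo --> (0 : R)^'.
Proof.
move=> A [e /= e0 HA]; have := @near_mesh (fun x => A x).
apply; exists e => //= x xe x0; apply: HA => //=.
by rewrite gt_eqF.
Qed.

Lemma energy_cvg n f : torus_periodic d L f -> Ck d (2 * n) f ->
  (fun r => (L / (M r)%:R) ^+ d * \sum_(x : gidx d (M r)) iter n (flap (h r)) f (gridpt d (M r) L x) ^+ 2) @ \oo
   --> torus_int d L (fun x => lapn d n f x ^+ 2).
Proof.
move=> pf hf; set g := lapn d n f.
have pg : torus_periodic d L g by exact: periodic_lapn.
have cg : continuous g by apply: (@Ck_continuous _ _ 0); apply: Ck_lapn; rewrite addn0.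
have [B B0 gB] : exists2 B : R, 0 < B & forall x, `|g x| <= B.
  exists (Linfnorm d L g + 1) => [|x].
    have c0 : cube d L 0 by move=> i; rewrite mxE lexx ltW.
    by have := Linfnorm_ge cg c0; have := normr_ge0 (g 0); lra.
  have [m mx] := translate_into_cube x L0; rewrite -(periodic_lattice m x pg).
  by have := Linfnorm_ge cg mx; lra.
have ug2 : unif_cont (fun x => g x ^+ 2).
  apply: (@periodic_unif_cont _ _ L) => //; first by move=> i x; rewrite pg.
  by move=> x; exact: (cvgM (cg x) (cg x)).
apply/cvgrPdist_le => /= e e0.
(* If [|a| <= B] and [|b - a| <= eta <= 1], then [|a^2 - b^2| <= eta (2 B + 1)]. *)
pose eta := Num.min 1 (e / 2 / (L ^+ d * (2 * B + 1))).
have Ld : 0 < L ^+ d by rewrite exprn_gt0.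
have P0 : 0 < L ^+ d * (2 * B + 1) by rewrite mulr_gt0//; lra.
have e20 : 0 < e / 2 by rewrite divr_gt0.
have eta0 : 0 < eta by rewrite lt_min ltr01 divr_gt0.
have eta1 : eta <= 1 by rewrite ge_min lexx.
have etaP : L ^+ d * (eta * (2 * B + 1)) <= e / 2.
  by rewrite mulrCA -ler_pdivlMr// ge_min lexx orbT.
have N1 := near_mesh (flap_cvg L0 pf hf eta0).
have [K HK] := torus_int_grid_cvg L0 e20 ug2.
near=> r.
have H1 : `|torus_int d L (fun x => g x ^+ 2) -
    (L / (M r)%:R) ^+ d * \sum_(x : gidx d (M r)) g (gridpt d (M r) L x) ^+ 2| <= e / 2.
  apply: HK => //; apply: leq_trans (M_ge r); near: r; exact: nbhs_infty_ge.
have H2 : forall x, `|iter n (flap (h r)) f x - g x| <= eta by near: r.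
set S1 := _ * \sum_x g _ ^+ 2 in H1.
set S2 := _ * \sum_x _.
suff H3 : `|S1 - S2| <= e / 2.
  have -> : torus_int d L (fun x => g x ^+ 2) - S2 = (torus_int d L (fun x => g x ^+ 2) - S1) + (S1 - S2) by ring.
  by apply: le_trans (ler_normD _ _) _; lra.
rewrite /S1 /S2 -mulrBr -sumrB normrM ger0_norm ?exprn_ge0 ?(ltW (h_gt0 r))//.
apply: le_trans etaP.
have MR : ((M r)%:R ^+ d : R) != 0 by rewrite expf_neq0// pnatr_eq0 -lt0n.
have -> : L ^+ d = (L / (M r)%:R) ^+ d * (M r)%:R ^+ d by rewrite expr_div_n divfK.
rewrite -mulrA ler_wpM2l ?exprn_ge0 ?(ltW (h_gt0 r))//.
apply: le_trans (ler_norm_sum _ _ _) _.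
apply: (@le_trans _ _ (\sum_(x : gidx d (M r)) (eta * (2 * B + 1)))); last first.
  by rewrite sumr_const card_ffun !card_ord -[_ *+ (_ ^ _)]mulr_natl natrX.
apply: ler_sum => x _; set a := g _; set b := iter _ _ _ _.
have ab : `|b - a| <= eta by exact: H2.
have aB : `|a| <= B by exact: gB.
have -> : a ^+ 2 - b ^+ 2 = - ((b - a) * (2 * a + (b - a))) by ring.
rewrite normrN normrM ler_pM//; apply: le_trans (ler_normD _ _) _.
rewrite normrM gtr0_norm//; lra.
Unshelve. all: by end_near.
Qed.

Lemma cvg_fin_sum (I : finType) (F : I -> nat -> R) (a : I -> R) :
  (forall i, F i @ \oo --> a i) -> (fun r => \sum_i F i r) @ \oo --> \sum_i a i.
Proof. by move=> H; apply: cvg_big => [|i _]; [exact: add_continuous|exact: H]. Qed.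

(** The central alias keeps the frequency of [l] while the mesh shrinks, so each term
    [4 h^-2 sin(c h)^2] tends to [4 c^2] with [c = pi freq / L]. *)
Lemma central_symbol_cvg (l : gidx d N) :
  (fun r => dlap_symbol (h r) (merge l (centre r))) @ \oo --> kin_symbol L l.
Proof.
apply: cvg_fin_sum => j.
pose c : R := pi * freq N (l j) / L.
have E : (fun r => 4 / h r ^+ 2 * sin (pi * freq (M r) (merge l (centre r) j) / (M r)%:R) ^+ 2) =
    (fun r => 4 * (((h r)^-1 * sin (c * h r)) * ((h r)^-1 * sin (c * h r)))).
  apply/funext => r; rewrite !ffunE freq_merge inordK; last by lia.
  rewrite subrr mulr0 addr0.
  have -> : pi * freq N (l j) / (M r)%:R = c * h r.
    by rewrite /c /h; set m := (M r)%:R; rewrite mulrA divfK// gt_eqF.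
  by rewrite [in RHS]mulrACA -expr2 -[sin _ * sin _]expr2 exprVn [RHS]mulrA.
rewrite E; have -> : (2 * pi / L) ^+ 2 * freq N (l j) ^+ 2 = 4 * (c * c).
  by rewrite /c -exprMn expr2; ring.
apply: cvgMl_tmp.
by have H := cvg_comp _ _ mesh_cvg0 (@sin_lin_cvg R c); exact: (cvgM H H).
Qed.

Lemma central_error_cvg n : (fun r => central_error d N r L n) @ \oo --> (0 : R).
Proof.
rewrite (_ : 0 = \sum_(l : gidx d N) (0 : R)); last by rewrite big1.
apply: cvg_fin_sum => l; have H := @central_symbol_cvg l.
(* At zero frequency the limit of the denominator is 0 and limits of quotients do not apply; but
   there the term is 0 for every [r]. *)
have [z|nz] := eqVneq (kin_symbol L l) 0.
  have f0 j : freq N (l j) = 0 :> R.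
    have := z => /eqP; rewrite psumr_eq0 => [/allP/(_ j)|i _]; last by rewrite mulr_ge0 ?sqr_ge0.
    rewrite mem_index_enum mulf_eq0 !sqrf_eq0 => /(_ isT) /orP[|/eqP//].
    by rewrite gt_eqF// divr_gt0 ?mulr_gt0 ?pi_gt0.
  rewrite (_ : (fun r => _) = fun=> 0); first exact: cvg_cst.
  apply/funext => r; rewrite z.
  have -> : dlap_symbol (L / (N * r.*2.+1)%:R) (merge l (centre r)) = 0.
    apply: big1 => j _; rewrite !ffunE freq_merge inordK; last by lia.
    by rewrite subrr mulr0 addr0 f0 mulr0 mul0r sin0 expr0n mulr0.
  by rewrite subrr mulr0 expr0n mul0r.
have A : (fun r => 2^-1 * (kin_symbol L l - dlap_symbol (h r) (merge l (centre r)))) @ \oo --> (0 : R).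
  rewrite (_ : 0 = 2^-1 * (kin_symbol L l - kin_symbol L l)); last by rewrite subrr mulr0.
  by apply: cvgMl_tmp; apply: cvgB; [exact: cvg_cst|exact: H].
have P (k : nat) : (fun r => dlap_symbol (h r) (merge l (centre r)) ^+ k) @ \oo --> kin_symbol L l ^+ k.
  elim: k => [|k IH]; first by under eq_fun do rewrite expr0; exact: cvg_cst.
  by rewrite exprS; under eq_fun do rewrite exprS; exact: cvgM.
have -> : 0 = 0 * 0 / kin_symbol L l ^+ (2 * n) by rewrite !mul0r.
apply: cvgM; first exact: (cvgM A A).
by apply: cvgV; [rewrite expf_neq0|exact: P].
Qed.

Lemma torus_int_sqr_ge0 (f : 'rV[R]_d -> R) : 0 <= torus_int d L (fun x => f x ^+ 2).
Proof.
rewrite /torus_int; move: (enum 'I_d) (0 : 'rV[R]_d) => s; elim: s => [|i s IH] x /=; first exact: sqr_ge0.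
by apply: Rintegral_ge0 => y _; exact: IH.
Qed.

Lemma L2norm_sqr (f : 'rV[R]_d -> R) : L2norm d L f ^+ 2 = torus_int d L (fun x => f x ^+ 2).
Proof. by rewrite sqr_sqrtr// torus_int_sqr_ge0. Qed.

(** The limit of [kinetic_error_le] in [r]. The values of [f] at coarse points do not change with
    [r], so on the left only [flap] moves, towards [lap]. *)
Lemma kinetic_grid_error s f : (d + 7 <= 4 * s)%N -> torus_periodic d L f -> Ck d (2 * s.+1) f ->
  (L / N%:R) ^+ d * \sum_(x : gidx d N)
    nsq ((2^-1 * lap d f (gridpt d N L x))%:C + \sum_x' Kop d N L x x' * (f (gridpt d N L x'))%:C)
  <= L2norm d L (lapn d s.+1 f) ^+ 2 * ((L * d%:R / N%:R) ^+ (4 * s) / 16).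
Proof.
move=> ds pf hf; have wN : 0 <= (L / N%:R) ^+ d by rewrite exprn_ge0// divr_ge0// ltW.
pose z (x : gidx d N) := \sum_x' Kop d N L x x' * (f (gridpt d N L x'))%:C.
pose err (a : 'rV[R]_d -> R) := (L / N%:R) ^+ d * \sum_(x : gidx d N) nsq ((2^-1 * a (gridpt d N L x))%:C + z x).
pose E r := (L / (M r)%:R) ^+ d * \sum_(x : gidx d (M r)) iter s.+1 (flap (h r)) f (gridpt d (M r) L x) ^+ 2.
pose D := (L * d%:R / N%:R) ^+ (4 * s) / 16.
rewrite L2norm_sqr -/(err (lap d f)).
have cE := energy_cvg pf hf; rewrite -/E in cE.
have cD : (fun r => E r * (central_error d N r L s.+1 + D)) @ \oo -->
    torus_int d L (fun x => lapn d s.+1 f x ^+ 2) * D.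
  rewrite -{2}(add0r D); apply: cvgM; first exact: cE.
  by apply: cvgD; [exact: central_error_cvg|exact: cvg_cst].
have cerr : (fun r => err (flap (h r) f)) @ \oo --> err (lap d f).
  apply: cvgMl_tmp; apply: cvg_fin_sum => x.
  have hf2 : Ck d (2 * 1) f by apply: Ck_le hf; lia.
  have c1 : (fun r => flap (h r) f (gridpt d N L x)) @ \oo --> lap d f (gridpt d N L x).
    apply/cvgrPdist_le => e e0; have := near_mesh (flap_cvg L0 pf hf2 e0).
    by apply: filterS => r H; rewrite distrC; exact: H.
  have E1 a : nsq ((2^-1 * a)%:C + z x) = (2^-1 * a + complex.Re (z x)) * (2^-1 * a + complex.Re (z x)) + complex.Im (z x) ^+ 2.
    by rewrite /nsq cReD cImD /= add0r -expr2.
  rewrite E1; under eq_fun do rewrite E1.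
  have c2 : (fun r => 2^-1 * flap (h r) f (gridpt d N L x) + complex.Re (z x)) @ \oo -->
      2^-1 * lap d f (gridpt d N L x) + complex.Re (z x).
    by apply: cvgD; [exact: cvgMl_tmp|exact: cvg_cst].
  by apply: cvgD; [exact: (cvgM c2 c2)|exact: cvg_cst].
apply: (ler_cvg_to cerr cD); near=> r.
pose F (x : gidx d (M r)) : R[i] := (f (gridpt d (M r) L x))%:C.
have := @kinetic_error_le R d N r L d0 N0 eN L0 s F ds.
rewrite -/(M r) -/(h r) -/D => H.
have EF : (L / (M r)%:R) ^+ d * \sum_(x : gidx d (M r)) iter s.+1 (flap (h r)) f (gridpt d (M r) L x) ^+ 2 = L ^+ d * weighted_energy L s.+1 F.
  exact: (grid_energy s.+1 (M0 r) (eM r) pf).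
rewrite /E EF /err.
have -> : L ^+ d * weighted_energy L s.+1 F * (central_error d N r L s.+1 + D) =
    (L / N%:R) ^+ d * (N%:R ^+ d * weighted_energy L s.+1 F * (central_error d N r L s.+1 + D)).
  have NR : (N%:R ^+ d : R) != 0 by rewrite expf_neq0// pnatr_eq0 -lt0n.
  by rewrite !mulrA expr_div_n divfK.
rewrite ler_wpM2l//; apply: le_trans H; rewrite le_eqVlt; apply/orP; left; apply/eqP.
apply: eq_bigr => x _; congr (nsq (_ + _)).
  by rewrite rmorphM (dlap_grid _ pf) gridpt_refine.
by apply: eq_bigr => x' _; rewrite /F gridpt_refine.
Unshelve. all: by end_near.
Qed.

Lemma sampling_grid_bound n f : (d + 7 <= 4 * n)%N -> torus_periodic d L f -> Ck d (2 * n) f ->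
  torus_int d L (fun x => f x ^+ 2) <=
    2 * ((L / N%:R) ^+ d * \sum_(x : gidx d N) f (gridpt d N L x) ^+ 2)
    + 3 * (L2norm d L (lapn d n f) ^+ 2 * ((L * d%:R / N%:R) ^+ (4 * n) / 64)).
Proof.
move=> dn pf hf.
pose E k r := (L / (M r)%:R) ^+ d * \sum_(x : gidx d (M r)) iter k (flap (h r)) f (gridpt d (M r) L x) ^+ 2.
pose D := (L * d%:R / N%:R) ^+ (4 * n) / 64; pose G := (L / N%:R) ^+ d * \sum_(x : gidx d N) f (gridpt d N L x) ^+ 2.
rewrite L2norm_sqr -/D -/G.
have c0 : E 0%N @ \oo --> torus_int d L (fun x => f x ^+ 2).
  by apply: (@energy_cvg 0%N f pf); apply: Ck_le hf.
have cn : E n @ \oo --> torus_int d L (fun x => lapn d n f x ^+ 2) by exact: energy_cvg.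
have cr : (fun r => 2 * G + 3 * (E n r * D)) @ \oo -->
    2 * G + 3 * (torus_int d L (fun x => lapn d n f x ^+ 2) * D).
  apply: cvgD; first exact: cvg_cst.
  by apply: cvgMl_tmp; apply: cvgMr_tmp.
apply: (ler_cvg_to c0 cr); near=> r.
pose F (x : gidx d (M r)) : R[i] := (f (gridpt d (M r) L x))%:C.
have EF k : E k r = L ^+ d * weighted_energy L k F.
  exact: (grid_energy k (M0 r) (eM r) pf).
rewrite !EF; have := @sampling_lower_bound R d N r L d0 N0 eN L0 n F dn.
rewrite -/(M r) -/D => H.
have Ld : 0 <= L ^+ d by rewrite exprn_ge0// ltW.
apply: le_trans (ler_wpM2l Ld H) _; rewrite le_eqVlt; apply/orP; left; apply/eqP.
have -> : \sum_x nsq (F (refine (ltn0Sn r.*2) x)) = \sum_(x : gidx d N) f (gridpt d N L x) ^+ 2.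
  by apply: eq_bigr => x _; rewrite nsq_real gridpt_refine.
rewrite /G expr_div_n; ring.
Unshelve. all: by end_near.
Qed.
End Refinement.

(** * Comparison with a unitary flow *)

Section UnitaryComparison.
Set Implicit Arguments.
Unset Strict Implicit.
Context {R : realType}.
Local Notation C := R[i].
Local Notation Re := (@complex.Re R).
Local Notation Im := (@complex.Im R).
Local Notation cj := (@conjc R).
Local Notation "x %:C" := (@real_complex_def _ (Phant _) x) : ring_scope.

Lemma is_derive_fin_sum (I : finType) (f : I -> R -> R) (l : I -> R) (t : R) :
  (forall i, is_derive t 1 (f i) (l i)) -> is_derive t 1 (fun s => \sum_i f i s) (\sum_i l i).
Proof.
move=> H; elim: (index_enum I) => [|i r IH].
  rewrite big_nil; have -> : (fun s => \sum_(i <- [::]) f i s) = (fun=> 0).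
    by apply/funext => s; rewrite big_nil.
  exact: is_derive_cst.
rewrite big_cons; have -> : (fun s => \sum_(j <- i :: r) f j s) = (fun s => f i s + \sum_(j <- r) f j s).
  by apply/funext => s; rewrite big_cons.
exact: is_deriveD.
Qed.

Lemma is_derive_mul (f g : R -> R) (t a b : R) : is_derive t 1 f a -> is_derive t 1 g b ->
  is_derive t 1 (fun s => f s * g s) (a * g t + f t * b).
Proof.
move=> df dg; have -> : a * g t + f t * b = f t *: b + g t *: a by rewrite addrC [a * _]mulrC.
exact: is_deriveM.
Qed.

Section InnerProduct.
Variable I : finType.
Implicit Types v w : I -> C.

(** The real part of the Hermitian product, that is the Euclidean product of the underlying real
    space. *)
Definition rdot v w : R := \sum_i (Re (v i) * Re (w i) + Im (v i) * Im (w i)).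

Lemma rdotC v w : rdot v w = rdot w v.
Proof. by apply: eq_bigr => i _; ring. Qed.

Lemma rdotvv v : rdot v v = \sum_i nsq (v i).
Proof. by apply: eq_bigr => i _; rewrite /nsq !expr2. Qed.

Lemma rdotDl v v' w : rdot (fun i => v i + v' i) w = rdot v w + rdot v' w.
Proof. by rewrite /rdot -big_split; apply: eq_bigr => i _ /=; rewrite cReD cImD; ring. Qed.

Lemma rdotZl (a : R) v w : rdot (fun i => a%:C * v i) w = a * rdot v w.
Proof.
by rewrite /rdot mulr_sumr; apply: eq_bigr => i _; cbv beta; rewrite cReM cImM /=; ring.
Qed.

Lemma rdotDr v w w' : rdot v (fun i => w i + w' i) = rdot v w + rdot v w'.
Proof. by rewrite rdotC rdotDl !(rdotC v). Qed.

Lemma rdotZr (a : R) v w : rdot v (fun i => a%:C * w i) = a * rdot v w.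
Proof. by rewrite rdotC rdotZl rdotC. Qed.

Lemma rdot_cauchy_schwarz v w : rdot v w ^+ 2 <= rdot v v * rdot w w.
Proof.
have H := @cauchy_schwarz_sum R (I + I)%type
  (fun s => match s with inl i => Re (v i) | inr i => Im (v i) end)
  (fun s => match s with inl i => Re (w i) | inr i => Im (w i) end).
move: H; rewrite !big_sumType /= -!big_split /= /rdot.
by under [X in _ <= X * _ -> _]eq_bigr do rewrite !expr2;
  under [X in _ <= _ * X -> _]eq_bigr do rewrite !expr2.
Qed.

Lemma rdotE v w : rdot v w = Re (\sum_i cj (v i) * w i).
Proof.
rewrite cRe_sum; apply: eq_bigr => i _.
by case: (v i) => a b; case: (w i) => c e /=; ring.
Qed.

Lemma rdot_antihermitian (A : I -> I -> C) v w : (forall i j, cj (A i j) = - A j i) ->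
  rdot v (fun i => \sum_j A i j * w j) = - rdot (fun i => \sum_j A i j * v j) w.
Proof.
move=> HA; rewrite !rdotE -cReN; congr Re.
under eq_bigr do rewrite mulr_sumr.
rewrite exchange_big /= -sumrN; apply: eq_bigr => i _.
rewrite rmorph_sum mulr_suml -sumrN; apply: eq_bigr => j _.
by rewrite [in RHS]rmorphM /= HA; ring.
Qed.
End InnerProduct.

Lemma derive_rdot (I : finType) (v w v' w' : R -> I -> C) (t : R) :
  (forall i, is_derive t 1 (fun s => Re (v s i)) (Re (v' t i))) ->
  (forall i, is_derive t 1 (fun s => Im (v s i)) (Im (v' t i))) ->
  (forall i, is_derive t 1 (fun s => Re (w s i)) (Re (w' t i))) ->
  (forall i, is_derive t 1 (fun s => Im (w s i)) (Im (w' t i))) ->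
  is_derive t 1 (fun s => rdot (v s) (w s)) (rdot (v' t) (w t) + rdot (v t) (w' t)).
Proof.
move=> h1 h2 h3 h4.
have H i : is_derive t 1 (fun s => Re (v s i) * Re (w s i) + Im (v s i) * Im (w s i))
   ((Re (v' t i) * Re (w t i) + Re (v t i) * Re (w' t i)) +
    (Im (v' t i) * Im (w t i) + Im (v t i) * Im (w' t i))).
  by apply: is_deriveD; apply: is_derive_mul.
have := is_derive_fin_sum H.
have -> : \sum_i ((Re (v' t i) * Re (w t i) + Re (v t i) * Re (w' t i)) +
    (Im (v' t i) * Im (w t i) + Im (v t i) * Im (w' t i))) = rdot (v' t) (w t) + rdot (v t) (w' t).
  by rewrite /rdot -big_split; apply: eq_bigr => i _ /=; ring.
by [].
Qed.

Lemma constant_of_derive0 (f : R -> R) (T : R) : {within `[0, T], continuous f} ->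
  (forall t, 0 < t < T -> is_derive t 1 f 0) -> forall t, 0 <= t <= T -> f t = f 0.
Proof.
move=> cf df t /andP[t0 tT].
have cft : {within `[0, t], continuous f}.
  by apply: continuous_subspaceW cf; apply: subset_itvl; rewrite bnd_simp.
have cNft : {within `[0, t], continuous (fun s => - f s)}.
  by move=> x; apply: cvgN; exact: cft.
have W s : 0 < s < t -> 0 < s < T by move=> /andP[-> /lt_le_trans]; apply.
have A := @MVT_upper_bound R f (fun=> 0) 0 t 0 t0 cft (fun s h => df s (W s h)) (fun s h => lexx 0).
have dN s : 0 < s < t -> is_derive s 1 (fun s => - f s) 0.
  by move=> /W /df h; rewrite -oppr0; apply: is_deriveN.
have B := @MVT_upper_bound R (fun s => - f s) (fun=> 0) 0 t 0 t0 cNft dN (fun s h => lexx 0).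
by apply/eqP; rewrite eq_le; lra.
Qed.

Lemma continuous_within_fin_sum (I : finType) (D : set R) (f : I -> R -> R) :
  (forall i, {within D, continuous (f i)}) -> {within D, continuous (fun s => \sum_i f i s)}.
Proof.
move=> H x; apply: cvg_big => [|i _]; [exact: add_continuous|exact: H].
Qed.

Lemma continuous_within_rdot (I : finType) (D : set R) (v w : R -> I -> C) :
  (forall i, {within D, continuous (fun s => Re (v s i))}) ->
  (forall i, {within D, continuous (fun s => Im (v s i))}) ->
  (forall i, {within D, continuous (fun s => Re (w s i))}) ->
  (forall i, {within D, continuous (fun s => Im (w s i))}) ->
  {within D, continuous (fun s => rdot (v s) (w s))}.
Proof.
move=> h1 h2 h3 h4; apply: continuous_within_fin_sum => i x.
by apply: cvgD; apply: cvgM; [exact: h1|exact: h3|exact: h2|exact: h4].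
Qed.

Section Comparison.
Variables (I : finType) (T k : R) (A : R -> I -> I -> C).
Variables (u g : R -> I -> R) (phi : R -> I -> C).
Hypotheses (T0 : 0 <= T) (k0 : 0 <= k).
Hypothesis antiA : forall t, 0 < t < T -> forall i j, cj (A t i j) = - A t j i.
Hypothesis cu : forall i, {within `[0, T], continuous (fun t => u t i)}.
Hypothesis du : forall t, 0 < t < T -> forall i, is_derive t 1 (fun s => u s i) (g t i).
Hypothesis cRe : forall i, {within `[0, T], continuous (fun t => Re (phi t i))}.
Hypothesis cIm : forall i, {within `[0, T], continuous (fun t => Im (phi t i))}.
Hypothesis dRe : forall t, 0 < t < T -> forall i,
  is_derive t 1 (fun s => Re (phi s i)) (Re (\sum_j A t i j * phi t j)).
Hypothesis dIm : forall t, 0 < t < T -> forall i,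
  is_derive t 1 (fun s => Im (phi s i)) (Im (\sum_j A t i j * phi t j)).
Hypothesis phi0 : \sum_i nsq (phi 0 i) = 1.
Hypothesis u0 : forall t, 0 <= t <= T -> 0 < \sum_i u t i ^+ 2.
Hypothesis residual : forall t, 0 < t < T ->
  \sum_i nsq ((g t i)%:C - \sum_j A t i j * (u t j)%:C) <= k ^+ 2 * \sum_i u t i ^+ 2.

Let U t i : C := (u t i)%:C.
Let n t : R := Num.sqrt (\sum_i u t i ^+ 2).
Let res t i : C := (g t i)%:C - \sum_j A t i j * U t j.
Let F t : R := rdot (U t) (phi t) / n t.
Let W t : 0 < t < T -> 0 <= t <= T. Proof. by move=> /andP[/ltW -> /ltW ->]. Qed.

Let rdotUU t : rdot (U t) (U t) = \sum_i u t i ^+ 2.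
Proof. by rewrite rdotvv; apply: eq_bigr => i _; rewrite nsq_real. Qed.

Let n0 t : 0 <= t <= T -> 0 < n t. Proof. by move=> /u0; rewrite sqrtr_gt0. Qed.

Let n_sqr t : 0 <= t <= T -> n t ^+ 2 = rdot (U t) (U t).
Proof. by move=> /u0 /ltW h; rewrite rdotUU sqr_sqrtr. Qed.

Let phi_norm t : 0 <= t <= T -> rdot (phi t) (phi t) = 1.
Proof.
move=> tT; rewrite -phi0 -rdotvv.
apply: (@constant_of_derive0 (fun t => rdot (phi t) (phi t)) T) => //.
  exact: continuous_within_rdot.
move=> s sT; have := derive_rdot (v' := fun t i => \sum_j A t i j * phi t j)
  (w' := fun t i => \sum_j A t i j * phi t j) (dRe sT) (dIm sT) (dRe sT) (dIm sT).
by rewrite (rdot_antihermitian _ _ (antiA sT)) subrr.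
Qed.

Let dist_sqr t : 0 <= t <= T ->
  \sum_i nsq ((n t)^-1%:C * U t i - phi t i) = 2 - 2 * F t.
Proof.
move=> tT; have nz := lt0r_neq0 (n0 tT).
have E : \sum_i nsq ((n t)^-1%:C * U t i - phi t i) =
    (n t) ^- 2 * rdot (U t) (U t) - 2 * (n t)^-1 * rdot (U t) (phi t) + rdot (phi t) (phi t).
  rewrite /rdot !mulr_sumr -sumrB -big_split; apply: eq_bigr => i _ /=.
  by rewrite /nsq cReD cImD cReN cImN cReM cImM /= -exprVn; ring.
rewrite E phi_norm// -n_sqr// mulVf ?expf_neq0// /F; ring.
Qed.

(** Writing [u'] as the generator applied to [u] plus the residual, antihermiticity cancels the
    generator in the derivative of [rdot (U t) (phi t)] and in that of [rdot (U t) (U t)]. *)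
Let dF t : 0 < t < T ->
  is_derive t 1 F ((n t)^-1 * (rdot (res t) (phi t) - F t / n t * rdot (res t) (U t))).
Proof.
move=> tT; have nt := n0 (W tT); have nz := lt0r_neq0 nt.
pose U' t i : C := (g t i)%:C.
have U'E : U' t = (fun i => \sum_j A t i j * U t j + res t i).
  by apply/funext => i; rewrite /res addrC subrK.
have dUR i : is_derive t 1 (fun s => Re (U s i)) (Re (U' t i)) by exact: du.
have dUI i : is_derive t 1 (fun s => Im (U s i)) (Im (U' t i)) by exact: is_derive_cst.
have d1 : is_derive t 1 (fun s => rdot (U s) (phi s)) (rdot (res t) (phi t)).
  have := derive_rdot (v' := U') (w' := fun t i => \sum_j A t i j * phi t j) dUR dUI (dRe tT) (dIm tT).
  by rewrite (rdot_antihermitian _ _ (antiA tT)) U'E rdotDl addrAC subrr add0r.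
have d2 : is_derive t 1 (fun s => rdot (U s) (U s)) (2 * rdot (res t) (U t)).
  have := derive_rdot (v' := U') (w' := U') dUR dUI dUR dUI.
  rewrite [rdot (U t) (U' t)]rdotC U'E rdotDl.
  have -> : rdot (fun i => \sum_j A t i j * U t j) (U t) = 0.
    by have := rdot_antihermitian (U t) (U t) (antiA tT); rewrite rdotC; lra.
  by rewrite add0r mulr_natl.
have n_def s : n s = Num.sqrt (rdot (U s) (U s)) by rewrite rdotUU.
have d3 : is_derive t 1 n ((n t)^-1 * rdot (res t) (U t)).
  have -> : n = (fun s => Num.sqrt (rdot (U s) (U s))) by apply/funext.
  have UU0 : 0 < rdot (U t) (U t) by rewrite rdotUU u0// W.
  have := is_derive_sqrt_comp UU0 d2.
  by rewrite invfM mulrACA mulVf// mul1r.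
have d4 : is_derive t 1 (fun s => (n s)^-1) (- (n t) ^- 2 * ((n t)^-1 * rdot (res t) (U t))).
  exact: is_deriveV.
have := is_derive_mul d1 d4.
have -> : rdot (res t) (phi t) * (n t)^-1 + rdot (U t) (phi t) * (- n t ^- 2 * ((n t)^-1 * rdot (res t) (U t))) =
  (n t)^-1 * (rdot (res t) (phi t) - F t / n t * rdot (res t) (U t)).
  by rewrite /F -exprVn; ring.
by [].
Qed.

Let dF_le t : 0 < t < T ->
  `|(n t)^-1 * (rdot (res t) (phi t) - F t / n t * rdot (res t) (U t))| <= k * Num.sqrt (2 - 2 * F t).
Proof.
move=> tT; have tT' := W tT; have nt := n0 tT'; have nz := lt0r_neq0 nt.
(* [v] is the component of [phi] orthogonal to [U]. Its squared norm is [1 - F^2], which falls short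
   of [2 - 2 F] by [(1 - F)^2]. *)
pose v i : C := phi t i + (- (F t / n t))%:C * U t i.
have vE : rdot (res t) (phi t) - F t / n t * rdot (res t) (U t) = rdot (res t) v.
  by rewrite /v rdotDr rdotZr mulNr.
have vv : rdot v v = 1 - F t ^+ 2.
  have FE : rdot (U t) (phi t) = F t * n t by rewrite /F divfK.
  rewrite /v rdotDl rdotZl !rdotDr !rdotZr.
  rewrite phi_norm// [rdot (phi t) (U t)]rdotC FE -n_sqr//.
  by field.
have v0 : 0 <= rdot v v by rewrite rdotvv; apply: sumr_ge0 => i _; exact: nsq_ge0.
have vv_le : rdot v v <= 2 - 2 * F t by rewrite vv; have := sqr_ge0 (1 - F t); nra.
have rr : rdot (res t) (res t) <= (k * n t) ^+ 2.
  by rewrite rdotvv exprMn n_sqr// rdotUU; exact: residual.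
rewrite vE normrM normfV (gtr0_norm nt) mulrC ler_pdivrMr//.
rewrite -(sqrtr_sqr (rdot _ _)).
apply: (@le_trans _ _ (Num.sqrt ((k * n t) ^+ 2 * (2 - 2 * F t)))).
  apply: ler_wsqrtr; apply: le_trans (rdot_cauchy_schwarz _ _) _.
  by apply: ler_pM => //; rewrite rdotvv; apply: sumr_ge0 => i _; exact: nsq_ge0.
rewrite sqrtrM ?sqr_ge0// sqrtr_sqr ger0_norm; last by rewrite mulr_ge0// ltW.
by rewrite mulrAC.
Qed.

Let cF : {within `[0, T], continuous F}.
Proof.
have cUR i : {within `[0, T], continuous (fun s => Re (U s i))} by exact: cu.
have cUI i : {within `[0, T], continuous (fun s => Im (U s i))} by move=> x; exact: cvg_cst.
have c1 : {within `[0, T], continuous (fun s => rdot (U s) (phi s))} by exact: continuous_within_rdot.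
have c2 : {within `[0, T], continuous (fun s => rdot (U s) (U s))} by exact: continuous_within_rdot.
apply/subspace_continuousP => t tT.
move/subspace_continuousP : c1 => /(_ t tT) c1; move/subspace_continuousP : c2 => /(_ t tT) c2.
apply: cvgM => //; apply: cvgV; first by rewrite gt_eqF// n0//; move: tT; rewrite /= in_itv.
have -> : n = Num.sqrt \o (fun s => rdot (U s) (U s)) by apply/funext => s /=; rewrite rdotUU.
by apply: cvg_comp; [exact: c2|exact: sqrt_continuous].
Qed.

(* [2 - 2 F] is the squared distance of the normalised [u] to [phi], and the
   component of the residual along [u] does not contribute to [F']. *)
Lemma unitary_comparison :
  Num.sqrt (\sum_i nsq ((n T)^-1%:C * U T i - phi T i)) <=
  Num.sqrt (\sum_i nsq ((n 0)^-1%:C * U 0 i - phi 0 i)) + k * T.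
Proof.
rewrite !dist_sqr ?lexx ?T0//.
apply: (@sqrt_gronwall R (fun t => 2 - 2 * F t)
  (fun t => - (2 * ((n t)^-1 * (rdot (res t) (phi t) - F t / n t * rdot (res t) (U t)))))) => //.
- move=> x; apply: cvgB; first exact: cvg_cst.
  by apply: cvgMl_tmp; exact: cF.
- by move=> t tT; rewrite -dist_sqr//; apply: sumr_ge0 => i _; exact: nsq_ge0.
- move=> t tT; rewrite -[X in is_derive _ _ _ X]sub0r; apply: is_deriveB.
  by apply: is_deriveZ; exact: dF.
- move=> t tT; have := dF_le tT; rewrite ler_norml => /andP[+ _].
  by rewrite -[2 * k * _]mulrA; move: (_^-1 * _) (k * _) => a b; lra.
Qed.
End Comparison.
End UnitaryComparison.

(** * The continuity equation and the residual *)

Section ContinuityEquation.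
Set Implicit Arguments.
Unset Strict Implicit.
Context {R : realType}.
Variable d : nat.
Implicit Types (a V : 'rV[R]_d -> R) (x : 'rV[R]_d).

(** The commutator of [K] and [V] applied to [a], with [- lap / 2] in place of [K]. In this
    unexpanded form its continuity in time follows from that of [V], [lap a] and [lap (V a)]. *)
Definition half_commutator V a x : R :=
  2^-1 * (V x * lap d a x - lap d (fun y => V y * a y) x).

Lemma half_commutatorE V a x : Ck d 2 V -> Ck d 2 a ->
  half_commutator V a x =
  - (\sum_i partial d i V x * partial d i a x) - 2^-1 * a x * lap d V x.
Proof.
move=> hV ha; rewrite /half_commutator (lapM hV ha).
by move: (V x) (a x) (lap d a x) (lap d V x) (\sum_i _) => p q r s t; field.
Qed.

(** The continuity equation becomes [p' = 2 a g] with no division by [a], the shape in which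
    [is_derive_sqrt_nonneg] also handles zeros of [p]. *)
Lemma div_p_gradV_sqr V a x : Ck d 2 V -> Ck d 2 a ->
  - div_p_gradV d (fun y => a y ^+ 2) V x = 2 * a x * half_commutator V a x.
Proof.
move=> hV ha; rewrite half_commutatorE// /div_p_gradV /lap.
rewrite -sumrN -sumrN !mulr_sumr -sumrB mulr_sumr; apply: eq_bigr => i _.
have ha1 := Ck_pred ha; have hV1 := Ck_partial i hV.
have -> : (fun y => a y ^+ 2 * partial d i V y) = (fun y => (a y * a y) * partial d i V y).
  by apply/funext => y; rewrite expr2.
rewrite (partialM i (CkM ha1 ha1) hV1) (partialM i ha1 ha1); by field.
Qed.

(** A zero of a nonnegative function is a minimum along every coordinate line. *)
Lemma partial_at_zero a x i : Ck d 1 a -> (forall y, 0 <= a y) -> a x = 0 -> partial d i a x = 0.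
Proof.
move=> ha a0 ax.
pose phi (y : R) := a (x + y *: evec d i).
have dphi (y : R) : is_derive y 1 phi (partial d i a (x + y *: evec d i)).
  by apply: is_derive_line; exact: Ck_is_derive ha.
have H : is_derive (0 : R) 1 phi 0.
  apply: (@derive1_at_min R phi (-1) 1 0).
  - by lra.
  - by move=> y _; apply: (@ex_derive _ _ _ _ _ _ _ (dphi y)).
  - by rewrite in_itv /=; lra.
  - by move=> y _; rewrite {1}/phi scale0r addr0 ax; exact: a0.
have := dphi 0; rewrite scale0r addr0 => H'.
by rewrite -(@derive_val _ _ _ _ _ _ _ H') (@derive_val _ _ _ _ _ _ _ H).
Qed.

Lemma half_commutator_at_zero V a x : Ck d 2 V -> Ck d 2 a -> (forall y, 0 <= a y) -> a x = 0 ->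
  half_commutator V a x = 0.
Proof.
move=> hV ha a0 ax; rewrite half_commutatorE// ax mulr0 mul0r subr0 big1 ?oppr0// => i _.
by rewrite (partial_at_zero i (Ck_pred ha) a0 ax) mulr0.
Qed.
End ContinuityEquation.

Section Residual.
Set Implicit Arguments.
Unset Strict Implicit.
Context {R : realType}.
Local Notation C := R[i].
Local Notation "x %:C" := (@real_complex_def _ (Phant _) x) : ring_scope.
Variables (d N : nat) (L : R).
Implicit Types (a V : 'rV[R]_d -> R).

(** The matrix of [[K, D_V]], equal to [- i] times [Hc], so that the Schroedinger equation reads
    [phi' = generator phi]. *)
Definition generator V (k k' : gidx d N) : C :=
  Kop d N L k k' * (V (gridpt d N L k') - V (gridpt d N L k))%:C.

Lemma generator_antihermitian V k k' : conjc (generator V k k') = - generator V k' k.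
Proof.
rewrite /generator mulrC conjcMr Kop_hermitian mulrC -mulrN -rmorphN; congr (_ * real_complex_def _ _).
by rewrite opprB.
Qed.

Lemma opapp_Hc V (v : cvec d N) k :
  opapp d N (Hc d N L V) v k = ('i)%C * \sum_k' generator V k k' * v k'.
Proof.
rewrite /opapp mulr_sumr; apply: eq_bigr => k' _; rewrite mulrA; congr (_ * _).
rewrite /Hc /opmul /generator; congr (_ * _).
have -> : \sum_m Kop d N L k m * DVop d N L V m k' = Kop d N L k k' * (V (gridpt d N L k'))%:C.
  rewrite (bigD1 k')//= big1 ?addr0 /DVop ?eqxx ?mul1r// => m /negbTE ->.
  by rewrite mul0r mulr0.
have -> : \sum_m DVop d N L V k m * Kop d N L m k' = (V (gridpt d N L k))%:C * Kop d N L k k'.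
  rewrite (bigD1 k)//= big1 ?addr0 /DVop ?eqxx ?mul1r// => m /negbTE mk.
  by rewrite eq_sym mk mul0r mul0r.
by rewrite rmorphB mulrBr [(V (gridpt d N L k))%:C * _]mulrC.
Qed.

Lemma gridpt_cube (k : gidx d N) : 0 < L -> cube d L (gridpt d N L k).
Proof.
move=> L0 i; have N0 : (0 < N)%N := leq_ltn_trans (leq0n _) (ltn_ord (k i)).
have NR : 0 < (N%:R : R) by rewrite ltr0n.
rewrite mxE mulr_ge0 ?divr_ge0 ?(ltW L0)//= mulrAC ler_pdivrMr// ler_pM2l// ler_nat.
exact: ltnW.
Qed.

Lemma residual_arith (v Y X D Sa Sb : R) : 0 <= v -> 0 <= Y -> 0 <= X -> 0 <= D ->
  Sa <= Y ^+ 2 * D -> Sb <= X ^+ 2 * D ->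
  2 * v ^+ 2 * Sa + 2 * Sb <= ((v + 1) * Y + X) ^+ 2 * (2 * D).
Proof.
move=> v0 Y0 X0 D0 ha hb.
apply: (@le_trans _ _ (2 * v ^+ 2 * (Y ^+ 2 * D) + 2 * (X ^+ 2 * D))).
  by rewrite lerD// ler_wpM2l// mulr_ge0// sqr_ge0.
have -> : 2 * v ^+ 2 * (Y ^+ 2 * D) + 2 * (X ^+ 2 * D) = (v ^+ 2 * Y ^+ 2 + X ^+ 2) * (2 * D) by ring.
rewrite ler_wpM2r ?mulr_ge0// -exprMn sqrrD.
have H1 : (v * Y) ^+ 2 <= ((v + 1) * Y) ^+ 2.
  by rewrite ler_sqr ?nnegrE ?mulr_ge0//; [rewrite ler_wpM2r// lerDl|lra].
have H2 : 0 <= (v + 1) * Y * X *+ 2 by rewrite mulrn_wge0// !mulr_ge0//; lra.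
lra.
Qed.

(** With [z f] the kinetic error of [f], the residual is exactly [V z a - z b] for [b = V a]. The
    inequality [|x + y|^2 <= 2 |x|^2 + 2 |y|^2] doubles [1/16] to [1/8]. *)
Lemma residual_le s a V : (0 < d)%N -> (0 < N)%N -> ~~ odd N -> 0 < L -> (d + 7 <= 4 * s)%N ->
  torus_periodic d L a -> torus_periodic d L V -> Ck d (2 * s.+1) a -> Ck d (2 * s.+1) V ->
  (L / N%:R) ^+ d * \sum_k nsq ((half_commutator V a (gridpt d N L k))%:C
      - \sum_k' generator V k k' * (a (gridpt d N L k'))%:C) <=
  ((Linfnorm d L V + 1) * L2norm d L (lapn d s.+1 a) + L2norm d L (lapn d s.+1 (fun x => V x * a x))) ^+ 2
  * ((L * d%:R / N%:R) ^+ (4 * s) / 8).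
Proof.
move=> d0 N0 eN L0 ds pa pV ha hV.
pose b x := V x * a x; have hb : Ck d (2 * s.+1) b by exact: CkM.
have pb : torus_periodic d L b by move=> i x; rewrite /b pa pV.
pose w := (L / N%:R) ^+ d; pose D := (L * d%:R / N%:R) ^+ (4 * s) / 16.
pose z (f : 'rV[R]_d -> R) (k : gidx d N) : C := (2^-1 * lap d f (gridpt d N L k))%:C
  + \sum_k' Kop d N L k k' * (f (gridpt d N L k'))%:C.
have Ka : w * \sum_k nsq (z a k) <= L2norm d L (lapn d s.+1 a) ^+ 2 * D by exact: kinetic_grid_error.
have Kb : w * \sum_k nsq (z b k) <= L2norm d L (lapn d s.+1 b) ^+ 2 * D by exact: kinetic_grid_error.
have w0 : 0 <= w by rewrite exprn_ge0// divr_ge0// ltW.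
have D0 : 0 <= D.
  by rewrite divr_ge0// exprn_ge0// divr_ge0// mulr_ge0// ltW.
pose v := Linfnorm d L V.
have Vv k : V (gridpt d N L k) ^+ 2 <= v ^+ 2.
  have := Linfnorm_ge (Ck_continuous hV) (gridpt_cube k L0).
  by rewrite -[V _ ^+ 2]real_normK ?num_real// => H; rewrite ler_sqr ?nnegrE// (le_trans _ H).
have v0 : 0 <= v.
  have c0 : cube d L 0 by move=> i; rewrite mxE lexx ltW.
  by apply: le_trans (Linfnorm_ge (Ck_continuous hV) c0).
have resE k : (half_commutator V a (gridpt d N L k))%:C
      - \sum_k' generator V k k' * (a (gridpt d N L k'))%:C =
    (V (gridpt d N L k))%:C * z a k + - z b k.
  have -> : \sum_k' generator V k k' * (a (gridpt d N L k'))%:C =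
     \sum_k' Kop d N L k k' * (b (gridpt d N L k'))%:C -
     (V (gridpt d N L k))%:C * \sum_k' Kop d N L k k' * (a (gridpt d N L k'))%:C.
    rewrite mulr_sumr -sumrB; apply: eq_bigr => k' _.
    by rewrite /generator /b rmorphB rmorphM; ring.
  have -> : (half_commutator V a (gridpt d N L k))%:C =
      (V (gridpt d N L k))%:C * (2^-1 * lap d a (gridpt d N L k))%:C - (2^-1 * lap d b (gridpt d N L k))%:C.
    rewrite -rmorphM -rmorphB; congr (real_complex_def _ _).
    by rewrite /half_commutator -/b mulrBr mulrCA.
  by rewrite /z mulrDr !opprD opprK [- _ + _ * \sum_k' _]addrC addrACA.
have nsq_res k : nsq ((half_commutator V a (gridpt d N L k))%:C
      - \sum_k' generator V k k' * (a (gridpt d N L k'))%:C) <=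
    2 * v ^+ 2 * nsq (z a k) + 2 * nsq (z b k).
  rewrite resE; apply: le_trans (nsqD_le _ _) _.
  rewrite nsqM nsq_real [nsq (- _)]/nsq cReN cImN !sqrrN lerD2r mulrA.
  by rewrite ler_wpM2r ?nsq_ge0// ler_wpM2l.
apply: (@le_trans _ _ (2 * v ^+ 2 * (w * \sum_k nsq (z a k)) + 2 * (w * \sum_k nsq (z b k)))).
  rewrite [2 * v ^+ 2 * _]mulrCA [2 * (w * _)]mulrCA -mulrDr ler_wpM2l// !mulr_sumr -big_split /=.
  by apply: ler_sum => k _; exact: nsq_res.
have -> : (L * d%:R / N%:R) ^+ (4 * s) / 8 = 2 * D.
  by rewrite /D; move: (_ ^+ (4 * s)) => q; field.
exact: (residual_arith v0 (sqrtr_ge0 _) (sqrtr_ge0 _) D0 Ka Kb).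
Qed.

(** The comparison measures the residual relative to the norm of the sampled amplitude, so that norm
    must not degenerate. [sampling_grid_bound] gives [1 <= 2 G + 3/64] for the sampled mass [G]. *)
Lemma amplitude_mass_ge s a : (0 < d)%N -> (0 < N)%N -> ~~ odd N -> 0 < L -> (d + 7 <= 4 * s)%N ->
  torus_periodic d L a -> Ck d (2 * s.+1) a -> torus_int d L (fun x => a x ^+ 2) = 1 ->
  3 * L2norm d L (lapn d s.+1 a) * (L * d%:R / N%:R) ^+ (2 * s) <= 1 ->
  (L * d%:R / N%:R) ^+ (2 * s) <= 1 ->
  4^-1 <= (L / N%:R) ^+ d * \sum_(k : gidx d N) a (gridpt d N L k) ^+ 2.
Proof.
move=> d0 N0 eN L0 ds pa ha a1; set q := L * d%:R / N%:R; set Y := L2norm _ _ _ => Yq q1.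
have q0 : 0 <= q by rewrite divr_ge0// mulr_ge0// ltW.
have s0 : (0 < s)%N by lia.
have q_le1 : q <= 1 by rewrite leNgt -(@expr_gt1 _ (2 * s) q) ?muln_gt0 ?s0// -leNgt.
have ds1 : (d + 7 <= 4 * s.+1)%N by lia.
have := sampling_grid_bound d0 N0 eN L0 ds1 pa ha; rewrite a1 -/q -/Y.
set G := _ ^+ d * _ => H.
have Y0 : 0 <= Y by exact: sqrtr_ge0.
have e0 : 0 <= q ^+ (2 * s) by rewrite exprn_ge0.
(* Here [q <= 1] trades the exponent [4 (s + 1)] for [4 s]. *)
have Hq : Y ^+ 2 * q ^+ (4 * s.+1) <= (Y * q ^+ (2 * s)) ^+ 2.
  rewrite [leRHS]exprMn ler_wpM2l ?sqr_ge0// -exprM.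
  by apply: ler_wiXn2l => //; lia.
have Hy : (Y * q ^+ (2 * s)) ^+ 2 <= 1.
  by rewrite -(expr1n _ 2) ler_sqr ?nnegrE ?mulr_ge0//; have := mulr_ge0 Y0 e0; lra.
move: H; rewrite mulrA; lra.
Qed.
End Residual.

(** * Finiteness of the constant and conclusion *)

Section Assembly.
Set Implicit Arguments.
Unset Strict Implicit.
Context {R : realType}.

(** The supremum is a priori an extended real. The value [+oo] would make the left-hand side
    infinite, against the bound by [T], and the value at [t = 0] excludes [-oo]. *)
Lemma ereal_sup_fin (B : R -> R) (T n eps : R) : 0 < T -> 0 < eps ->
  (n%:E + T%:E * (3%:E * ereal_sup [set (B t)%:E | t in `[0%R, T]] + 1%:E) * eps%:E <= T%:E)%E ->
  exists sigma : R, ereal_sup [set (B t)%:E | t in `[0%R, T]] = sigma%:E /\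
    forall t, 0 <= t <= T -> B t <= sigma.
Proof.
move=> Tp e0; set S := ereal_sup _.
have SB t : 0 <= t <= T -> ((B t)%:E <= S)%E.
  by move=> tT; apply: ereal_sup_ubound; exists t => //=; rewrite in_itv.
case: S SB => [sigma|SB|SB].
- by move=> SB _; exists sigma; split => // t /SB; rewrite lee_fin.
- rewrite gt0_muley ?lte_fin// addye// gt0_muley ?lte_fin// gt0_mulye ?lte_fin// addey//.
- by have := SB 0; rewrite lexx (ltW Tp) => /(_ isT).
Qed.

Lemma continuous_within_interior (f : R -> R) (T t : R) : 0 < t < T ->
  {within `[0, T], continuous f} -> {for t, continuous f}.
Proof.
move=> tT; have T0 : 0 < T by move/andP: tT => [/lt_trans]; apply.
by move=> /(continuous_within_itvP f T0) [H _ _]; apply: H; rewrite in_itv.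
Qed.

Lemma vnorm_psivec d N (L : R) (p : 'rV[R]_d -> R) (v : cvec d N) :
  vnorm d N (fun k => psivec d N L p k - v k) =
  Num.sqrt (\sum_k nsq ((Num.sqrt (\sum_k Num.sqrt (p (gridpt d N L k)) ^+ 2))^-1%:C%C
     * (Num.sqrt (p (gridpt d N L k)))%:C%C - v k)).
Proof.
rewrite /vnorm; congr Num.sqrt; apply: eq_bigr => k _; rewrite /psivec /nsq.
have -> : vnorm d N (gridvec d N L p) = Num.sqrt (\sum_k Num.sqrt (p (gridpt d N L k)) ^+ 2).
  by rewrite /vnorm; congr Num.sqrt; apply: eq_bigr => j _; rewrite /gridvec /= expr0n addr0.
by [].
Qed.
End Assembly.

Theorem theorem1 (R : realType) (d N s : nat) (L T : R)
  (p V : R -> 'rV[R]_d -> R) (phi0 : cvec d N) (phi : R -> cvec d N) :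
  (1 <= d)%N -> 0 < L -> 0 < T ->
  (2 <= N)%N -> (exists k : nat, N = (2 ^ k)%N) ->
  (* p_t, V_t are functions on the torus (L-torus_periodic on R^d) *)
  (forall t : R, 0 <= t <= T -> torus_periodic d L (p t) /\ torus_periodic d L (V t)) ->
  (* p_t is a probability density on T^d *)
  (forall t : R, 0 <= t <= T -> forall x : 'rV[R]_d, 0 <= p t x) ->
  (forall t : R, 0 <= t <= T -> torus_int d L (p t) = 1) ->
  (* continuity equation on T^d x [0,T] *)
  (forall (t : R) (x : 'rV[R]_d), 0 <= t <= T ->
     has_deriv_on T (fun u => p u x) t (- div_p_gradV d (p t) (V t) x)) ->
  (* regularity *)
  (d + 7 <= 4 * s)%N ->
  (forall t : R, 0 <= t <= T ->
     Ck d (2 * (s + 1)) (fun x => Num.sqrt (p t x)) /\ Ck d (2 * (s + 1)) (V t)) ->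
  (forall x : 'rV[R]_d, {within `[0, T], continuous (fun t : R => V t x)}) ->
  (forall x : 'rV[R]_d, {within `[0, T], continuous
                (fun t : R => lap d (fun y => Num.sqrt (p t y)) x)}) ->
  (forall x : 'rV[R]_d, {within `[0, T], continuous
                (fun t : R => lap d (fun y => V t y * Num.sqrt (p t y)) x)}) ->
  (* presupposition: |psi_t> (the normalized grid vector) exists *)
  (forall t : R, 0 <= t <= T -> gridvec d N L (p t) <> (fun _ => 0)) ->
  (* |phi_t> : unit initial vector, solution of i d/dt phi = H^c_t phi on [0,T] *)
  vnorm d N phi0 = 1 -> phi 0 = phi0 ->
  (forall t : R, 0 <= t <= T -> forall k, exists z,
     has_cderiv_on T (fun u => phi u k) t z /\
     ('i)%C * z = opapp d N (Hc d N L (V t)) (phi t) k) ->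
  let cs : \bar R :=
    (3%:E * ereal_sup
       [set ((Linfnorm d L (V t) + 1)
               * L2norm d L (lapn d (s + 1) (fun y => Num.sqrt (p t y)))
             + L2norm d L (lapn d (s + 1) (fun y => V t y * Num.sqrt (p t y))))%:E
       | t in `[0%R, T]] + 1%:E)%E in
  let delta : \bar R :=
    ((vnorm d N (fun k => psivec d N L (p 0) k - phi0 k))%:E
     + T%:E * cs * ((L * d%:R / N%:R) ^+ (2 * s))%:E)%E in
  (delta <= T%:E)%E ->
  ((vnorm d N (fun k => psivec d N L (p T) k - phi T k))%:E <= delta)%E.
Proof.
move=> d0 L0 T0 N2 [kN Nk] per p0 p1 ceq ds reg cV cla clVa _ phi01 phi0E dphi cs delta.
have N0 : (0 < N)%N by exact: leq_trans N2.
have eN : ~~ odd N by rewrite Nk oddX orbF; case: kN Nk N2 => [->|].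
have NR : 0 < (N%:R : R) by rewrite ltr0n.
rewrite addn1 in reg; rewrite /delta /cs addn1.
pose a t x : R := Num.sqrt (p t x).
pose B t : R := (Linfnorm d L (V t) + 1) * L2norm d L (lapn d s.+1 (a t))
   + L2norm d L (lapn d s.+1 (fun y => V t y * a t y)).
set q := L * d%:R / N%:R; set eps := q ^+ (2 * s); set n := vnorm d N _.
have q0 : 0 < q by rewrite divr_gt0// mulr_gt0// ltr0n.
have eps0 : 0 < eps by rewrite exprn_gt0.
have n0 : 0 <= n by exact: sqrtr_ge0.
move=> delta_le; have [sigma [SE Bs]] := @ereal_sup_fin R B T n eps T0 eps0 delta_le.
move: delta_le; rewrite -[X in (_ + _ * (_ * ereal_sup X + _) * _ <= _)%E]/([set (B t)%:E | t in `[0%R, T]]) SE.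
rewrite -!(EFinM, EFinD) !lee_fin => delta_le.
have Linf0 t : 0 <= t <= T -> 0 <= Linfnorm d L (V t).
  move=> tT; have [_ hV] := reg t tT.
  have c0 : cube d L 0 by move=> i; rewrite mxE lexx ltW.
  exact: le_trans (Linfnorm_ge (Ck_continuous hV) c0).
have Y0 t : 0 <= L2norm d L (lapn d s.+1 (a t)) by exact: sqrtr_ge0.
have B0 t : 0 <= t <= T -> 0 <= B t.
  by move=> tT; rewrite addr_ge0 ?sqrtr_ge0// mulr_ge0// addr_ge0// Linf0.
have TT : 0 <= T <= T by rewrite lexx ltW.
have sigma0 : 0 <= sigma by apply: le_trans (Bs T TT); exact: B0.
(* The growth rate [cs * eps]. As [T * beta] is part of [delta], the hypothesis [delta <= T] gives
   [beta <= 1]. *)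
pose beta := (3 * sigma + 1) * eps.
have beta0 : 0 <= beta by rewrite mulr_ge0 ?(ltW eps0)//; lra.
have beta1 : beta <= 1.
  rewrite -(ler_pM2l T0) mulr1; apply: le_trans delta_le.
  by rewrite /beta mulrA lerDr.
have pa t : 0 <= t <= T -> torus_periodic d L (a t).
  by move=> tT i x; rewrite /a; have [-> _] := per t tT.
have aE t : 0 <= t <= T -> p t = (fun x => a t x ^+ 2).
  by move=> tT; apply/funext => x; rewrite /a sqr_sqrtr// p0.
have YB t : 0 <= t <= T -> L2norm d L (lapn d s.+1 (a t)) <= B t.
  move=> tT; rewrite /B mulrDl mul1r -addrA addrCA lerDl addr_ge0 ?sqrtr_ge0//.
  by rewrite mulr_ge0// Linf0.
(* The two smallness conditions come from [beta <= 1]: the summand [3 sigma eps] controls the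
   Laplacian norm through [YB], the summand [eps] the mesh. *)
have mass t : 0 <= t <= T -> 4^-1 <= (L / N%:R) ^+ d * \sum_k a t (gridpt d N L k) ^+ 2.
  move=> tT; have [ha _] := reg t tT.
  apply: (amplitude_mass_ge d0 N0 eN L0 ds (pa t tT) ha).
  - by rewrite -(p1 t tT) (aE t tT).
  - apply: le_trans beta1; rewrite ler_wpM2r ?(ltW eps0)//.
    by have := YB t tT; have := Bs t tT; lra.
  - by apply: le_trans beta1; rewrite -[leLHS]mul1r ler_wpM2r ?(ltW eps0)//; lra.
have w0 : 0 < (L / N%:R) ^+ d by rewrite exprn_gt0// divr_gt0.
have W t : 0 < t < T -> 0 <= t <= T by move=> /andP[/ltW -> /ltW ->].
have two_le : (2 <= 2 * s.+1)%N by rewrite leq_pmulr.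
have iT := @unitary_comparison R (gidx d N) T beta (fun t => generator L (V t))
  (fun t k => a t (gridpt d N L k)) (fun t k => half_commutator (V t) (a t) (gridpt d N L k)) phi
  (ltW T0) beta0.
rewrite !vnorm_psivec in delta_le *.
have -> : T * (3 * sigma + 1) * eps = beta * T by rewrite /beta; ring.
rewrite /n vnorm_psivec -phi0E.
apply: iT.
- by move=> t _ i j; exact: generator_antihermitian.
- move=> k x.
  have cp : {within `[0, T], continuous (fun t => p t (gridpt d N L k))}.
    by apply: has_deriv_on_continuous => t tT; eexists; exact: ceq.
  by apply: (@continuous_comp (subspace `[0, T]) R R (fun t => p t (gridpt d N L k)) Num.sqrt); [exact: cp|exact: sqrt_continuous].
- move=> t tT k; set x := gridpt d N L k.
  apply: (@is_derive_sqrt_nonneg R (fun t => p t x) (fun t => half_commutator (V t) (a t) x) T) => //.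
  + by move=> u uT; exact: p0.
  + move=> u uT; have [ha hV] := reg u (W u uT).
    have H := has_deriv_on_interior uT (ceq u x (W u uT)).
    rewrite (aE u (W u uT)) in H.
    by rewrite (div_p_gradV_sqr x (Ck_le two_le hV) (Ck_le two_le ha)) in H.
  (* The three time-continuity hypotheses are used here, one for each ingredient of
     [half_commutator]. *)
  + move=> u uT; have Wi := continuous_within_interior uT.
    apply: cvgMl_tmp; apply: cvgB; last by apply: Wi; exact: clVa.
    by apply: cvgM; apply: Wi; [exact: cV|exact: cla].
  + move=> u uT pu; have [ha hV] := reg u (W u uT).
    apply: (half_commutator_at_zero (Ck_le two_le hV) (Ck_le two_le ha)).
      by move=> y; exact: sqrtr_ge0.
    by rewrite /a pu sqrtr0.
- move=> k; apply: has_deriv_on_continuous => t tT.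
  by have [z [[H _] _]] := dphi t tT k; eexists; exact: H.
- move=> k; apply: has_deriv_on_continuous => t tT.
  by have [z [[_ H] _]] := dphi t tT k; eexists; exact: H.
- move=> t tT k; have [z [[H _] zE]] := dphi t (W t tT) k.
  rewrite opapp_Hc in zE.
  have -> : \sum_j generator L (V t) k j * phi t j = z.
    by apply: (@mulfI _ ('i)%C); [rewrite eq_complex /= negb_and oner_eq0 orbT|rewrite zE].
  exact: has_deriv_on_interior H.
- move=> t tT k; have [z [[_ H] zE]] := dphi t (W t tT) k.
  rewrite opapp_Hc in zE.
  have -> : \sum_j generator L (V t) k j * phi t j = z.
    by apply: (@mulfI _ ('i)%C); [rewrite eq_complex /= negb_and oner_eq0 orbT|rewrite zE].
  exact: has_deriv_on_interior H.
- rewrite phi0E; have := phi01; rewrite /vnorm => H.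
  have S0 : 0 <= \sum_k nsq (phi0 k) by apply: sumr_ge0 => k _; exact: nsq_ge0.
  by rewrite -[LHS](sqr_sqrtr S0) H expr1n.
- move=> t tT; rewrite -(pmulr_rgt0 _ w0); apply: lt_le_trans (mass t tT).
  by rewrite invr_gt0.
- move=> t tT; have tT' := W t tT; have [ha hV] := reg t tT'.
  rewrite -(ler_pM2l w0).
  apply: le_trans (residual_le d0 N0 eN L0 ds (pa t tT') (per t tT').2 ha hV) _.
  rewrite [leRHS]mulrCA -/(B t).
  (* The residual is at most [(B t * eps)^2 / 8], hence at most [beta^2 / 4], and [1/4] is the lower
     bound for the mass. *)
  apply: (@le_trans _ _ (beta ^+ 2 * 4^-1)); last first.
    by rewrite ler_wpM2l ?sqr_ge0// mass.
  have -> : (4 * s = (2 * s) * 2)%N by rewrite mulnAC.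
  rewrite exprM -/q -/eps.
  have Be : B t * eps <= beta.
    by rewrite ler_wpM2r ?(ltW eps0)//; have := Bs t tT'; lra.
  have Be0 : 0 <= B t * eps by rewrite mulr_ge0 ?(ltW eps0)// B0.
  rewrite mulrA -exprMn; move: (B t * eps) Be Be0 => y yb y0; nra.
Qed.
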